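(* Let $\Lambda$ be a compact path-connected metric space and let $f_n\colon\Lambda\times\mathbb{R}^d\to\mathbb{R}^d$, $n\in\mathbb{Z}$, be continuous with $f_n(\lambda,0)=0$ for all $n,\lambda$, satisfying (F0)–(F3). If $$J(\operatorname{IM}\mathbb{P}^+(\overline{\kappa}))\neq J(\operatorname{IM}\mathbb{P}^-(\underline{\kappa}))\in J(\Lambda),$$ where $\mathbb{P}^\pm,\overline{\kappa},\underline{\kappa}$ are as in (F2), then the equation $\phi(n+1)=f_n(\lambda,\phi(n))$, $n\in\mathbb{Z}$, has a bifurcation point from the trivial branch, i.e. there is $\lambda_*\in\Lambda$ such that every neighborhood of $(\lambda_*,0)$ in $\Lambda\times\ell_0(\mathbb{R}^d)$ contains $(\lambda,\phi)$ with $\phi\neq0$ and $\phi(n+1)=f_n(\lambda,\phi(n))$ for all $n$.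
   Context: $\ell_0(\mathbb{R}^d)$: sequences $\mathbb{Z}\to\mathbb{R}^d$ converging to $0$ at $\pm\infty$, sup norm. $D_d(0,r)$: closed ball in $\mathbb{R}^d$. $\mathbb{Z}^+_\kappa=\mathbb{Z}\cap[\kappa,\infty)$, $\mathbb{Z}^-_\kappa=\mathbb{Z}\cap(-\infty,\kappa]$. (F0): each $f_n$ is differentiable in the second variable with $D_2f_n$ continuous on $\Lambda\times\mathbb{R}^d$. (F1): there is $r_0>0$ such that $\{f_n\}_n$ is equicontinuous on $\Lambda\times D_d(0,r_0)$ and $\{D_2f_n\}_n$ is equicontinuous and pointwise bounded on $\Lambda\times D_d(0,r_0)$. Let $\mathbb{A}_n(\lambda):=D_2f_n(\lambda,0)$. (F2): $\mathbb{A}$ has an exponential dichotomy on $\mathbb{Z}^+_{\overline{\kappa}}$ and on $\mathbb{Z}^-_{\underline{\kappa}}$, for some $\underline{\kappa}<0<\overline{\kappa}$, with parametrized projectors $\mathbb{P}^+\colon\Lambda\times\mathbb{Z}^+_{\overline{\kappa}}\to\mathcal{L}(\mathbb{R}^d)$, $\mathbb{P}^-\colon\Lambda\times\mathbb{Z}^-_{\underline{\kappa}}\to\mathcal{L}(\mathbb{R}^d)$. (F3): there is $\lambda_0\in\Lambda$ such that $\mathbb{A}(\lambda_0)$ has an exponential dichotomy on all of $\mathbb{Z}$. Definitions: for $\mathbb{B}\colon\mathbb{Z}\to\mathcal{L}(\mathbb{R}^d)$, $\Phi(k,n)=\mathbb{B}_{k-1}\cdots\mathbb{B}_n$ ($k>n$),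 $\Phi(n,n)=\mathrm{id}$. A projector on $\mathbb{I}\subset\mathbb{Z}$ is $\mathbb{P}\colon\mathbb{I}\to\mathcal{L}(\mathbb{R}^d)$ with $\mathbb{P}(n)^2=\mathbb{P}(n)$; invariant if $\mathbb{B}_n\mathbb{P}(n)=\mathbb{P}(n+1)\mathbb{B}_n$ whenever $n,n+1\in\mathbb{I}$ and $\sup\|\mathbb{P}(n)\|<\infty$; regular if moreover $\mathbb{B}_n|_{\ker\mathbb{P}(n)}\colon\ker\mathbb{P}(n)\to\ker\mathbb{P}(n+1)$ is an isomorphism. $\mathbb{B}$ has an ED on $\mathbb{I}$ if there are an invariant regular projector $\mathbb{P}$, $K\geq1$, $\alpha\in(0,1)$ with $|\Phi(k,n)\mathbb{P}(n)x|\leq K\alpha^{k-n}|\mathbb{P}(n)x|$ and $|\Phi(k,n)(I-\mathbb{P}(n))x|\geq K^{-1}\alpha^{-(k-n)}|(I-\mathbb{P}(n))x|$ for $k\geq n$ in $\mathbb{I}$. For a parametrized field, an ED on $\mathbb{I}$ with parametrized projector $\mathbb{P}\colon\Lambda\times\mathbb{I}\to\mathcal{L}(\mathbb{R}^d)$ means each $\mathbb{P}_n\colon\Lambda\to\mathcal{L}(\mathbb{R}^d)$ is continuous and, with $K,\alpha$ independent of $\lambda$, each $\mathbb{A}(\lambda)$ has an ED on $\mathbb{I}$ w.r.t. $\mathbb{P}(\lambda)$. $\operatorname{IM}\mathbb{P}^\pm(\kappa):=\{(\lambda,x): x\in\operatorname{im}\mathbb{P}^\pm(\lambda,\kappa)\}$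 (a vector bundle over $\Lambda$). $\widetilde{KO}(\Lambda)$ is the reduced real K-group (classes $[E]-[F]$ with $\operatorname{rank}E=\operatorname{rank}F$). $J(\Lambda)$ is the quotient of $\widetilde{KO}(\Lambda)$ by the subgroup generated by $[E]-[F]$ with $E,F$ stably fibrewise homotopy equivalent (i.e. the sphere bundles of $E\oplus\Theta(\mathbb{R}^n)$ and $F\oplus\Theta(\mathbb{R}^m)$ are fibre-homotopy equivalent for some $n,m$), and $J\colon\widetilde{KO}(\Lambda)\to J(\Lambda)$ is the quotient map; for a bundle $E$ of rank $r$ write $J(E):=J([E]-[\Theta(\mathbb{R}^r)])$, $\Theta(\mathbb{R}^r)=\Lambda\times\mathbb{R}^r$. *)

(* Defs.v *)
From Stdlib Require Import Reals ZArith List.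
Open Scope R_scope.

(* Finite-dimensional linear algebra.  A vector of R^N is represented  *)
(* by nat -> R whose coordinates >= N vanish ([supp N]); an N x N      *)
(* matrix by nat -> nat -> R of which only entries (i,j), i,j<N, are    *)
(* ever read.  All operations below are truncated to the dimension.    *)

Fixpoint sumn (n : nat) (g : nat -> R) : R :=
  match n with O => 0 | S m => sumn m g + g m end.

Definition vec := nat -> R.
Definition mat := nat -> nat -> R.

Definition zerov : vec := fun _ => 0.
Definition supp (N : nat) (v : vec) : Prop := forall i, (N <= i)%nat -> v i = 0.
Definition eqv (N : nat) (u v : vec) : Prop := forall i, (i < N)%nat -> u i = v i.
Definition vadd (u v : vec) : vec := fun i => u i + v i.
Definition vsub (u v : vec) : vec := fun i => u i - v i.
Definition vnorm (N : nat) (v : vec) : R := sqrt (sumn N (fun i => v i ^ 2)).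

Definition mvr (m n : nat) (A : mat) (v : vec) : vec :=
  fun i => if Nat.ltb i m then sumn n (fun j => A i j * v j) else 0.
Definition mv (N : nat) (A : mat) (v : vec) : vec := mvr N N A v.
Definition mm (N : nat) (A B : mat) : mat :=
  fun i j => if andb (Nat.ltb i N) (Nat.ltb j N)
             then sumn N (fun l => A i l * B l j) else 0.
Definition idm (N : nat) : mat :=
  fun i j => if andb (andb (Nat.ltb i N) (Nat.ltb j N)) (Nat.eqb i j) then 1 else 0.
Definition msub (A B : mat) : mat := fun i j => A i j - B i j.
Definition meq (N : nat) (A B : mat) : Prop :=
  forall i j, (i < N)%nat -> (j < N)%nat -> A i j = B i j.
Definition mnorm (N : nat) (A : mat) : R :=
  sqrt (sumn N (fun i => sumn N (fun j => A i j ^ 2))).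

Definition is_metric {L : Type} (dist : L -> L -> R) : Prop :=
  (forall x y, dist x y = 0 <-> x = y) /\
  (forall x y, dist x y = dist y x) /\
  (forall x y z, dist x z <= dist x y + dist y z).

Definition mis_open {L : Type} (dist : L -> L -> R) (U : L -> Prop) : Prop :=
  forall x, U x -> exists eps, 0 < eps /\ forall y, dist x y < eps -> U y.

Definition mcompact {L : Type} (dist : L -> L -> R) : Prop :=
  forall (I : Type) (U : I -> L -> Prop),
    (forall i, mis_open dist (U i)) -> (forall x, exists i, U i x) ->
    exists l : list I, forall x, exists i, In i l /\ U i x.

Definition mpath_connected {L : Type} (dist : L -> L -> R) : Prop :=
  forall x y, exists p : R -> L, p 0 = x /\ p 1 = y /\
    forall t, 0 <= t <= 1 -> forall eps, 0 < eps -> exists del, 0 < del /\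
      forall t', 0 <= t' <= 1 -> Rabs (t' - t) < del -> dist (p t) (p t') < eps.

Definition cont_L {L : Type} (dist : L -> L -> R) (g : L -> R) : Prop :=
  forall x eps, 0 < eps -> exists del, 0 < del /\
    forall y, dist x y < del -> Rabs (g y - g x) < eps.

Definition contf_on {L : Type} (dist : L -> L -> R) (d : nat)
  (D : L -> vec -> Prop) (g : L -> vec -> vec) : Prop :=
  forall l x, D l x -> forall eps, 0 < eps -> exists del, 0 < del /\
    forall l' x', D l' x' -> dist l l' + vnorm d (vsub x' x) < del ->
      vnorm d (vsub (g l' x') (g l x)) < eps.

Definition contm_on {L : Type} (dist : L -> L -> R) (d : nat)
  (D : L -> vec -> Prop) (g : L -> vec -> mat) : Prop :=
  forall l x, D l x -> forall eps, 0 < eps -> exists del, 0 < del /\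
    forall l' x', D l' x' -> dist l l' + vnorm d (vsub x' x) < del ->
      mnorm d (msub (g l' x') (g l x)) < eps.

Definition equicontf_on {L : Type} (dist : L -> L -> R) (d : nat)
  (D : L -> vec -> Prop) (g : Z -> L -> vec -> vec) : Prop :=
  forall l x, D l x -> forall eps, 0 < eps -> exists del, 0 < del /\
    forall n l' x', D l' x' -> dist l l' + vnorm d (vsub x' x) < del ->
      vnorm d (vsub (g n l' x') (g n l x)) < eps.

Definition equicontm_on {L : Type} (dist : L -> L -> R) (d : nat)
  (D : L -> vec -> Prop) (g : Z -> L -> vec -> mat) : Prop :=
  forall l x, D l x -> forall eps, 0 < eps -> exists del, 0 < del /\
    forall n l' x', D l' x' -> dist l l' + vnorm d (vsub x' x) < del ->
      mnorm d (msub (g n l' x') (g n l x)) < eps.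

Definition ptwise_boundedm_on {L : Type} (d : nat)
  (D : L -> vec -> Prop) (g : Z -> L -> vec -> mat) : Prop :=
  forall l x, D l x -> exists C, forall n, mnorm d (g n l x) <= C.

Definition whole_space {L : Type} (d : nat) : L -> vec -> Prop :=
  fun _ x => supp d x.
Definition closed_ball {L : Type} (d : nat) (r : R) : L -> vec -> Prop :=
  fun _ x => supp d x /\ vnorm d x <= r.

Definition is_deriv (d : nat) (g : vec -> vec) (x : vec) (A : mat) : Prop :=
  forall eps, 0 < eps -> exists del, 0 < del /\
    forall h, supp d h -> vnorm d h < del ->
      vnorm d (vsub (vsub (g (vadd x h)) (g x)) (mv d A h)) <= eps * vnorm d h.

Definition Zge (k : Z) : Z -> Prop := fun n => (k <= n)%Z.
Definition Zle (k : Z) : Z -> Prop := fun n => (n <= k)%Z.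
Definition Zall : Z -> Prop := fun _ => True.

(* Phi_aux B n m = B_{n+m-1} ... B_n ;  Phi B k n = Phi(k,n) for k >= n *)
Fixpoint Phi_aux (d : nat) (B : Z -> mat) (n : Z) (m : nat) : mat :=
  match m with
  | O => idm d
  | S m' => mm d (B (n + Z.of_nat m')%Z) (Phi_aux d B n m')
  end.
Definition Phi (d : nat) (B : Z -> mat) (k n : Z) : mat :=
  Phi_aux d B n (Z.to_nat (k - n)).

Definition projector (d : nat) (I : Z -> Prop) (P : Z -> mat) : Prop :=
  forall n, I n -> meq d (mm d (P n) (P n)) (P n).

Definition invariant_proj (d : nat) (B : Z -> mat) (I : Z -> Prop) (P : Z -> mat) : Prop :=
  projector d I P /\
  (forall n, I n -> I (n + 1)%Z ->
     meq d (mm d (B n) (P n)) (mm d (P (n + 1)%Z) (B n))) /\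
  (exists C, forall n, I n -> mnorm d (P n) <= C).

Definition in_ker (d : nat) (A : mat) (x : vec) : Prop :=
  supp d x /\ eqv d (mv d A x) zerov.

Definition regular_proj (d : nat) (B : Z -> mat) (I : Z -> Prop) (P : Z -> mat) : Prop :=
  invariant_proj d B I P /\
  forall n, I n -> I (n + 1)%Z ->
    (forall x, in_ker d (P n) x -> in_ker d (P (n + 1)%Z) (mv d (B n) x)) /\
    (forall x, in_ker d (P n) x -> eqv d (mv d (B n) x) zerov -> eqv d x zerov) /\
    (forall y, in_ker d (P (n + 1)%Z) y ->
       exists x, in_ker d (P n) x /\ eqv d (mv d (B n) x) y).

Definition ED_wrt (d : nat) (B : Z -> mat) (I : Z -> Prop) (P : Z -> mat)
  (K al : R) : Prop :=
  regular_proj d B I P /\ 1 <= K /\ 0 < al < 1 /\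
  forall k n, I k -> I n -> (n <= k)%Z -> forall x, supp d x ->
    vnorm d (mv d (Phi d B k n) (mv d (P n) x))
      <= K * powerRZ al (k - n) * vnorm d (mv d (P n) x) /\
    vnorm d (mv d (Phi d B k n) (mv d (msub (idm d) (P n)) x))
      >= / K * powerRZ al (- (k - n)) * vnorm d (mv d (msub (idm d) (P n)) x).

Definition has_ED (d : nat) (B : Z -> mat) (I : Z -> Prop) : Prop :=
  exists P K al, ED_wrt d B I P K al.

Definition param_ED {L : Type} (dist : L -> L -> R) (d : nat)
  (A : L -> Z -> mat) (I : Z -> Prop) (P : L -> Z -> mat) : Prop :=
  (forall n, I n -> forall i j, (i < d)%nat -> (j < d)%nat ->
     cont_L dist (fun l => P l n i j)) /\
  exists K al, forall l, ED_wrt d (A l) I (P l) K al.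

(* Vector bundles over L, modelled as images of continuous projector   *)
(* families L -> M_N(R) (every real vector bundle over a mcompact       *)
(* Hausdorff space is isomorphic to such a subbundle of a trivial one) *)

Record bundle (L : Type) := mkBundle { bN : nat; bQ : L -> mat }.
Arguments mkBundle {L} _ _.
Arguments bN {L} _.
Arguments bQ {L} _ _ _ _.

Definition is_bundle {L : Type} (dist : L -> L -> R) (E : bundle L) : Prop :=
  (forall l i j, (bN E <= i \/ bN E <= j)%nat -> bQ E l i j = 0) /\
  (forall i j, cont_L dist (fun l => bQ E l i j)) /\
  (forall l, meq (bN E) (mm (bN E) (bQ E l) (bQ E l)) (bQ E l)).

Definition fiber {L : Type} (E : bundle L) (l : L) (v : vec) : Prop :=
  supp (bN E) v /\ eqv (bN E) (mv (bN E) (bQ E l) v) v.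

Definition lin_indep (N r : nat) (b : nat -> vec) : Prop :=
  forall c : nat -> R,
    eqv N (fun i => sumn r (fun k => c k * b k i)) zerov ->
    forall k, (k < r)%nat -> c k = 0.

Definition bundle_rank {L : Type} (E : bundle L) (r : nat) : Prop :=
  forall l, exists b : nat -> vec,
    (forall k, (k < r)%nat -> fiber E l (b k)) /\
    lin_indep (bN E) r b /\
    forall v, fiber E l v ->
      exists c : nat -> R, eqv (bN E) v (fun i => sumn r (fun k => c k * b k i)).

Definition bundle_iso {L : Type} (dist : L -> L -> R) (E F : bundle L) : Prop :=
  exists T S : L -> mat,
    (forall i j, cont_L dist (fun l => T l i j)) /\
    (forall i j, cont_L dist (fun l => S l i j)) /\
    forall l,
      (forall v, fiber E l v ->
         fiber F l (mvr (bN F) (bN E) (T l) v) /\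
         eqv (bN E) (mvr (bN E) (bN F) (S l) (mvr (bN F) (bN E) (T l) v)) v) /\
      (forall w, fiber F l w ->
         fiber E l (mvr (bN E) (bN F) (S l) w) /\
         eqv (bN F) (mvr (bN F) (bN E) (T l) (mvr (bN E) (bN F) (S l) w)) w).

Definition bsum {L : Type} (E F : bundle L) : bundle L :=
  mkBundle (bN E + bN F)
    (fun l i j =>
       if andb (Nat.ltb i (bN E)) (Nat.ltb j (bN E)) then bQ E l i j
       else if andb (Nat.leb (bN E) i) (Nat.leb (bN E) j)
            then bQ F l (i - bN E)%nat (j - bN E)%nat
            else 0).

Definition triv {L : Type} (n : nat) : bundle L := mkBundle n (fun _ => idm n).

Definition bsums {L : Type} (Es : list (bundle L)) : bundle L :=
  fold_right bsum (triv 0) Es.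

Definition sph {L : Type} (E : bundle L) (l : L) (v : vec) : Prop :=
  fiber E l v /\ vnorm (bN E) v = 1.

Definition fib_map {L : Type} (E F : bundle L) (g : L -> vec -> vec) : Prop :=
  forall l v, sph E l v -> sph F l (g l v).

Definition cont_on_sph {L : Type} (dist : L -> L -> R) (E F : bundle L)
  (g : L -> vec -> vec) : Prop :=
  forall l v, sph E l v -> forall eps, 0 < eps -> exists del, 0 < del /\
    forall l' v', sph E l' v' -> dist l l' + vnorm (bN E) (vsub v' v) < del ->
      vnorm (bN F) (vsub (g l' v') (g l v)) < eps.

Definition fib_homotopic_id {L : Type} (dist : L -> L -> R) (E : bundle L)
  (g : L -> vec -> vec) : Prop :=
  exists H : R -> L -> vec -> vec,
    (forall t l v, 0 <= t <= 1 -> sph E l v -> sph E l (H t l v)) /\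
    (forall t l v, 0 <= t <= 1 -> sph E l v ->
       forall eps, 0 < eps -> exists del, 0 < del /\
         forall t' l' v', 0 <= t' <= 1 -> sph E l' v' ->
           Rabs (t' - t) + dist l l' + vnorm (bN E) (vsub v' v) < del ->
           vnorm (bN E) (vsub (H t' l' v') (H t l v)) < eps) /\
    (forall l v, sph E l v -> eqv (bN E) (H 0 l v) (g l v)) /\
    (forall l v, sph E l v -> eqv (bN E) (H 1 l v) v).

Definition fhe {L : Type} (dist : L -> L -> R) (E F : bundle L) : Prop :=
  exists phi psi : L -> vec -> vec,
    fib_map E F phi /\ fib_map F E psi /\
    cont_on_sph dist E F phi /\ cont_on_sph dist F E psi /\
    fib_homotopic_id dist E (fun l v => psi l (phi l v)) /\
    fib_homotopic_id dist F (fun l w => phi l (psi l w)).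

Definition stably_fhe {L : Type} (dist : L -> L -> R) (E F : bundle L) : Prop :=
  exists n m, fhe dist (bsum E (triv n)) (bsum F (triv m)).

(* [A] - [B] = [A'] - [B'] in KO(L) *)
Definition ko_eq {L : Type} (dist : L -> L -> R) (A B A' B' : bundle L) : Prop :=
  exists G, is_bundle dist G /\
    bundle_iso dist (bsum (bsum A B') G) (bsum (bsum A' B) G).

(* generators [E'] - [F'] of the kernel of J : KO~(L) -> J(L) *)
Definition J_generator {L : Type} (dist : L -> L -> R) (p : bundle L * bundle L) : Prop :=
  is_bundle dist (fst p) /\ is_bundle dist (snd p) /\
  (exists r, bundle_rank (fst p) r /\ bundle_rank (snd p) r) /\
  stably_fhe dist (fst p) (snd p).

(* J(E) = J(F), where E has rank r and F has rank s:
   ([E] - [Theta^r]) - ([F] - [Theta^s]) = [E + Theta^s] - [F + Theta^r]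
   lies in the subgroup generated by the J_generators, i.e. equals a
   finite signed sum  sum_i eps_i ([E_i] - [F_i]). *)
Definition J_eq {L : Type} (dist : L -> L -> R) (E : bundle L) (r : nat)
  (F : bundle L) (s : nat) : Prop :=
  exists gens : list (bool * (bundle L * bundle L)),
    (forall g, In g gens -> J_generator dist (snd g)) /\
    ko_eq dist (bsum E (triv s)) (bsum F (triv r))
      (bsums (map (fun g : bool * (bundle L * bundle L) => if fst g then fst (snd g) else snd (snd g)) gens))
      (bsums (map (fun g : bool * (bundle L * bundle L) => if fst g then snd (snd g) else fst (snd g)) gens)).

Definition IM {L : Type} (d : nat) (P : L -> Z -> mat) (k : Z) : bundle L :=
  mkBundle d (fun l i j =>
    if andb (Nat.ltb i d) (Nat.ltb j d) then P l k i j else 0).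

Definition ell0 (d : nat) (phi : Z -> vec) : Prop :=
  (forall n, supp d (phi n)) /\
  (forall eps, 0 < eps -> exists N : Z, forall n, (N <= Z.abs n)%Z -> vnorm d (phi n) < eps).

Definition is_bifurcation_point {L : Type} (dist : L -> L -> R) (d : nat)
  (f : Z -> L -> vec -> vec) (ls : L) : Prop :=
  forall del, 0 < del -> exists (l : L) (phi : Z -> vec),
    dist l ls < del /\ ell0 d phi /\ (forall n, vnorm d (phi n) < del) /\
    (exists n i, (i < d)%nat /\ phi n i <> 0) /\
    forall n, eqv d (phi (n + 1)%Z) (f n l (phi n)).

(* Main.v *)
Require Import Defs.
From Stdlib Require Import Reals ZArith List.
From Stdlib Require Import Lra Lia Psatz Classical IndefiniteDescription FunctionalExtensionality Permutation.
Open Scope R_scope.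

(* Suppose that there is no bifurcation point.  On a window [-N, N] consider the map sending a
   finite sequence phi to the defects phi(n+1) - f_n(phi(n)), to P^-(-N) phi(-N) and to
   (I - P^+(N)) phi(N); over L it is a fibrewise map from a trivial bundle to the bundle
   Y = Theta + im P^-(-N) + ker P^+(N).  By the dichotomies its zeros decay exponentially away
   from 0 at a rate independent of N, so if it had zeros of a fixed small norm for arbitrarily
   large N, then a cluster point of them would be a small nonzero homoclinic solution.  Hence,
   for some N, it is a map of sphere bundles.  Over the parameter in (F3) it is homotopic to
   its linearization, which is an isomorphism; since L is path connected and the bundles are
   locally trivial, it is a homotopy equivalence on every fibre, and by Dold's theorem a fibre
   homotopy equivalence.  As ker P^+(N) and ker P^-(-N) are isomorphic to ker P^+(kh) and
   ker P^-(kl), this says that im P^+(kh) and im P^-(kl) have the same J-class. *)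

(** * Vectors and matrices *)

(** The linearized maps need not be invertible, so the flow compares the kernels of the projectors
    at different times, but not their images. Hence the K-theoretic comparison passes to kernels and
    adds [KER d Pm kl] on both sides; it reads [[IM P+] - [IM P-] = [Theta^M] - [Y]], and the
    right-hand side is a generator of the kernel of [J] once the two sphere bundles are equivalent.
    The constants are chosen in an order that makes them independent of the window. The dichotomies
    bound the projectors for each parameter separately; a uniform bound is extracted from [K], [al]
    and a uniform bound on the linearization. It yields a tolerance [e] and a decay rate valid on
    every long window. Then the radius [eta] of the sphere is fixed, so small that the nonlinearity
    is an [e]-perturbation of its linearization and that no nonzero homoclinic solution of this size
    exists; the window comes last. As [e] also serves at the parameter of (F3), where the dichotomy
    on [Z] excludes nonzero zeros of every [e]-perturbation, the homotopy to the linearization has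
    no zeros on the sphere. *)

Definition vscal (c : R) (v : vec) : vec := fun i => c * v i.
Definition vtrunc (n : nat) (v : vec) : vec := fun i => if Nat.ltb i n then v i else 0.

Lemma sumn_ext (n : nat) (g h : nat -> R) :
  (forall i, (i < n)%nat -> g i = h i) -> sumn n g = sumn n h.
Proof.
  induction n as [|n IH]; simpl; intros H; [reflexivity|].
  rewrite IH, H; auto with arith.
Qed.

Lemma sumn_plus (n : nat) (g h : nat -> R) :
  sumn n (fun i => g i + h i) = sumn n g + sumn n h.
Proof. induction n as [|n IH]; simpl; [ring|rewrite IH; ring]. Qed.

Lemma sumn_scal (n : nat) (c : R) (g : nat -> R) :
  sumn n (fun i => c * g i) = c * sumn n g.
Proof. induction n as [|n IH]; simpl; [ring|rewrite IH; ring]. Qed.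

Lemma sumn_zero (n : nat) (g : nat -> R) :
  (forall i, (i < n)%nat -> g i = 0) -> sumn n g = 0.
Proof.
  intros H; rewrite (sumn_ext n g (fun _ => 0 * 0)), sumn_scal by (intros; rewrite H; auto; ring).
  ring.
Qed.

Lemma sumn_le (n : nat) (g h : nat -> R) :
  (forall i, (i < n)%nat -> g i <= h i) -> sumn n g <= sumn n h.
Proof.
  induction n as [|n IH]; simpl; intros H; [lra|].
  apply Rplus_le_compat; [apply IH|apply H]; auto with arith.
Qed.

Lemma sumn_nonneg (n : nat) (g : nat -> R) :
  (forall i, (i < n)%nat -> 0 <= g i) -> 0 <= sumn n g.
Proof.
  intros H; replace 0 with (sumn n (fun _ => 0)) by (apply sumn_zero; auto).
  now apply sumn_le.
Qed.

Lemma sumn_term_le (n k : nat) (g : nat -> R) :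
  (forall i, (i < n)%nat -> 0 <= g i) -> (k < n)%nat -> g k <= sumn n g.
Proof.
  induction n as [|n IH]; simpl; intros H Hk; [lia|].
  assert (0 <= sumn n g) by (apply sumn_nonneg; auto with arith).
  assert (0 <= g n) by auto with arith.
  destruct (Nat.eq_dec k n) as [->|Hn]; [lra|].
  assert (g k <= sumn n g) by (apply IH; [auto with arith|lia]).
  lra.
Qed.

Lemma sumn_swap (n m : nat) (g : nat -> nat -> R) :
  sumn n (fun i => sumn m (fun j => g i j)) = sumn m (fun j => sumn n (fun i => g i j)).
Proof.
  induction n as [|n IH]; simpl.
  - symmetry; now apply sumn_zero.
  - now rewrite IH, <- sumn_plus.
Qed.

Lemma sumn_app (n m : nat) (g : nat -> R) :
  sumn (n + m) g = sumn n g + sumn m (fun i => g (n + i)%nat).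
Proof.
  induction m as [|m IH]; simpl.
  - rewrite Nat.add_0_r; ring.
  - rewrite Nat.add_succ_r; simpl; rewrite IH; ring.
Qed.

Lemma sumn_delta (n k : nat) (g : nat -> R) :
  (k < n)%nat -> (forall i, (i < n)%nat -> i <> k -> g i = 0) -> sumn n g = g k.
Proof.
  induction n as [|n IH]; simpl; intros Hk H; [lia|].
  destruct (Nat.eq_dec k n) as [->|Hn].
  - rewrite sumn_zero; [ring|]. intros i Hi; apply H; lia.
  - rewrite IH, (H n); [ring|lia|lia|lia|]. intros i Hi Hik; apply H; lia.
Qed.

Lemma sumn_const (n : nat) (c : R) : sumn n (fun _ => c) = INR n * c.
Proof. induction n as [|n IH]; [simpl; ring|]. rewrite S_INR; simpl; rewrite IH; ring. Qed.

Definition dot (n : nat) (u v : vec) : R := sumn n (fun i => u i * v i).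

Lemma vnorm_sqr (n : nat) (v : vec) : vnorm n v ^ 2 = sumn n (fun i => v i ^ 2).
Proof.
  unfold vnorm; rewrite <- Rsqr_pow2, Rsqr_sqrt; [reflexivity|].
  apply sumn_nonneg; intros; apply pow2_ge_0.
Qed.

Lemma vnorm_nonneg (n : nat) (v : vec) : 0 <= vnorm n v.
Proof. apply sqrt_pos. Qed.

Lemma Rle_of_sqr (x y : R) : 0 <= y -> x ^ 2 <= y ^ 2 -> x <= y.
Proof. intros Hy H; destruct (Rle_or_lt x y); [assumption|nra]. Qed.

(** Cauchy-Schwarz, one coordinate at a time: the mixed term [2 * S * a * b] is at most
    [A * b ^ 2 + B * a ^ 2], by [S ^ 2 <= A * B] and the arithmetic-geometric mean inequality. *)
Lemma dot_sqr_le (n : nat) (u v : vec) : dot n u v ^ 2 <= dot n u u * dot n v v.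
Proof.
  unfold dot; induction n as [|n IH]; simpl sumn; [simpl; lra|].
  set (S := sumn n (fun i => u i * v i)) in *.
  assert (HA : 0 <= sumn n (fun i => u i * u i)) by (apply sumn_nonneg; intros; nra).
  assert (HB : 0 <= sumn n (fun i => v i * v i)) by (apply sumn_nonneg; intros; nra).
  set (A := sumn n (fun i => u i * u i)) in *. set (B := sumn n (fun i => v i * v i)) in *.
  set (a := u n). set (b := v n).
  assert (2 * S * a * b <= A * b ^ 2 + B * a ^ 2).
  { apply Rle_of_sqr; [nra|].
    assert (S ^ 2 * (a ^ 2 * b ^ 2) <= A * B * (a ^ 2 * b ^ 2)) by (apply Rmult_le_compat_r; nra).
    assert (0 <= (A * b ^ 2 - B * a ^ 2) ^ 2) by apply pow2_ge_0.
    nra. }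
  nra.
Qed.

Lemma dot_self (n : nat) (u : vec) : dot n u u = vnorm n u ^ 2.
Proof. rewrite vnorm_sqr; apply sumn_ext; intros; ring. Qed.

Lemma dot_le (n : nat) (u v : vec) : dot n u v <= vnorm n u * vnorm n v.
Proof.
  apply Rle_of_sqr; [apply Rmult_le_pos; apply vnorm_nonneg|].
  rewrite Rpow_mult_distr, <- !dot_self; apply dot_sqr_le.
Qed.

Lemma vnorm_ext (n : nat) (u v : vec) : eqv n u v -> vnorm n u = vnorm n v.
Proof. intros H; unfold vnorm; f_equal; apply sumn_ext; intros; now rewrite H. Qed.

Lemma vnorm_zero (n : nat) : vnorm n zerov = 0.
Proof.
  unfold vnorm; rewrite sumn_zero; [apply sqrt_0|]. intros; unfold zerov; ring.
Qed.

Lemma vnorm_zero_eqv (n : nat) (v : vec) : vnorm n v = 0 -> eqv n v zerov.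
Proof.
  intros H i Hi. assert (v i ^ 2 <= 0).
  { replace 0 with (vnorm n v ^ 2) by (rewrite H; ring). rewrite vnorm_sqr.
    apply (sumn_term_le n i (fun i => v i ^ 2)); auto. intros; apply pow2_ge_0. }
  unfold zerov; nra.
Qed.

Lemma vnorm_scal (n : nat) (c : R) (v : vec) : vnorm n (vscal c v) = Rabs c * vnorm n v.
Proof.
  apply Rsqr_inj; [apply vnorm_nonneg|apply Rmult_le_pos; [apply Rabs_pos|apply vnorm_nonneg]|].
  rewrite !Rsqr_pow2, Rpow_mult_distr, <- (Rsqr_pow2 (Rabs c)), <- Rsqr_abs, Rsqr_pow2, !vnorm_sqr.
  rewrite <- sumn_scal; apply sumn_ext; intros; unfold vscal; ring.
Qed.

Lemma vnorm_triang (n : nat) (u v : vec) : vnorm n (vadd u v) <= vnorm n u + vnorm n v.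
Proof.
  pose proof (vnorm_nonneg n u). pose proof (vnorm_nonneg n v).
  apply Rle_of_sqr; [lra|].
  assert (vnorm n (vadd u v) ^ 2 = vnorm n u ^ 2 + vnorm n v ^ 2 + 2 * dot n u v).
  { rewrite !vnorm_sqr; unfold dot; rewrite <- sumn_scal, <- !sumn_plus.
    apply sumn_ext; intros; unfold vadd; ring. }
  pose proof (dot_le n u v). nra.
Qed.

Lemma vnorm_sub_sym (n : nat) (u v : vec) : vnorm n (vsub u v) = vnorm n (vsub v u).
Proof.
  unfold vnorm; f_equal; apply sumn_ext; intros; unfold vsub; ring.
Qed.

Lemma vnorm_triang_sub (n : nat) (u v : vec) : vnorm n u <= vnorm n v + vnorm n (vsub u v).
Proof.
  rewrite (vnorm_ext n u (vadd v (vsub u v))); [apply vnorm_triang|].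
  intros i _; unfold vadd, vsub; ring.
Qed.

Lemma vnorm_sub_le (n : nat) (u v : vec) : vnorm n (vsub u v) <= vnorm n u + vnorm n v.
Proof.
  rewrite (vnorm_ext n _ (vadd u (vscal (-1) v))).
  - eapply Rle_trans; [apply vnorm_triang|]. rewrite vnorm_scal, Rabs_left; lra.
  - intros i _; unfold vadd, vsub, vscal; ring.
Qed.

Lemma vnorm_sub_triang (n : nat) (u v w : vec) :
  vnorm n (vsub u w) <= vnorm n (vsub u v) + vnorm n (vsub v w).
Proof.
  rewrite (vnorm_ext n _ (vadd (vsub u v) (vsub v w))); [apply vnorm_triang|].
  intros i _; unfold vadd, vsub; ring.
Qed.

Lemma coord_le_vnorm (n i : nat) (v : vec) : (i < n)%nat -> Rabs (v i) <= vnorm n v.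
Proof.
  intros Hi; apply Rle_of_sqr; [apply vnorm_nonneg|].
  rewrite pow2_abs, vnorm_sqr.
  apply (sumn_term_le n i (fun i => v i ^ 2)); auto. intros; apply pow2_ge_0.
Qed.

Lemma vnorm_le_sumn (n : nat) (v : vec) : vnorm n v <= sumn n (fun i => Rabs (v i)).
Proof.
  assert (Hp : forall m, 0 <= sumn m (fun i => Rabs (v i)))
    by (intros; apply sumn_nonneg; intros; apply Rabs_pos).
  apply Rle_of_sqr; [auto|]. rewrite vnorm_sqr.
  induction n as [|n IH]; [simpl; lra|].
  cbn [sumn]. specialize (Hp n). pose proof (Rabs_pos (v n)). pose proof (pow2_abs (v n)).
  set (x := sumn n (fun i => v i ^ 2)) in *. set (y := sumn n (fun i => Rabs (v i))) in *.
  nra.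
Qed.

Lemma supp_ext (n : nat) (u v : vec) : supp n u -> supp n v -> eqv n u v -> u = v.
Proof.
  intros Hu Hv H; extensionality i. destruct (Nat.lt_ge_cases i n); [auto|].
  now rewrite Hu, Hv.
Qed.

Lemma supp_zerov (n : nat) : supp n zerov.
Proof. intros i _; reflexivity. Qed.

Lemma supp_vadd (n : nat) (u v : vec) : supp n u -> supp n v -> supp n (vadd u v).
Proof. intros Hu Hv i Hi; unfold vadd; rewrite Hu, Hv; auto; ring. Qed.

Lemma supp_vsub (n : nat) (u v : vec) : supp n u -> supp n v -> supp n (vsub u v).
Proof. intros Hu Hv i Hi; unfold vsub; rewrite Hu, Hv; auto; ring. Qed.

Lemma supp_vscal (n : nat) (c : R) (u : vec) : supp n u -> supp n (vscal c u).
Proof. intros Hu i Hi; unfold vscal; rewrite Hu; auto; ring. Qed.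

Lemma supp_vtrunc (n : nat) (v : vec) : supp n (vtrunc n v).
Proof. intros i Hi; unfold vtrunc; now rewrite (proj2 (Nat.ltb_ge i n)). Qed.

Lemma vtrunc_eqv (n : nat) (v : vec) : eqv n (vtrunc n v) v.
Proof. intros i Hi; unfold vtrunc; now rewrite (proj2 (Nat.ltb_lt i n)). Qed.

Lemma vtrunc_supp (n : nat) (v : vec) : supp n v -> vtrunc n v = v.
Proof. intros; apply (supp_ext n); auto using supp_vtrunc, vtrunc_eqv. Qed.

Lemma supp_mvr (m n : nat) (A : mat) (v : vec) : supp m (mvr m n A v).
Proof. intros i Hi; unfold mvr; now rewrite (proj2 (Nat.ltb_ge i m)). Qed.

Lemma supp_mv (n : nat) (A : mat) (v : vec) : supp n (mv n A v).
Proof. apply supp_mvr. Qed.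

Lemma mvr_lt (m n : nat) (A : mat) (v : vec) (i : nat) :
  (i < m)%nat -> mvr m n A v i = sumn n (fun j => A i j * v j).
Proof. intros Hi; unfold mvr; now rewrite (proj2 (Nat.ltb_lt i m)). Qed.

Lemma mvr_ext (m n : nat) (A B : mat) (u v : vec) :
  (forall i j, (i < m)%nat -> (j < n)%nat -> A i j = B i j) -> eqv n u v ->
  mvr m n A u = mvr m n B v.
Proof.
  intros HA Hv; apply (supp_ext m); auto using supp_mvr.
  intros i Hi; rewrite !mvr_lt by assumption.
  apply sumn_ext; intros j Hj; now rewrite HA, Hv.
Qed.

Lemma mvr_vadd (m n : nat) (A : mat) (u v : vec) :
  mvr m n A (vadd u v) = vadd (mvr m n A u) (mvr m n A v).
Proof.
  apply (supp_ext m); auto using supp_mvr, supp_vadd.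
  intros i Hi; unfold vadd at 2; rewrite !mvr_lt by assumption.
  rewrite <- sumn_plus; apply sumn_ext; intros; unfold vadd; ring.
Qed.

Lemma mvr_vscal (m n : nat) (A : mat) (c : R) (v : vec) :
  mvr m n A (vscal c v) = vscal c (mvr m n A v).
Proof.
  apply (supp_ext m); auto using supp_mvr, supp_vscal.
  intros i Hi; unfold vscal at 2; rewrite !mvr_lt by assumption.
  rewrite <- sumn_scal; apply sumn_ext; intros; unfold vscal; ring.
Qed.

Lemma vsub_vadd (u v : vec) : vsub u v = vadd u (vscal (-1) v).
Proof. extensionality i; unfold vsub, vadd, vscal; ring. Qed.

Lemma mvr_vsub (m n : nat) (A : mat) (u v : vec) :
  mvr m n A (vsub u v) = vsub (mvr m n A u) (mvr m n A v).
Proof. now rewrite !vsub_vadd, mvr_vadd, mvr_vscal. Qed.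

Lemma mvr_zerov (m n : nat) (A : mat) : mvr m n A zerov = zerov.
Proof.
  apply (supp_ext m); auto using supp_mvr, supp_zerov.
  intros i Hi; rewrite mvr_lt by assumption. apply sumn_zero; intros; unfold zerov; ring.
Qed.

Lemma mv_vadd (n : nat) (A : mat) (u v : vec) : mv n A (vadd u v) = vadd (mv n A u) (mv n A v).
Proof. apply mvr_vadd. Qed.
Lemma mv_vsub (n : nat) (A : mat) (u v : vec) : mv n A (vsub u v) = vsub (mv n A u) (mv n A v).
Proof. apply mvr_vsub. Qed.
Lemma mv_vscal (n : nat) (A : mat) (c : R) (v : vec) : mv n A (vscal c v) = vscal c (mv n A v).
Proof. apply mvr_vscal. Qed.
Lemma mv_zerov (n : nat) (A : mat) : mv n A zerov = zerov.
Proof. apply mvr_zerov. Qed.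

Lemma mm_lt (n : nat) (A B : mat) (i j : nat) : (i < n)%nat -> (j < n)%nat ->
  mm n A B i j = sumn n (fun l => A i l * B l j).
Proof.
  intros Hi Hj; unfold mm.
  now rewrite (proj2 (Nat.ltb_lt i n)), (proj2 (Nat.ltb_lt j n)).
Qed.

Lemma mv_mm (n : nat) (A B : mat) (v : vec) : mv n (mm n A B) v = mv n A (mv n B v).
Proof.
  apply (supp_ext n); auto using supp_mv.
  intros i Hi; unfold mv; rewrite !mvr_lt by assumption.
  rewrite (sumn_ext n _ (fun j => sumn n (fun l => A i l * B l j * v j))).
  2:{ intros j Hj; rewrite mm_lt by assumption.
      rewrite Rmult_comm, <- sumn_scal; apply sumn_ext; intros; ring. }
  rewrite sumn_swap; apply sumn_ext; intros l Hl.
  rewrite mvr_lt, <- sumn_scal by assumption. apply sumn_ext; intros; ring.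
Qed.

Lemma idm_lt (n i j : nat) : (i < n)%nat -> (j < n)%nat ->
  idm n i j = if Nat.eqb i j then 1 else 0.
Proof.
  intros Hi Hj; unfold idm.
  now rewrite (proj2 (Nat.ltb_lt i n)), (proj2 (Nat.ltb_lt j n)).
Qed.

Lemma mv_idm (n : nat) (v : vec) : mv n (idm n) v = vtrunc n v.
Proof.
  apply (supp_ext n); auto using supp_mv, supp_vtrunc.
  intros i Hi; unfold mv; rewrite mvr_lt, vtrunc_eqv by assumption.
  rewrite (sumn_delta n i); auto.
  - rewrite idm_lt, Nat.eqb_refl by assumption; ring.
  - intros j Hj Hij; rewrite idm_lt by assumption.
    rewrite (proj2 (Nat.eqb_neq i j)) by auto; ring.
Qed.

Lemma mv_idm_supp (n : nat) (v : vec) : supp n v -> mv n (idm n) v = v.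
Proof. intros; rewrite mv_idm; now apply vtrunc_supp. Qed.

Lemma mv_msub (n : nat) (A B : mat) (v : vec) : mv n (msub A B) v = vsub (mv n A v) (mv n B v).
Proof.
  apply (supp_ext n); auto using supp_mv, supp_vsub.
  intros i Hi; unfold vsub, mv; rewrite !mvr_lt by assumption.
  replace (sumn n (fun j => A i j * v j) - sumn n (fun j => B i j * v j)) with
    (sumn n (fun j => A i j * v j) + (-1) * sumn n (fun j => B i j * v j)) by ring.
  rewrite <- sumn_scal, <- sumn_plus; apply sumn_ext; intros; unfold msub; ring.
Qed.

Lemma mv_meq (n : nat) (A B : mat) (v : vec) : meq n A B -> mv n A v = mv n B v.
Proof. intros H; apply mvr_ext; [exact H|intros i _; reflexivity]. Qed.

Lemma mv_eqv (n : nat) (A : mat) (u v : vec) : eqv n u v -> mv n A u = mv n A v.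
Proof. intros H; now apply mvr_ext. Qed.

Definition unitv (j : nat) : vec := fun i => if Nat.eqb i j then 1 else 0.

Lemma supp_unitv (n j : nat) : (j < n)%nat -> supp n (unitv j).
Proof.
  intros Hj i Hi; unfold unitv. now rewrite (proj2 (Nat.eqb_neq i j)) by lia.
Qed.

Lemma mvr_unitv (m n : nat) (A : mat) (i j : nat) :
  (i < m)%nat -> (j < n)%nat -> mvr m n A (unitv j) i = A i j.
Proof.
  intros Hi Hj; rewrite mvr_lt, (sumn_delta n j); auto; unfold unitv.
  - rewrite Nat.eqb_refl; ring.
  - intros k Hk Hkj; rewrite (proj2 (Nat.eqb_neq k j)) by assumption; ring.
Qed.

Lemma meq_of_mv (n : nat) (A B : mat) :
  (forall v, supp n v -> mv n A v = mv n B v) -> meq n A B.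
Proof.
  intros H i j Hi Hj.
  rewrite <- (mvr_unitv n n A), <- (mvr_unitv n n B); auto.
  change (mv n A (unitv j) i = mv n B (unitv j) i). now rewrite H by now apply supp_unitv.
Qed.

(** The Frobenius norm of a rectangular matrix. [mnorm n] is convertible to [fnorm n n], so bounds
    pass between the two by conversion. *)
Definition fnorm (m n : nat) (A : mat) : R :=
  sqrt (sumn m (fun i => sumn n (fun j => A i j ^ 2))).

Lemma fnorm_sqr (m n : nat) (A : mat) :
  fnorm m n A ^ 2 = sumn m (fun i => sumn n (fun j => A i j ^ 2)).
Proof.
  unfold fnorm; rewrite <- Rsqr_pow2, Rsqr_sqrt; [reflexivity|].
  apply sumn_nonneg; intros; apply sumn_nonneg; intros; apply pow2_ge_0.
Qed.

Lemma fnorm_nonneg (m n : nat) (A : mat) : 0 <= fnorm m n A.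
Proof. apply sqrt_pos. Qed.

Lemma mvr_bound (m n : nat) (A : mat) (v : vec) :
  vnorm m (mvr m n A v) <= fnorm m n A * vnorm n v.
Proof.
  apply Rle_of_sqr; [apply Rmult_le_pos; [apply fnorm_nonneg|apply vnorm_nonneg]|].
  rewrite Rpow_mult_distr, fnorm_sqr, vnorm_sqr, Rmult_comm, <- sumn_scal.
  apply sumn_le; intros i Hi; rewrite mvr_lt by assumption.
  eapply Rle_trans; [apply (dot_sqr_le n (A i) v)|].
  rewrite !dot_self, (vnorm_sqr n (A i)); lra.
Qed.

Lemma mv_bound (n : nat) (A : mat) (v : vec) : vnorm n (mv n A v) <= mnorm n A * vnorm n v.
Proof. apply mvr_bound. Qed.

Lemma mnorm_nonneg (n : nat) (A : mat) : 0 <= mnorm n A.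
Proof. apply sqrt_pos. Qed.

Lemma fnorm_le_sumn (m n : nat) (A : mat) :
  fnorm m n A <= sumn m (fun i => sumn n (fun j => Rabs (A i j))).
Proof.
  set (B := fun i => vnorm n (A i)).
  assert (fnorm m n A = vnorm m B).
  { unfold fnorm, vnorm at 1; f_equal; apply sumn_ext; intros; unfold B; now rewrite vnorm_sqr. }
  rewrite H. eapply Rle_trans; [apply vnorm_le_sumn|].
  apply sumn_le; intros; unfold B. rewrite Rabs_pos_eq by apply vnorm_nonneg. apply vnorm_le_sumn.
Qed.

Lemma entry_le_mnorm (n : nat) (A : mat) (i j : nat) :
  (i < n)%nat -> (j < n)%nat -> Rabs (A i j) <= mnorm n A.
Proof.
  intros Hi Hj; apply Rle_of_sqr; [apply mnorm_nonneg|].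
  rewrite pow2_abs; unfold mnorm; change (A i j ^ 2 <= fnorm n n A ^ 2); rewrite fnorm_sqr.
  eapply Rle_trans; [apply (sumn_term_le n j (fun j => A i j ^ 2)); auto; intros; apply pow2_ge_0|].
  apply (sumn_term_le n i (fun i => sumn n (fun j => A i j ^ 2))); auto.
  intros; apply sumn_nonneg; intros; apply pow2_ge_0.
Qed.

(** * Continuity on subsets *)

(** No metric axioms are built into [dA] and [dB]. This admits [dV n], which ignores the coordinates
    from [n] on, and sums of distances on products. *)
Definition contD {A B : Type} (dA : A -> A -> R) (dB : B -> B -> R)
  (D : A -> Prop) (f : A -> B) : Prop :=
  forall x, D x -> forall eps, 0 < eps -> exists del, 0 < del /\
    forall y, D y -> dA x y < del -> dB (f x) (f y) < eps.

Definition dR (x y : R) : R := Rabs (y - x).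
Definition dV (n : nat) (u v : vec) : R := vnorm n (vsub v u).
Definition dsum {A B : Type} (dA : A -> A -> R) (dB : B -> B -> R) (p q : A * B) : R :=
  dA (fst p) (fst q) + dB (snd p) (snd q).

Lemma dR_nonneg (x y : R) : 0 <= dR x y.
Proof. apply Rabs_pos. Qed.
Lemma dV_nonneg (n : nat) (x y : vec) : 0 <= dV n x y.
Proof. apply vnorm_nonneg. Qed.

Section Cont.
Context {A : Type} (dA : A -> A -> R).

Lemma contD_sub {B} (dB : B -> B -> R) (D D' : A -> Prop) (f : A -> B) :
  (forall x, D' x -> D x) -> contD dA dB D f -> contD dA dB D' f.
Proof.
  intros H Hf x Hx eps He; destruct (Hf x (H x Hx) eps He) as [del [Hd Hc]].
  exists del; split; auto.
Qed.

Lemma contD_ext {B} (dB : B -> B -> R) (D : A -> Prop) (f g : A -> B) :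
  (forall x, D x -> f x = g x) -> contD dA dB D f -> contD dA dB D g.
Proof.
  intros H Hf x Hx eps He; destruct (Hf x Hx eps He) as [del [Hd Hc]].
  exists del; split; auto. intros y Hy Hxy; rewrite <- !H by assumption; auto.
Qed.

Lemma contD_comp {B C} (dB : B -> B -> R) (dC : C -> C -> R)
  (D : A -> Prop) (E : B -> Prop) (f : A -> B) (g : B -> C) :
  contD dA dB D f -> contD dB dC E g -> (forall x, D x -> E (f x)) ->
  contD dA dC D (fun x => g (f x)).
Proof.
  intros Hf Hg H x Hx eps He.
  destruct (Hg (f x) (H x Hx) eps He) as [d1 [Hd1 H1]].
  destruct (Hf x Hx d1 Hd1) as [d2 [Hd2 H2]].
  exists d2; split; auto.
Qed.

Lemma contD_pair {B C} (dB : B -> B -> R) (dC : C -> C -> R)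
  (D : A -> Prop) (f : A -> B) (g : A -> C) :
  contD dA dB D f -> contD dA dC D g -> contD dA (dsum dB dC) D (fun x => (f x, g x)).
Proof.
  intros Hf Hg x Hx eps He.
  destruct (Hf x Hx (eps / 2)) as [d1 [Hd1 H1]]; [lra|].
  destruct (Hg x Hx (eps / 2)) as [d2 [Hd2 H2]]; [lra|].
  exists (Rmin d1 d2); split; [now apply Rmin_pos|].
  intros y Hy Hxy.
  specialize (H1 y Hy (Rlt_le_trans _ _ _ Hxy (Rmin_l _ _))).
  specialize (H2 y Hy (Rlt_le_trans _ _ _ Hxy (Rmin_r _ _))).
  unfold dsum; simpl; lra.
Qed.

Lemma contD_const {B} (dB : B -> B -> R) (D : A -> Prop) (b : B) :
  dB b b = 0 -> contD dA dB D (fun _ => b).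
Proof. intros H x Hx eps He; exists 1; split; [lra|]. intros; lra. Qed.

Lemma contD_id (D : A -> Prop) : contD dA dA D (fun x => x).
Proof. intros x Hx eps He; exists eps; auto. Qed.

Lemma contD_cR (D : A -> Prop) (c : R) : contD dA dR D (fun _ => c).
Proof. apply contD_const; unfold dR; rewrite Rminus_diag, Rabs_R0; reflexivity. Qed.

Lemma contD_comp1 (D : A -> Prop) (f : A -> R) (F : R -> R) :
  contD dA dR D f -> (forall x, D x -> continuity_pt F (f x)) -> contD dA dR D (fun x => F (f x)).
Proof.
  intros Hf HF x Hx eps He.
  destruct (HF x Hx eps He) as [d1 [Hd1 H1]].
  destruct (Hf x Hx d1 Hd1) as [d2 [Hd2 H2]].
  exists d2; split; auto. intros y Hy Hxy.
  (* [continuity_pt] only tests points different from [f x], so equal values are treated apart. *)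
  destruct (Req_dec (f x) (f y)) as [E|E].
  - unfold dR; rewrite E, Rminus_diag, Rabs_R0; assumption.
  - apply (H1 (f y)). split; [split; [exact I|exact E]|]. apply (H2 y Hy Hxy).
Qed.

Lemma contD_plus (D : A -> Prop) (f g : A -> R) :
  contD dA dR D f -> contD dA dR D g -> contD dA dR D (fun x => f x + g x).
Proof.
  intros Hf Hg x Hx eps He.
  destruct (contD_pair dR dR D f g Hf Hg x Hx eps He) as [d [Hd H]].
  exists d; split; auto. intros y Hy Hxy; specialize (H y Hy Hxy); unfold dsum, dR in *; simpl in H.
  eapply Rle_lt_trans; [|exact H].
  replace (f y + g y - (f x + g x)) with (f y - f x + (g y - g x)) by ring. apply Rabs_triang.
Qed.

Lemma contD_scal (D : A -> Prop) (c : R) (f : A -> R) :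
  contD dA dR D f -> contD dA dR D (fun x => c * f x).
Proof.
  intros Hf; apply (contD_comp1 D f (fun t => c * t)); auto.
  intros; apply (continuity_pt_scal id); apply derivable_continuous_pt, derivable_pt_id.
Qed.

Lemma contD_sqr (D : A -> Prop) (f : A -> R) :
  contD dA dR D f -> contD dA dR D (fun x => f x * f x).
Proof.
  intros Hf; apply (contD_comp1 D f (fun t => t * t)); auto.
  intros; apply (continuity_pt_mult id id); apply derivable_continuous_pt, derivable_pt_id.
Qed.

Lemma contD_minus (D : A -> Prop) (f g : A -> R) :
  contD dA dR D f -> contD dA dR D g -> contD dA dR D (fun x => f x - g x).
Proof.
  intros Hf Hg; apply (contD_ext dR D (fun x => f x + (-1) * g x)); [intros; ring|].
  apply contD_plus; auto using contD_scal.
Qed.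

(* Polarization: [4 f g = (f + g)^2 - (f - g)^2]. *)
Lemma contD_mult (D : A -> Prop) (f g : A -> R) :
  contD dA dR D f -> contD dA dR D g -> contD dA dR D (fun x => f x * g x).
Proof.
  intros Hf Hg; apply (contD_ext dR D
    (fun x => / 4 * ((f x + g x) * (f x + g x) - (f x - g x) * (f x - g x)))); [intros; field|].
  apply contD_scal, contD_minus; apply contD_sqr; auto using contD_plus, contD_minus.
Qed.

Lemma contD_inv (D : A -> Prop) (f : A -> R) :
  contD dA dR D f -> (forall x, D x -> f x <> 0) -> contD dA dR D (fun x => / f x).
Proof.
  intros Hf H; apply (contD_comp1 D f Rinv); auto.
  intros; apply (continuity_pt_inv id); [apply derivable_continuous_pt, derivable_pt_id|apply H; auto].
Qed.

Lemma contD_abs (D : A -> Prop) (f : A -> R) :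
  contD dA dR D f -> contD dA dR D (fun x => Rabs (f x)).
Proof. intros Hf; apply (contD_comp1 D f Rabs); auto. intros; apply Rcontinuity_abs. Qed.

Lemma contD_min (D : A -> Prop) (f g : A -> R) :
  contD dA dR D f -> contD dA dR D g -> contD dA dR D (fun x => Rmin (f x) (g x)).
Proof.
  intros Hf Hg; apply (contD_ext dR D (fun x => / 2 * (f x + g x - Rabs (f x - g x)))).
  - intros; unfold Rmin, Rabs; destruct Rle_dec, Rcase_abs; lra.
  - apply contD_scal, contD_minus; auto using contD_plus, contD_abs, contD_minus.
Qed.

Lemma contD_max (D : A -> Prop) (f g : A -> R) :
  contD dA dR D f -> contD dA dR D g -> contD dA dR D (fun x => Rmax (f x) (g x)).
Proof.
  intros Hf Hg; apply (contD_ext dR D (fun x => / 2 * (f x + g x + Rabs (f x - g x)))).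
  - intros; unfold Rmax, Rabs; destruct Rle_dec, Rcase_abs; lra.
  - apply contD_scal, contD_plus; auto using contD_plus, contD_abs, contD_minus.
Qed.

Lemma contD_sumn (D : A -> Prop) (n : nat) (f : nat -> A -> R) :
  (forall i, (i < n)%nat -> contD dA dR D (f i)) -> contD dA dR D (fun x => sumn n (fun i => f i x)).
Proof.
  induction n as [|n IH]; simpl; intros H; [apply contD_cR|].
  apply contD_plus; auto with arith.
Qed.

Lemma contD_coord (D : A -> Prop) (n i : nat) (f : A -> vec) : (i < n)%nat ->
  contD dA (dV n) D f -> contD dA dR D (fun x => f x i).
Proof.
  intros Hi Hf x Hx eps He; destruct (Hf x Hx eps He) as [d [Hd H]].
  exists d; split; auto. intros y Hy Hxy. eapply Rle_lt_trans; [|apply (H y Hy Hxy)].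
  apply (coord_le_vnorm n i (vsub (f y) (f x)) Hi).
Qed.

Lemma contD_vec (D : A -> Prop) (n : nat) (f : A -> vec) :
  (forall i, (i < n)%nat -> contD dA dR D (fun x => f x i)) -> contD dA (dV n) D f.
Proof.
  intros H x Hx eps He.
  assert (Hs : contD dA dR D (fun y => sumn n (fun i => Rabs (f y i - f x i)))).
  { apply contD_sumn; intros; apply contD_abs, contD_minus; auto using contD_cR. }
  destruct (Hs x Hx eps He) as [d [Hd Hc]]; exists d; split; auto.
  intros y Hy Hxy; specialize (Hc y Hy Hxy); unfold dR in Hc.
  rewrite (sumn_zero n (fun i => Rabs (f x i - f x i))) in Hc
    by (intros; rewrite Rminus_diag; apply Rabs_R0).
  eapply Rle_lt_trans; [apply vnorm_le_sumn|].
  eapply Rle_lt_trans; [apply Rle_abs|]. rewrite Rminus_0_r in Hc; exact Hc.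
Qed.

Lemma contD_vnorm (D : A -> Prop) (n : nat) (f : A -> vec) :
  contD dA (dV n) D f -> contD dA dR D (fun x => vnorm n (f x)).
Proof.
  intros Hf x Hx eps He; destruct (Hf x Hx eps He) as [d [Hd H]].
  exists d; split; auto. intros y Hy Hxy. eapply Rle_lt_trans; [|apply (H y Hy Hxy)].
  unfold dR, dV.
  pose proof (vnorm_triang_sub n (f y) (f x)). pose proof (vnorm_triang_sub n (f x) (f y)).
  rewrite (vnorm_sub_sym n (f x)) in H1. unfold Rabs; destruct Rcase_abs; lra.
Qed.

Lemma contD_vadd (D : A -> Prop) (n : nat) (f g : A -> vec) :
  contD dA (dV n) D f -> contD dA (dV n) D g -> contD dA (dV n) D (fun x => vadd (f x) (g x)).
Proof.
  intros Hf Hg; apply contD_vec; intros i Hi; unfold vadd.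
  apply contD_plus; now apply (contD_coord D n).
Qed.

Lemma contD_vscal (D : A -> Prop) (n : nat) (c : A -> R) (f : A -> vec) :
  contD dA dR D c -> contD dA (dV n) D f -> contD dA (dV n) D (fun x => vscal (c x) (f x)).
Proof.
  intros Hc Hf; apply contD_vec; intros i Hi; unfold vscal.
  apply contD_mult; auto. now apply (contD_coord D n).
Qed.

Lemma contD_vsub (D : A -> Prop) (n : nat) (f g : A -> vec) :
  contD dA (dV n) D f -> contD dA (dV n) D g -> contD dA (dV n) D (fun x => vsub (f x) (g x)).
Proof.
  intros Hf Hg; apply contD_vec; intros i Hi; unfold vsub.
  apply contD_minus; now apply (contD_coord D n).
Qed.

Lemma contD_mvr (D : A -> Prop) (m n : nat) (T : A -> mat) (f : A -> vec) :
  (forall i j, (i < m)%nat -> (j < n)%nat -> contD dA dR D (fun x => T x i j)) ->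
  contD dA (dV n) D f -> contD dA (dV m) D (fun x => mvr m n (T x) (f x)).
Proof.
  intros HT Hf; apply contD_vec; intros i Hi.
  apply (contD_ext dR D (fun x => sumn n (fun j => T x i j * f x j))).
  - intros; now rewrite mvr_lt.
  - apply contD_sumn; intros j Hj; apply contD_mult; auto. now apply (contD_coord D n).
Qed.

(** Pasting over the closed pieces [phi <= c] and [c <= phi]: off the common boundary only one
    branch is seen nearby, and on it the smaller of two radii works because the branches agree
    there. *)
Lemma contD_if {B} (dB : B -> B -> R) (D : A -> Prop) (phi : A -> R) (c : R) (f g : A -> B) :
  contD dA dR D phi ->
  contD dA dB (fun x => D x /\ phi x <= c) f -> contD dA dB (fun x => D x /\ c <= phi x) g ->
  (forall x, D x -> phi x = c -> f x = g x) ->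
  contD dA dB D (fun x => if Rle_dec (phi x) c then f x else g x).
Proof.
  intros Hp Hf Hg He x Hx eps Heps.
  destruct (Rtotal_order (phi x) c) as [Hc|[Hc|Hc]].
  - destruct (Hf x (conj Hx (Rlt_le _ _ Hc)) eps Heps) as [d1 [Hd1 H1]].
    destruct (Hp x Hx (c - phi x)) as [d2 [Hd2 H2]]; [lra|].
    exists (Rmin d1 d2); split; [now apply Rmin_pos|]. intros y Hy Hxy.
    pose proof (H2 y Hy (Rlt_le_trans _ _ _ Hxy (Rmin_r _ _))) as H3.
    unfold dR in H3; apply Rabs_def2 in H3.
    destruct (Rle_dec (phi x) c); [|lra]. destruct (Rle_dec (phi y) c); [|lra].
    apply H1; auto. eapply Rlt_le_trans; [exact Hxy|apply Rmin_l].
  - destruct (Hf x (conj Hx (Req_le _ _ Hc)) eps Heps) as [d1 [Hd1 H1]].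
    destruct (Hg x (conj Hx (Req_le _ _ (eq_sym Hc))) eps Heps) as [d2 [Hd2 H2]].
    exists (Rmin d1 d2); split; [now apply Rmin_pos|]. intros y Hy Hxy.
    destruct (Rle_dec (phi x) c); [|lra]. destruct (Rle_dec (phi y) c).
    + apply H1; auto. eapply Rlt_le_trans; [exact Hxy|apply Rmin_l].
    + rewrite He by assumption. apply H2; [split; auto; lra|].
      eapply Rlt_le_trans; [exact Hxy|apply Rmin_r].
  - destruct (Hg x (conj Hx (Rlt_le _ _ Hc)) eps Heps) as [d1 [Hd1 H1]].
    destruct (Hp x Hx (phi x - c)) as [d2 [Hd2 H2]]; [lra|].
    exists (Rmin d1 d2); split; [now apply Rmin_pos|]. intros y Hy Hxy.
    pose proof (H2 y Hy (Rlt_le_trans _ _ _ Hxy (Rmin_r _ _))) as H3.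
    unfold dR in H3; apply Rabs_def2 in H3.
    destruct (Rle_dec (phi x) c); [lra|]. destruct (Rle_dec (phi y) c); [lra|].
    apply H1; [split; auto; lra|]. eapply Rlt_le_trans; [exact Hxy|apply Rmin_l].
Qed.

End Cont.

Lemma contD_fst {A B : Type} (dA : A -> A -> R) (dB : B -> B -> R) (D : A * B -> Prop) :
  (forall x y, 0 <= dB x y) -> contD (dsum dA dB) dA D fst.
Proof.
  intros H x Hx eps He; exists eps; split; auto. intros y Hy Hxy.
  unfold dsum in Hxy; specialize (H (snd x) (snd y)); lra.
Qed.

Lemma contD_snd {A B : Type} (dA : A -> A -> R) (dB : B -> B -> R) (D : A * B -> Prop) :
  (forall x y, 0 <= dA x y) -> contD (dsum dA dB) dB D snd.
Proof.
  intros H x Hx eps He; exists eps; split; auto. intros y Hy Hxy.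
  unfold dsum in Hxy; specialize (H (fst x) (fst y)); lra.
Qed.

(** * Compactness, fibrewise homotopy and Dold's theorem *)

Lemma inv_succ_small (eps : R) : 0 < eps -> exists m : nat, forall j, (m <= j)%nat -> 0 < / (INR j + 1) < eps.
Proof.
  intros He; destruct (archimed_cor1 eps He) as [N [HN HN0]].
  exists N; intros j Hj. apply le_INR in Hj. apply lt_INR in HN0; simpl in HN0.
  split; [apply Rinv_0_lt_compat; lra|].
  eapply Rlt_trans; [|exact HN]. apply Rinv_lt_contravar; nra.
Qed.

Lemma real_cluster (C : R) (u : nat -> R) : (forall j, Rabs (u j) <= C) ->
  exists c, forall eps J, 0 < eps -> exists j, (J <= j)%nat /\ Rabs (u j - c) < eps.
Proof.
  intros H; destruct (Bolzano_Weierstrass u (fun c => - C <= c <= C)) as [c Hc].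
  - apply compact_P3.
  - intros n; specialize (H n); unfold Rabs in H; destruct Rcase_abs; lra.
  - exists c; intros eps J He.
    destruct (Hc (disc c (mkposreal eps He)) J) as [p [Hp1 Hp2]].
    + now exists (mkposreal eps He).
    + exists p; auto.
Qed.

(** Bolzano-Weierstrass with infinitely many coordinates. [Y k] fixes the first [k] coordinates of
    the limit so that they are approached infinitely often ([cl k]); the next coordinate is a
    cluster value along indices [s m] at which the earlier ones are already within [/ (m + 1)]. The
    limit is the diagonal of the [Y k]. *)
Lemma vec_cluster (C : R) (x : nat -> vec) : (forall j i, Rabs (x j i) <= C) ->
  exists y, forall K eps J, 0 < eps ->
    exists j, (J <= j)%nat /\ forall i, (i < K)%nat -> Rabs (x j i - y i) < eps.
Proof.
  intros H.
  set (cl := fun k y => forall eps J, 0 < eps ->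
    exists j, (J <= j)%nat /\ forall i, (i < k)%nat -> Rabs (x j i - y i) < eps).
  assert (Hstep : forall p : nat * vec, exists y', cl (fst p) (snd p) ->
     cl (S (fst p)) y' /\ forall i, (i < fst p)%nat -> y' i = snd p i).
  { intros [k y]; simpl. destruct (classic (cl k y)) as [Hcl|Hn]; [|exists y; tauto].
    assert (Hs : forall m : nat, exists j, (m <= j)%nat /\
      forall i, (i < k)%nat -> Rabs (x j i - y i) < / (INR m + 1)).
    { intros m; apply Hcl, Rinv_0_lt_compat; pose proof (pos_INR m); lra. }
    apply functional_choice in Hs; destruct Hs as [s Hs].
    destruct (real_cluster C (fun m => x (s m) k)) as [c Hc]; [auto|].
    exists (fun i => if Nat.eqb i k then c else y i). intros _; split.
    - intros eps J He. destruct (inv_succ_small eps He) as [m Hm].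
      destruct (Hc eps (Nat.max J m) He) as [j [Hj1 Hj2]]. exists (s j); split.
      + pose proof (proj1 (Hs j)); lia.
      + intros i Hi; destruct (Nat.eqb_spec i k) as [->|Hik]; auto.
        eapply Rlt_trans; [apply Hs; lia|apply Hm; lia].
    - intros i Hi; now rewrite (proj2 (Nat.eqb_neq i k)) by lia. }
  apply functional_choice in Hstep; destruct Hstep as [F HF].
  set (Y := fix Y k := match k with O => zerov | S k' => F (k', Y k') end).
  assert (HY : forall k, cl k (Y k)).
  { induction k as [|k IH]; [intros eps J _; exists J; split; [lia|intros; lia]|].
    apply (proj1 (HF (k, Y k) IH)). }
  assert (HYs : forall k m i, (i < k)%nat -> (k <= m)%nat -> Y m i = Y k i).
  { intros k m i Hi; induction 1 as [|m Hm IH]; auto.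
    rewrite <- IH. apply (proj2 (HF (m, Y m) (HY m))); simpl; lia. }
  exists (fun i => Y (S i) i). intros K eps J He.
  destruct (HY K eps J He) as [j [Hj1 Hj2]]; exists j; split; auto.
  intros i Hi; rewrite <- (HYs (S i) K i) by lia; auto.
Qed.

Definition usphere (n : nat) (v : vec) : Prop := supp n v /\ vnorm n v = 1.

Lemma sphere_cluster (n : nat) (x : nat -> vec) : (forall j, usphere n (x j)) ->
  exists y, usphere n y /\ forall eps J, 0 < eps -> exists j, (J <= j)%nat /\ dV n y (x j) < eps.
Proof.
  intros H; destruct (vec_cluster 1 x) as [y0 Hy].
  { intros j i; destruct (H j) as [H1 H2]. destruct (Nat.lt_ge_cases i n) as [Hi|Hi].
    - rewrite <- H2; now apply coord_le_vnorm.
    - rewrite H1, Rabs_R0 by assumption; lra. }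
  assert (Hcl : forall eps J, 0 < eps -> exists j, (J <= j)%nat /\ dV n (vtrunc n y0) (x j) < eps).
  { intros eps J He.
    assert (Hp : 0 < eps / (INR n + 1)).
    { apply Rdiv_lt_0_compat; auto. pose proof (pos_INR n); lra. }
    destruct (Hy n _ J Hp) as [j [Hj1 Hj2]]; exists j; split; auto.
    eapply Rle_lt_trans; [apply vnorm_le_sumn|].
    eapply Rle_lt_trans; [apply (sumn_le n _ (fun _ => eps / (INR n + 1)))|].
    - intros i Hi; unfold vsub; rewrite vtrunc_eqv by assumption. apply Rlt_le, Hj2; auto.
    - rewrite sumn_const. pose proof (pos_INR n).
      replace (INR n * (eps / (INR n + 1))) with (eps - eps / (INR n + 1)) by (field; lra). lra. }
  exists (vtrunc n y0); split; [|exact Hcl]. split; [apply supp_vtrunc|].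
  apply cond_eq; intros eps He. destruct (Hcl eps 0%nat He) as [j [_ Hj]].
  destruct (H j) as [_ Hn]. unfold dV in Hj.
  pose proof (vnorm_triang_sub n (vtrunc n y0) (x j)). pose proof (vnorm_triang_sub n (x j) (vtrunc n y0)).
  rewrite (vnorm_sub_sym n (vtrunc n y0)) in *. unfold Rabs; destruct Rcase_abs; lra.
Qed.

(** A fibrewise space: a family of subsets of one Euclidean space, with no local triviality built
    in. Sphere bundles and constant families of spheres are treated alike. *)
Record fsp (L : Type) := mkFsp { fdim : nat; fset : L -> vec -> Prop }.
Arguments mkFsp {L} _ _.
Arguments fdim {L} _.
Arguments fset {L} _ _ _.

Definition I01 (t : R) : Prop := 0 <= t <= 1.

(** Radial projection to the unit sphere; at norm 0 the inverse takes its default value 0. *)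
Definition nrm (n : nat) (v : vec) : vec := vscal (/ vnorm n v) v.

Lemma vnorm_nrm (n : nat) (v : vec) : vnorm n v <> 0 -> vnorm n (nrm n v) = 1.
Proof.
  intros H; unfold nrm; rewrite vnorm_scal. pose proof (vnorm_nonneg n v).
  rewrite Rabs_pos_eq; [field; auto|]. apply Rlt_le, Rinv_0_lt_compat; lra.
Qed.

Lemma vscal_1 (v : vec) : vscal 1 v = v.
Proof. extensionality i; unfold vscal; ring. Qed.

Lemma nrm_unit (n : nat) (v : vec) : vnorm n v = 1 -> nrm n v = v.
Proof. intros H; unfold nrm; rewrite H, Rinv_1; apply vscal_1. Qed.

(** Normalizing moves [u] by [|1 - |u||], which is at most its distance from the unit vector [w];
    this accounts for the factor 2. *)
Lemma nrm_close (n : nat) (u w : vec) : vnorm n w = 1 -> vnorm n (vsub u w) < 1 ->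
  vnorm n u <> 0 /\ vnorm n (vsub (nrm n u) w) <= 2 * vnorm n (vsub u w).
Proof.
  intros Hw H. pose proof (vnorm_triang_sub n w u) as H1. pose proof (vnorm_triang_sub n u w) as H2.
  rewrite (vnorm_sub_sym n w u) in H1. rewrite Hw in *.
  assert (Hu : vnorm n u <> 0) by lra. split; auto.
  eapply Rle_trans; [apply (vnorm_sub_triang n _ u)|].
  assert (vnorm n (vsub (nrm n u) u) = Rabs (1 - vnorm n u)).
  { pose proof (vnorm_nonneg n u).
    rewrite (vnorm_ext n _ (vscal (/ vnorm n u - 1) u)) by (intros i _; unfold vsub, nrm, vscal; ring).
    rewrite vnorm_scal.
    transitivity (Rabs (/ vnorm n u - 1) * Rabs (vnorm n u)); [now rewrite (Rabs_pos_eq (vnorm n u))|].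
    rewrite <- Rabs_mult; f_equal; field; auto. }
  rewrite H0. unfold Rabs; destruct Rcase_abs; lra.
Qed.

Section Metric.
Context {L : Type} (dist : L -> L -> R).
Hypothesis Hmet : is_metric dist.

Lemma metric_refl x : dist x x = 0.
Proof. now apply Hmet. Qed.
Lemma metric_sym x y : dist x y = dist y x.
Proof. apply Hmet. Qed.
Lemma metric_triang x y z : dist x z <= dist x y + dist y z.
Proof. apply Hmet. Qed.
Lemma metric_nonneg x y : 0 <= dist x y.
Proof.
  pose proof (metric_triang x y x) as H. rewrite metric_refl, (metric_sym y x) in H; lra.
Qed.

Lemma contD_dist (D : L -> Prop) x : contD dist dR D (fun y => dist x y).
Proof.
  intros y Hy eps He; exists eps; split; auto. intros z Hz Hyz. unfold dR.
  pose proof (metric_triang x y z). pose proof (metric_triang x z y).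
  rewrite (metric_sym z y) in *. unfold Rabs; destruct Rcase_abs; lra.
Qed.

Lemma max_on_list {A} (J : A -> nat) (l : list A) : exists m, forall x, In x l -> (J x <= m)%nat.
Proof.
  induction l as [|a l [m Hm]]; [exists 0%nat; intros x []|].
  exists (Nat.max (J a) m); intros x [->|Hx]; [lia|]. specialize (Hm x Hx); lia.
Qed.

(** Without a cluster point every point has a ball that the sequence leaves for good. Finitely many
    of these balls cover, and the term at the largest departure index lies in none of them. *)
Lemma compact_cluster (s : nat -> L) : mcompact dist ->
  exists ls, forall eps J, 0 < eps -> exists j, (J <= j)%nat /\ dist ls (s j) < eps.
Proof.
  intros Hc; apply NNPP; intros Hn.
  assert (H : forall ls, exists p : R * nat, 0 < fst p /\ forall j, (snd p <= j)%nat -> fst p <= dist ls (s j)).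
  { intros ls; apply NNPP; intros H; apply Hn; exists ls; intros eps J He.
    apply NNPP; intros H'; apply H; exists (eps, J); split; auto.
    intros j Hj; apply Rnot_lt_le; intros Hl; apply H'; exists j; auto. }
  apply functional_choice in H; destruct H as [F HF].
  destruct (Hc L (fun ls x => dist ls x < fst (F ls))) as [l Hl].
  - intros ls x Hx; exists (fst (F ls) - dist ls x); split; [lra|].
    intros y Hy; pose proof (metric_triang ls x y); lra.
  - intros x; exists x; rewrite metric_refl; apply HF.
  - destruct (max_on_list (fun a => snd (F a)) l) as [m Hm].
    destruct (Hl (s m)) as [ls [Hin Hd]].
    pose proof (proj2 (HF ls) m (Hm ls Hin)); lra.
Qed.

(** Makes a locally valid radius valid for all parameters: failures at the radii [/ (m + 1)] would
    cluster at a point near which some radius works. It serves the absence of bifurcation, the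
    remainder of [f] and the bound on the linearization. *)
Lemma compact_uniform (Pr : R -> L -> Prop) : mcompact dist ->
  (forall r r' l, 0 < r' -> r' <= r -> Pr r l -> Pr r' l) ->
  (forall ls, exists r del, 0 < r /\ 0 < del /\ forall l, dist ls l < del -> Pr r l) ->
  exists r, 0 < r /\ forall l, Pr r l.
Proof.
  intros Hc Hmono Hloc; apply NNPP; intros Hn.
  assert (H : forall m : nat, exists l, ~ Pr (/ (INR m + 1)) l).
  { intros m; apply NNPP; intros H; apply Hn; exists (/ (INR m + 1)); split.
    - apply Rinv_0_lt_compat; pose proof (pos_INR m); lra.
    - intros l; apply NNPP; intros H'; apply H; now exists l. }
  apply functional_choice in H; destruct H as [s Hs].
  destruct (compact_cluster s Hc) as [ls Hls].
  destruct (Hloc ls) as [r [del [Hr [Hd H]]]].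
  destruct (inv_succ_small r Hr) as [m Hm].
  destruct (Hls del m Hd) as [j [Hj Hjd]].
  apply (Hs j), (Hmono r); [apply Hm|apply Rlt_le, Hm|]; auto.
Qed.

(** A supremum argument along a path: [E] consists of the times up to which [Q] has held throughout;
    [Q] extends past the supremum unless the latter is 1. *)
Lemma path_connected_ind (Q : L -> Prop) : mpath_connected dist ->
  (forall l, exists del, 0 < del /\ forall l', dist l l' < del -> (Q l <-> Q l')) ->
  forall x y, Q x -> Q y.
Proof.
  intros Hp Hloc x y Hx; destruct (Hp x y) as [p [P0 [P1 Hpc]]].
  set (E := fun t => 0 <= t <= 1 /\ forall s, 0 <= s <= t -> Q (p s)).
  assert (E0 : E 0).
  { split; [lra|]. intros s Hs; replace s with 0 by lra. now rewrite P0. }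
  destruct (completeness E) as [m [Hub Hlub]].
  { exists 1; intros t [Ht _]; lra. }
  { now exists 0. }
  assert (Hm0 : 0 <= m) by now apply Hub.
  assert (Hm1 : m <= 1) by (apply Hlub; intros t [Ht _]; lra).
  destruct (Hloc (p m)) as [e [He HQ]].
  destruct (Hpc m (conj Hm0 Hm1) e He) as [del [Hd Hdel]].
  assert (Hnear : forall t, 0 <= t <= 1 -> Rabs (t - m) < del -> (Q (p m) <-> Q (p t))) by auto.
  assert (Ht : exists t, E t /\ m - del < t).
  { apply NNPP; intros Hn. assert (m <= m - del); [|lra].
    apply Hlub; intros t Et; apply Rnot_lt_le; intros Hl; apply Hn; exists t; auto. }
  destruct Ht as [t [Et Htm]].
  assert (Htm' : t <= m) by now apply Hub.
  assert (Qm : Q (p m)).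
  { apply (Hnear t); [apply Et|unfold Rabs; destruct Rcase_abs; lra|]. apply Et; split; [apply Et|lra]. }
  set (t' := Rmin 1 (m + del / 2)).
  assert (Et' : E t').
  { split; [unfold t', Rmin; destruct Rle_dec; lra|]. intros s Hs.
    assert (s <= 1 /\ s <= m + del / 2) by (unfold t', Rmin in Hs; destruct Rle_dec; lra).
    destruct (Rle_or_lt s t); [apply Et; lra|].
    apply (Hnear s); [lra|unfold Rabs; destruct Rcase_abs; lra|assumption]. }
  assert (t' <= m) by now apply Hub.
  assert (t' = 1) by (unfold t', Rmin in *; destruct Rle_dec; lra).
  rewrite <- P1, <- H0. apply Et'. split; [apply Et'|lra].
Qed.

(** The tube lemma for the compact sphere: violating vectors over parameters tending to [l] would
    cluster at a unit vector [y], contradicting continuity at [(l, y)]. *)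
Lemma sphere_uniform (n m : nat) (g : L -> vec -> vec) :
  contD (dsum dist (dV n)) (dV m) (fun p => usphere n (snd p)) (fun p => g (fst p) (snd p)) ->
  forall l eps, 0 < eps -> exists del, 0 < del /\
    forall l' v, dist l l' < del -> usphere n v -> vnorm m (vsub (g l' v) (g l v)) < eps.
Proof.
  intros Hg l eps He; apply NNPP; intros Hn.
  assert (H : forall k : nat, exists p : L * vec, dist l (fst p) < / (INR k + 1) /\ usphere n (snd p) /\
    eps <= vnorm m (vsub (g (fst p) (snd p)) (g l (snd p)))).
  { intros k; apply NNPP; intros H; apply Hn; exists (/ (INR k + 1)); split.
    - apply Rinv_0_lt_compat; pose proof (pos_INR k); lra.
    - intros l' v Hl Hv; apply Rnot_le_lt; intros H'; apply H; now exists (l', v). }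
  apply functional_choice in H; destruct H as [s Hs].
  destruct (sphere_cluster n (fun k => snd (s k))) as [y [Hy Hcl]]; [intros; apply Hs|].
  destruct (Hg (l, y) Hy (eps / 2)) as [del [Hd Hdel]]; [lra|].
  destruct (inv_succ_small (del / 2)) as [k0 Hk0]; [lra|].
  destruct (Hcl (del / 2) k0) as [k [Hk1 Hk2]]; [lra|].
  destruct (Hs k) as [Hs1 [Hs2 Hs3]]. specialize (Hk0 k Hk1).
  assert (H1 : dV m (g l y) (g (fst (s k)) (snd (s k))) < eps / 2).
  { apply (Hdel (s k)); auto. unfold dsum; simpl; lra. }
  assert (H2 : dV m (g l y) (g l (snd (s k))) < eps / 2).
  { apply (Hdel (l, snd (s k))); auto. unfold dsum; simpl. rewrite (metric_refl); lra. }
  unfold dV in *.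
  pose proof (vnorm_sub_triang m (g (fst (s k)) (snd (s k))) (g l y) (g l (snd (s k)))).
  rewrite (vnorm_sub_sym m (g l y)) in *. lra.
Qed.

(** * Fibrewise maps and homotopies over parts of the base *)

Definition dP (n : nat) : L * vec -> L * vec -> R := dsum dist (dV n).
Definition dH (n : nat) : R * (L * vec) -> R * (L * vec) -> R := dsum dR (dP n).

Lemma dP_nonneg n x y : 0 <= dP n x y.
Proof. unfold dP, dsum; pose proof (metric_nonneg (fst x) (fst y)); pose proof (dV_nonneg n (snd x) (snd y)); lra. Qed.

Definition fdom (A : L -> Prop) (X : fsp L) (p : L * vec) : Prop :=
  A (fst p) /\ fset X (fst p) (snd p).
Definition hdom (A : L -> Prop) (X : fsp L) (q : R * (L * vec)) : Prop :=
  I01 (fst q) /\ fdom A X (snd q).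

(** The part [A] of the base is a parameter, so that single fibres ([A = eq l]), the closed pieces
    of a gluing and the whole base share one notion. *)
Definition fm (A : L -> Prop) (X Y : fsp L) (g : L -> vec -> vec) : Prop :=
  (forall l v, A l -> fset X l v -> fset Y l (g l v)) /\
  contD (dP (fdim X)) (dV (fdim Y)) (fdom A X) (fun p => g (fst p) (snd p)).

Definition hm (A : L -> Prop) (X Y : fsp L) (H : R -> L -> vec -> vec) : Prop :=
  (forall t l v, I01 t -> A l -> fset X l v -> fset Y l (H t l v)) /\
  contD (dH (fdim X)) (dV (fdim Y)) (hdom A X) (fun q => H (fst q) (fst (snd q)) (snd (snd q))).

Definition hmt (A : L -> Prop) (X Y : fsp L) (g0 g1 : L -> vec -> vec) : Prop :=
  exists H, hm A X Y H /\
    (forall l v, A l -> fset X l v -> H 0 l v = g0 l v) /\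
    (forall l v, A l -> fset X l v -> H 1 l v = g1 l v).

(** A left inverse up to fibrewise homotopy. Gluing is carried out for one-sided inverses;
    two-sidedness is recovered at the end. *)
Definition linv (A : L -> Prop) (X Y : fsp L) (g h : L -> vec -> vec) : Prop :=
  fm A Y X h /\ hmt A X X (fun l v => h l (g l v)) (fun _ v => v).

Definition fheq (A : L -> Prop) (X Y : fsp L) (g : L -> vec -> vec) : Prop :=
  fm A X Y g /\ exists h, linv A X Y g h /\ hmt A Y Y (fun l w => g l (h l w)) (fun _ w => w).

Section Eval.
Context {C : Type} (dC : C -> C -> R) (D : C -> Prop) (A : L -> Prop) (X Y : fsp L).

Lemma fm_eval (g : L -> vec -> vec) (l : C -> L) (v : C -> vec) :
  fm A X Y g -> contD dC dist D l -> contD dC (dV (fdim X)) D v ->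
  (forall c, D c -> A (l c) /\ fset X (l c) (v c)) ->
  contD dC (dV (fdim Y)) D (fun c => g (l c) (v c)).
Proof.
  intros [_ Hg] Hl Hv HD.
  apply (contD_comp dC (dP (fdim X)) (dV (fdim Y)) D (fdom A X) (fun c => (l c, v c)) (fun p => g (fst p) (snd p))); auto.
  now apply contD_pair.
Qed.

Lemma hm_eval (H : R -> L -> vec -> vec) (t : C -> R) (l : C -> L) (v : C -> vec) :
  hm A X Y H -> contD dC dR D t -> contD dC dist D l -> contD dC (dV (fdim X)) D v ->
  (forall c, D c -> I01 (t c) /\ A (l c) /\ fset X (l c) (v c)) ->
  contD dC (dV (fdim Y)) D (fun c => H (t c) (l c) (v c)).
Proof.
  intros [_ Hg] Ht Hl Hv HD.
  apply (contD_comp dC (dH (fdim X)) (dV (fdim Y)) D (hdom A X) (fun c => (t c, (l c, v c)))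
    (fun q => H (fst q) (fst (snd q)) (snd (snd q)))); auto.
  now apply contD_pair; [|apply contD_pair].
Qed.
End Eval.

Lemma contP_l n D : contD (dP n) dist D fst.
Proof. apply contD_fst, dV_nonneg. Qed.
Lemma contP_v n D : contD (dP n) (dV n) D snd.
Proof. apply contD_snd, metric_nonneg. Qed.
Lemma contH_t n D : contD (dH n) dR D fst.
Proof. apply contD_fst, dP_nonneg. Qed.
Lemma contH_p n D : contD (dH n) (dP n) D snd.
Proof. apply contD_snd, dR_nonneg. Qed.
Lemma contH_l n D : contD (dH n) dist D (fun q => fst (snd q)).
Proof.
  apply (contD_comp (dH n) (dP n) dist D (fun _ => True) snd fst); auto using contH_p, contP_l.
Qed.
Lemma contH_v n D : contD (dH n) (dV n) D (fun q => snd (snd q)).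
Proof.
  apply (contD_comp (dH n) (dP n) (dV n) D (fun _ => True) snd snd); auto using contH_p, contP_v.
Qed.

Lemma contP_base n (A : L -> Prop) X (u : L -> R) :
  contD dist dR A u -> contD (dP n) dR (fdom A X) (fun p => u (fst p)).
Proof.
  intros Hu; apply (contD_comp (dP n) dist dR (fdom A X) A fst u); auto using contP_l.
  intros p Hp; apply Hp.
Qed.
Lemma contH_base n (A : L -> Prop) X (u : L -> R) :
  contD dist dR A u -> contD (dH n) dR (hdom A X) (fun q => u (fst (snd q))).
Proof.
  intros Hu; apply (contD_comp (dH n) dist dR (hdom A X) A (fun q => fst (snd q)) u); auto using contH_l.
  intros p Hp; apply Hp.
Qed.

Lemma fm_sub (A B : L -> Prop) X Y g : (forall l, B l -> A l) -> fm A X Y g -> fm B X Y g.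
Proof.
  intros H [Hg Hc]; split; [auto|].
  eapply contD_sub; [|exact Hc]. intros x [Hx1 Hx2]; split; auto.
Qed.

Lemma fm_ext (A : L -> Prop) X Y g g' :
  (forall l v, A l -> fset X l v -> g l v = g' l v) -> fm A X Y g -> fm A X Y g'.
Proof.
  intros H [Hg Hc]; split; [intros; rewrite <- H; auto|].
  eapply contD_ext; [|exact Hc]. intros x [Hx1 Hx2]; simpl; auto.
Qed.

Lemma fm_id (A : L -> Prop) X : fm A X X (fun _ v => v).
Proof. split; [auto|]. apply contP_v. Qed.

Lemma fm_comp (A : L -> Prop) X Y Z g h :
  fm A X Y g -> fm A Y Z h -> fm A X Z (fun l v => h l (g l v)).
Proof.
  intros Hg Hh; split.
  - intros l v Hl Hv; apply Hh, Hg; auto.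
  - apply (fm_eval (dP (fdim X)) (fdom A X) A Y Z h fst (fun p => g (fst p) (snd p))); auto using contP_l.
    + apply Hg.
    + intros p Hp; split; [apply Hp|apply Hg; apply Hp].
Qed.

Lemma fm_glue (A : L -> Prop) X Y g (u : L -> R) (c : R) : contD dist dR A u ->
  fm (fun l => A l /\ u l <= c) X Y g -> fm (fun l => A l /\ c <= u l) X Y g -> fm A X Y g.
Proof.
  intros Hu [H1 C1] [H2 C2]; split.
  - intros l v Hl Hv; destruct (Rle_or_lt (u l) c); [apply H1|apply H2]; auto; split; auto; lra.
  - apply (contD_ext _ _ _ (fun p => if Rle_dec (u (fst p)) c then g (fst p) (snd p) else g (fst p) (snd p))).
    { intros; now destruct Rle_dec. }
    apply (contD_if (dP (fdim X)) (dV (fdim Y)) (fdom A X) (fun p => u (fst p))); auto.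
    + now apply contP_base.
    + eapply contD_sub; [|exact C1]. intros x [[? ?] ?]; split; auto.
    + eapply contD_sub; [|exact C2]. intros x [[? ?] ?]; split; auto.
Qed.

Lemma hmt_fm_l (A : L -> Prop) X Y g0 g1 : hmt A X Y g0 g1 -> fm A X Y g0.
Proof.
  intros [H [HH [H0 _]]]; apply (fm_ext _ _ _ (H 0)); auto. split.
  - intros; apply HH; auto; unfold I01; lra.
  - apply (hm_eval (dP (fdim X)) (fdom A X) A X Y H (fun _ => 0) fst snd HH);
      auto using contD_cR, contP_l, contP_v.
    intros c Hc; split; [unfold I01; lra|apply Hc].
Qed.

Lemma hmt_sym (A : L -> Prop) X Y g0 g1 : hmt A X Y g0 g1 -> hmt A X Y g1 g0.
Proof.
  intros [H [HH [H0 H1]]]; exists (fun t => H (1 - t)); split; [split|split].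
  - intros; apply HH; auto; unfold I01 in *; lra.
  - apply (hm_eval (dH (fdim X)) (hdom A X) A X Y H (fun q => 1 - fst q) _ _ HH);
      auto using contH_l, contH_v.
    + apply contD_minus; auto using contD_cR, contH_t.
    + intros c Hc; split; [|apply Hc]. destruct Hc as [Hc _]; unfold I01 in *; lra.
  - intros; rewrite Rminus_0_r; auto.
  - intros; rewrite Rminus_diag; auto.
Qed.

Lemma hmt_fm_r (A : L -> Prop) X Y g0 g1 : hmt A X Y g0 g1 -> fm A X Y g1.
Proof. intros H; eapply hmt_fm_l, hmt_sym, H. Qed.

Lemma hmt_refl (A : L -> Prop) X Y g : fm A X Y g -> hmt A X Y g g.
Proof.
  intros Hg; exists (fun _ => g); split; [split|split]; auto.
  - intros; apply Hg; auto.
  - apply (fm_eval (dH (fdim X)) (hdom A X) A X Y g _ _ Hg); auto using contH_l, contH_v.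
    intros c Hc; apply Hc.
Qed.

Lemma hmt_ext (A : L -> Prop) X Y g0 g1 g0' g1' :
  (forall l v, A l -> fset X l v -> g0 l v = g0' l v) ->
  (forall l v, A l -> fset X l v -> g1 l v = g1' l v) ->
  hmt A X Y g0 g1 -> hmt A X Y g0' g1'.
Proof.
  intros E0 E1 [H [HH [H0 H1]]]; exists H; split; auto.
  split; intros; [rewrite H0|rewrite H1]; auto.
Qed.

Lemma hmt_sub (A B : L -> Prop) X Y g0 g1 :
  (forall l, B l -> A l) -> hmt A X Y g0 g1 -> hmt B X Y g0 g1.
Proof.
  intros HB [H [HH [H0 H1]]]; exists H; split; [|split; auto].
  destruct HH as [Hm Hc]; split; [auto|].
  eapply contD_sub; [|exact Hc]. intros x [Hx1 [Hx2 Hx3]]; repeat split; auto; apply Hx1.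
Qed.

Lemma hmt_trans (A : L -> Prop) X Y g0 g1 g2 :
  hmt A X Y g0 g1 -> hmt A X Y g1 g2 -> hmt A X Y g0 g2.
Proof.
  intros [H [HH [H0 H1]]] [K [HK [K0 K1]]].
  exists (fun t l v => if Rle_dec t (1 / 2) then H (2 * t) l v else K (2 * t - 1) l v).
  split; [split|split].
  - intros t l v Ht Hl Hv; unfold I01 in Ht; destruct Rle_dec; [apply HH|apply HK]; auto; unfold I01; lra.
  - apply (contD_if (dH (fdim X)) (dV (fdim Y)) (hdom A X) fst (1 / 2)
      (fun q => H (2 * fst q) (fst (snd q)) (snd (snd q)))
      (fun q => K (2 * fst q - 1) (fst (snd q)) (snd (snd q)))); auto using contH_t.
    + apply (hm_eval (dH (fdim X)) _ A X Y H (fun q => 2 * fst q) _ _ HH); auto using contH_l, contH_v.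
      * apply contD_scal, contH_t.
      * intros c [[Hc1 Hc2] Hc3]; split; [unfold I01 in *; lra|apply Hc2].
    + apply (hm_eval (dH (fdim X)) _ A X Y K (fun q => 2 * fst q - 1) _ _ HK); auto using contH_l, contH_v.
      * apply contD_minus; [apply contD_scal, contH_t|apply contD_cR].
      * intros c [[Hc1 Hc2] Hc3]; split; [unfold I01 in *; lra|apply Hc2].
    + intros [t [l v]] [Ht [Hl Hv]] E; simpl in *; subst t.
      replace (2 * (1 / 2)) with 1 by field. rewrite H1, Rminus_diag, K0; auto.
  - intros; destruct Rle_dec; [|lra]. rewrite Rmult_0_r; auto.
  - intros; destruct Rle_dec; [lra|]. replace (2 * 1 - 1) with 1 by ring; auto.
Qed.

Lemma hmt_comp_l (A : L -> Prop) X Y Z g0 g1 k :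
  hmt A X Y g0 g1 -> fm A Y Z k -> hmt A X Z (fun l v => k l (g0 l v)) (fun l v => k l (g1 l v)).
Proof.
  intros [H [HH [H0 H1]]] Hk; exists (fun t l v => k l (H t l v)); split; [split|split].
  - intros; apply Hk, HH; auto.
  - apply (fm_eval (dH (fdim X)) (hdom A X) A Y Z k _ _ Hk (contH_l _ _) (proj2 HH)).
    intros c [Hc1 [Hc2 Hc3]]; split; [auto|]. apply HH; auto.
  - intros; rewrite H0; auto.
  - intros; rewrite H1; auto.
Qed.

Lemma hmt_comp_r (A : L -> Prop) X Y Z g0 g1 k :
  hmt A Y Z g0 g1 -> fm A X Y k -> hmt A X Z (fun l v => g0 l (k l v)) (fun l v => g1 l (k l v)).
Proof.
  intros [H [HH [H0 H1]]] Hk; exists (fun t l v => H t l (k l v)); split; [split|split].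
  - intros; apply HH; auto; apply Hk; auto.
  - apply (hm_eval (dH (fdim X)) (hdom A X) A Y Z H fst _ (fun q => k (fst (snd q)) (snd (snd q))) HH);
      auto using contH_t, contH_l.
    + apply (fm_eval (dH (fdim X)) (hdom A X) A X Y k _ _ Hk); auto using contH_l, contH_v.
      intros c Hc; apply Hc.
    + intros c [Hc1 [Hc2 Hc3]]; split; [auto|split; [auto|apply Hk; auto]].
  - intros; rewrite H0; auto; apply Hk; auto.
  - intros; rewrite H1; auto; apply Hk; auto.
Qed.

(** * Gluing left homotopy inverses *)

(** Homotopy extension by damping: over [c <= u] the homotopy [K] runs only up to time [s l], and
    since [s] vanishes where [u = c], the result fits together with the undeformed [k] below the
    level [c]. *)
Lemma hmt_cut_above (A : L -> Prop) X Y (u s : L -> R) (c : R) k k1 K :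
  contD dist dR A u -> contD dist dR A s ->
  (forall l, A l -> c <= u l -> I01 (s l)) -> (forall l, A l -> u l = c -> s l = 0) ->
  fm A X Y k -> hm (fun l => A l /\ c <= u l) X Y K ->
  (forall l v, A l -> c <= u l -> fset X l v -> K 0 l v = k l v) ->
  (forall l v, A l -> c <= u l -> fset X l v -> K 1 l v = k1 l v) ->
  hmt A X Y k (fun l v => if Rle_dec (u l) c then k l v else K (s l) l v).
Proof.
  intros Hu Hs Hs1 Hs0 Hk HK K0 K1.
  exists (fun t l v => if Rle_dec (u l) c then k l v else K (t * s l) l v).
  split; [split|split].
  - intros t l v Ht Hl Hv; destruct Rle_dec; [apply Hk; auto|].
    assert (c <= u l) by lra. specialize (Hs1 l Hl H).
    apply HK; auto; unfold I01 in *; nra.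
  - apply (contD_if (dH (fdim X)) (dV (fdim Y)) (hdom A X) (fun q => u (fst (snd q))) c
      (fun q => k (fst (snd q)) (snd (snd q)))
      (fun q => K (fst q * s (fst (snd q))) (fst (snd q)) (snd (snd q)))).
    + now apply contH_base.
    + apply (fm_eval (dH (fdim X)) _ A X Y k _ _ Hk); auto using contH_l, contH_v.
      intros x [Hx _]; apply Hx.
    + apply (hm_eval (dH (fdim X)) _ _ X Y K (fun q => fst q * s (fst (snd q))) _ _ HK);
        auto using contH_l, contH_v.
      * apply contD_mult; [apply contH_t|].
        apply (contD_sub _ _ (hdom A X)); [intros x Hx; apply Hx|]. now apply contH_base.
      * intros x [[Hx1 [Hx2 Hx3]] Hx4]. specialize (Hs1 _ Hx2 Hx4).
        split; [unfold I01 in *; nra|auto].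
    + intros [t [l v]] [Ht [Hl Hv]] E; simpl in *. rewrite Hs0, Rmult_0_r, K0; auto; lra.
  - intros l v Hl Hv; destruct Rle_dec; auto. rewrite Rmult_0_l, K0; auto; lra.
  - intros l v Hl Hv; destruct Rle_dec; auto. now rewrite Rmult_1_l.
Qed.

(** The mirror image of [hmt_cut_above], applied to [- u] at the level [- c]; this is the origin of
    the test in the conclusion. *)
Lemma hmt_cut_below (A : L -> Prop) X Y (u s : L -> R) (c : R) k k1 K :
  contD dist dR A u -> contD dist dR A s ->
  (forall l, A l -> u l <= c -> I01 (s l)) -> (forall l, A l -> u l = c -> s l = 0) ->
  fm A X Y k -> hm (fun l => A l /\ u l <= c) X Y K ->
  (forall l v, A l -> u l <= c -> fset X l v -> K 0 l v = k l v) ->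
  (forall l v, A l -> u l <= c -> fset X l v -> K 1 l v = k1 l v) ->
  hmt A X Y k (fun l v => if Rle_dec (- u l) (- c) then k l v else K (s l) l v).
Proof.
  intros Hu Hs Hs1 Hs0 Hk HK K0 K1.
  apply (hmt_cut_above A X Y (fun l => - u l) s (- c) k k1 K); auto.
  - apply (contD_ext dist dR A (fun l => (-1) * u l)); [intros; ring|]. now apply contD_scal.
  - intros; apply Hs1; auto; lra.
  - intros; apply Hs0; auto; lra.
  - destruct HK as [HK1 HK2]; split.
    + intros t l v Ht [Hl Hl'] Hv; apply HK1; auto; split; auto; lra.
    + eapply contD_sub; [|exact HK2]. intros x [Hx1 [[Hx2 Hx3] Hx4]].
      repeat split; auto; try apply Hx1; simpl in *; lra.
  - intros; apply K0; auto; lra.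
  - intros; apply K1; auto; lra.
Qed.

(* On the band [0 <= u <= 1/2] the map becomes a loop of self-maps based at the identity,
   and the reversed loop is an inverse. *)
Lemma linv_of_loop (A : L -> Prop) X (u : L -> R) k Lp :
  contD dist dR A u -> fm A X X k ->
  (forall l v, A l -> u l <= 1 / 2 -> fset X l v -> k l v = v) ->
  hm (fun l => A l /\ 0 <= u l) X X Lp ->
  (forall l v, A l -> 0 <= u l -> fset X l v -> Lp 0 l v = k l v) ->
  (forall l v, A l -> 0 <= u l -> fset X l v -> Lp 1 l v = v) ->
  exists m, linv A X X k m.
Proof.
  intros Hu Hk Hid HL L0 L1.
  (* [s] climbs from 0 at [u = 0] to 1 at [u = 1 / 2]; beyond, the homotopy [Lp] has run to its end
     and leaves the identity. The deformed map differs from the identity at most on the band. *)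
  set (s := fun l => Rmin (2 * u l) 1).
  assert (Hs : contD dist dR A s) by (apply contD_min; [now apply contD_scal|apply contD_cR]).
  assert (Hcut : hmt A X X k (fun l v => if Rle_dec (u l) 0 then k l v else Lp (s l) l v)).
  { apply (hmt_cut_above A X X u s 0 k (fun _ v => v)); auto.
    - intros l Hl H; unfold s, I01, Rmin; destruct Rle_dec; lra.
    - intros l Hl H; unfold s, Rmin; destruct Rle_dec; lra. }
  set (band := fun (h : L -> vec -> vec) l v =>
    if Rle_dec (u l) 0 then v else if Rle_dec (u l) (1 / 2) then h l v else v).
  (* A homotopy over the band that is the identity over both edges extends by the identity. *)
  assert (Hband : forall h0 h1 H, hm (fun l => A l /\ 0 <= u l <= 1 / 2) X X H ->
    (forall l v, A l -> 0 <= u l <= 1 / 2 -> fset X l v -> H 0 l v = h0 l v) ->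
    (forall l v, A l -> 0 <= u l <= 1 / 2 -> fset X l v -> H 1 l v = h1 l v) ->
    (forall t l v, I01 t -> A l -> u l = 0 \/ u l = 1 / 2 -> fset X l v -> H t l v = v) ->
    hmt A X X (band h0) (band h1)).
  { intros h0 h1 H HH H0 H1 Hb. exists (fun t => band (H t)); split; [split|split].
    - intros t l v Ht Hl Hv; unfold band; destruct Rle_dec; auto. destruct Rle_dec; auto.
      apply HH; auto; split; auto; lra.
    - unfold band.
      apply (contD_if (dH (fdim X)) (dV (fdim X)) (hdom A X) (fun q => u (fst (snd q))) 0
        (fun q => snd (snd q)) (fun q => if Rle_dec (u (fst (snd q))) (1 / 2) then
           H (fst q) (fst (snd q)) (snd (snd q)) else snd (snd q))); auto using contH_base, contH_v.
      + apply (contD_if (dH (fdim X)) (dV (fdim X)) _ (fun q => u (fst (snd q))) (1 / 2)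
        (fun q => H (fst q) (fst (snd q)) (snd (snd q))) (fun q => snd (snd q))); auto using contH_v.
        * apply (contD_sub _ _ (hdom A X)); [intros x Hx; apply Hx|]. now apply contH_base.
        * eapply contD_sub; [|apply (proj2 HH)].
          intros x [[[Hx1 [Hx2 Hx3]] Hx4] Hx5]; repeat split; auto; apply Hx1.
        * intros [t [l v]] [[Ht [Hl Hv]] Hx] E; simpl in *. apply Hb; auto.
      + intros [t [l v]] [Ht [Hl Hv]] E; simpl in *. destruct Rle_dec; [|lra].
        symmetry; apply Hb; auto.
    - intros l v Hl Hv; unfold band; destruct Rle_dec; auto; destruct Rle_dec; auto. apply H0; auto; lra.
    - intros l v Hl Hv; unfold band; destruct Rle_dec; auto; destruct Rle_dec; auto. apply H1; auto; lra. }
  assert (HLe : forall (a : R -> L -> R),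
    contD (dH (fdim X)) dR (hdom (fun l => A l /\ 0 <= u l <= 1 / 2) X) (fun q => a (fst q) (fst (snd q))) ->
    (forall t l, I01 t -> A l -> 0 <= u l <= 1 / 2 -> I01 (a t l)) ->
    hm (fun l => A l /\ 0 <= u l <= 1 / 2) X X (fun t l v => Lp (a t l) l v)).
  { intros a Ha Hi; split.
    - intros t l v Ht [Hl Hb] Hv; apply HL; auto; split; auto; lra.
    - apply (hm_eval (dH (fdim X)) _ _ X X Lp (fun q => a (fst q) (fst (snd q))) _ _ HL Ha);
        auto using contH_l, contH_v.
      intros q [Hq1 [[Hq2 Hq3] Hq4]]; repeat split; auto; try (apply Hi; auto); lra. }
  assert (Hub : contD (dH (fdim X)) dR (hdom (fun l => A l /\ 0 <= u l <= 1 / 2) X) (fun q => u (fst (snd q)))).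
  { apply contH_base. eapply contD_sub; [|exact Hu]. intros x Hx; apply Hx. }
  set (th := fun l => 2 * u l).
  assert (Hth : contD (dH (fdim X)) dR (hdom (fun l => A l /\ 0 <= u l <= 1 / 2) X) (fun q => th (fst (snd q)))).
  { unfold th; apply contD_scal, Hub. }
  assert (Lp0 : forall l v, A l -> 0 <= u l <= 1 / 2 -> fset X l v -> Lp 0 l v = v).
  { intros l v Hl Hb Hv; rewrite L0 by (auto; lra). apply Hid; auto; lra. }
  assert (Lp1 : forall l v, A l -> 0 <= u l <= 1 / 2 -> fset X l v -> Lp 1 l v = v).
  { intros l v Hl Hb Hv; apply L1; auto; lra. }
  assert (HLs : forall t l v, I01 t -> A l -> 0 <= u l -> fset X l v -> fset X l (Lp t l v)).
  { intros; apply HL; auto. }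
  (* [th] runs from 0 to 1 across the band, where the deformed map is [Lp (th l)]; the candidate
     inverse passes through the same loop backwards. *)
  exists (band (fun l v => Lp (1 - th l) l v)).
  split.
  - apply (hmt_fm_l A X X _ (band (fun l v => Lp (1 - th l) l v))).
    apply (Hband _ _ (fun _ l v => Lp (1 - th l) l v)).
    + apply (HLe (fun _ l => 1 - th l)).
      * apply contD_minus; auto using contD_cR.
      * intros; unfold th, I01; lra.
    + reflexivity.
    + reflexivity.
    + intros t l v Ht Hl [E|E] Hv; unfold th; rewrite E.
      * rewrite Rmult_0_r, Rminus_0_r; apply Lp1; auto; lra.
      * replace (1 - 2 * (1 / 2)) with 0 by field; apply Lp0; auto; lra.
  - set (m := band (fun l v => Lp (1 - th l) l v)).
    assert (Hm : fm A X X m).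
    { apply (hmt_fm_l A X X _ m). apply (Hband _ _ (fun _ l v => Lp (1 - th l) l v)).
      - apply (HLe (fun _ l => 1 - th l)).
        + apply contD_minus; auto using contD_cR.
        + intros; unfold th, I01; lra.
      - reflexivity.
      - reflexivity.
      - intros t l v Ht Hl [E|E] Hv; unfold th; rewrite E.
        + rewrite Rmult_0_r, Rminus_0_r; apply Lp1; auto; lra.
        + replace (1 - 2 * (1 / 2)) with 0 by field; apply Lp0; auto; lra. }
    eapply hmt_trans; [apply (hmt_comp_l A X X X _ _ m Hcut Hm)|].
    apply (hmt_ext A X X (band (fun l v => Lp (1 - th l) l (Lp (th l) l v))) (band (fun _ v => v))).
    { intros l v Hl Hv; unfold band, m, s, band, th. destruct (Rle_dec (u l) 0).
      - rewrite Hid; auto; lra.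
      - destruct (Rle_dec (u l) (1 / 2)).
        + rewrite Rmin_left by lra. reflexivity.
        + rewrite Rmin_right, L1 by (auto; lra). reflexivity. }
    { intros l v Hl Hv; unfold band; destruct Rle_dec; auto; destruct Rle_dec; auto. }
    (* The composite [Lp a] after [Lp b] starts at [a = 1 - th], [b = th]. At [t = 1] the parameters
       are changed so that one of the two factors is always at time 0, hence the identity; what
       remains is [Lp (Rabs (2 * th - 1))]. On the edges of the band [a] and [b] stay at 0 and 1. *)
    set (a := fun t l => (1 - t) * (1 - th l) + t * Rmax 0 (1 - 2 * th l)).
    set (b := fun t l => (1 - t) * th l + t * Rmax 0 (2 * th l - 1)).
    assert (Ha : forall t l, I01 t -> A l -> 0 <= u l <= 1 / 2 -> I01 (a t l)).
    { intros t l Ht Hl Hul; unfold a, th, I01 in *; unfold Rmax; destruct Rle_dec; nra. }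
    assert (Hb : forall t l, I01 t -> A l -> 0 <= u l <= 1 / 2 -> I01 (b t l)).
    { intros t l Ht Hl Hul; unfold b, th, I01 in *; unfold Rmax; destruct Rle_dec; nra. }
    eapply hmt_trans; [apply (Hband _ (fun l v => Lp (Rabs (2 * th l - 1)) l v)
      (fun t l v => Lp (a t l) l (Lp (b t l) l v)))|].
    + split.
      * intros t l v Ht [Hl Hul] Hv. apply HLs; auto; try lra. apply HLs; auto; lra.
      * apply (hm_eval (dH (fdim X)) _ (fun l => A l /\ 0 <= u l) X X Lp (fun q => a (fst q) (fst (snd q)))
          (fun q => fst (snd q)) (fun q => Lp (b (fst q) (fst (snd q))) (fst (snd q)) (snd (snd q))) HL);
        auto using contH_l.
        -- apply contD_plus; apply contD_mult; auto using contH_t, contD_minus, contD_cR.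
           apply contD_max; auto using contD_minus, contD_cR, contD_scal.
        -- apply (HLe b); auto.
           apply contD_plus; apply contD_mult; auto using contH_t, contD_minus, contD_cR.
           apply contD_max; auto using contD_minus, contD_cR, contD_scal.
        -- intros q [Hq1 [[Hq2 Hq3] Hq4]]; repeat split; auto; try (apply Ha; auto); try lra.
           apply HLs; auto; lra.
    + intros l v Hl Hul Hv; unfold a, b. rewrite Rminus_0_r, !Rmult_1_l, !Rmult_0_l, !Rplus_0_r. reflexivity.
    + intros l v Hl Hul Hv; unfold a, b. rewrite Rminus_diag, !Rmult_0_l, !Rmult_1_l, !Rplus_0_l.
      assert (0 <= th l <= 1) by (unfold th; lra).
      destruct (Rle_or_lt (2 * th l) 1).
      * rewrite (Rmax_left 0 (2 * th l - 1)), Lp0, Rmax_right by (auto; lra).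
        f_equal. rewrite Rabs_left1 by lra; ring.
      * rewrite (Rmax_right 0 (2 * th l - 1)), (Rmax_left 0 (1 - 2 * th l)) by lra.
        rewrite Lp0; auto.
        -- f_equal. rewrite Rabs_pos_eq by lra; ring.
        -- apply HLs; auto; unfold I01; lra.
    + intros t l v Ht Hl Hul Hv; unfold a, b, th.
      destruct Hul as [E|E]; rewrite E.
      * rewrite (Rmax_left 0 (2 * (2 * 0) - 1)), (Rmax_right 0 (1 - 2 * (2 * 0))) by lra.
        replace ((1 - t) * (1 - 2 * 0) + t * (1 - 2 * (2 * 0))) with 1 by ring.
        replace ((1 - t) * (2 * 0) + t * 0) with 0 by ring.
        rewrite Lp0, Lp1 by (auto; lra); reflexivity.
      * rewrite (Rmax_right 0 (2 * (2 * (1 / 2)) - 1)), (Rmax_left 0 (1 - 2 * (2 * (1 / 2)))) by lra.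
        replace ((1 - t) * (1 - 2 * (1 / 2)) + t * 0) with 0 by field.
        replace ((1 - t) * (2 * (1 / 2)) + t * (2 * (2 * (1 / 2)) - 1)) with 1 by field.
        rewrite Lp1, Lp0 by (auto; lra); reflexivity.
    (* The remaining path goes from the end of the loop part of the way back and returns; raising
       the floor [t] to 1 shrinks it to the end point, the identity. *)
    + set (e := fun t l => Rmax (Rabs (2 * th l - 1)) t).
      assert (He : forall t l, I01 t -> A l -> 0 <= u l <= 1 / 2 -> I01 (e t l)).
      { intros t l Ht Hl Hul; unfold e, th, I01 in *; unfold Rmax, Rabs;
          destruct Rcase_abs, Rle_dec; lra. }
      apply (Hband _ _ (fun t l v => Lp (e t l) l v)).
      * apply HLe; auto. apply contD_max; auto using contH_t, contD_abs, contD_minus, contD_scal, contD_cR.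
      * intros l v Hl Hul Hv; unfold e; rewrite Rmax_left; auto. apply Rabs_pos.
      * intros l v Hl Hul Hv; unfold e; rewrite Rmax_right; auto.
        unfold th, Rabs; destruct Rcase_abs; lra.
      * intros t l v Ht Hl Hul Hv. assert (e t l = 1).
        { unfold e, th, I01 in *; destruct Hul as [E|E]; rewrite E.
          - rewrite Rabs_left by lra. rewrite Rmax_left; lra.
          - rewrite Rabs_pos_eq by lra. rewrite Rmax_left; lra. }
        rewrite H; apply Lp1; auto; lra.
Qed.

(** The two homotopies to the identity need not agree over the overlap. The first is spent on making
    [k] the identity where [u <= 1 / 2]; there the second one then becomes a loop of self-maps, to
    which [linv_of_loop] applies. *)
Lemma linv_of_local_id (A : L -> Prop) X (u : L -> R) k :
  contD dist dR A u -> fm A X X k ->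
  hmt (fun l => A l /\ u l <= 1) X X k (fun _ v => v) ->
  hmt (fun l => A l /\ 0 <= u l) X X k (fun _ v => v) ->
  exists m, linv A X X k m.
Proof.
  intros Hu Hk [H [HH [H0 H1]]] HL.
  (* Equal to 1 for [u <= 1 / 2] and to 0 at [u = 1]. *)
  set (s := fun l => Rmin (2 * (1 - u l)) 1).
  assert (Hc : hmt A X X k (fun l v => if Rle_dec (- u l) (- (1)) then k l v else H (s l) l v)).
  { apply (hmt_cut_below A X X u s 1 k (fun _ v => v)); auto.
    - apply contD_min; [|apply contD_cR]. apply contD_scal, contD_minus; auto using contD_cR.
    - intros l Hl Hul; unfold s, I01, Rmin; destruct Rle_dec; lra.
    - intros l Hl Hul; unfold s, Rmin; destruct Rle_dec; lra. }
  set (k' := fun l v => if Rle_dec (- u l) (- (1)) then k l v else H (s l) l v) in *.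
  assert (HL' : hmt (fun l => A l /\ 0 <= u l) X X k' (fun _ v => v)).
  { eapply hmt_trans; [|exact HL]. apply hmt_sym. eapply hmt_sub; [|exact Hc]. tauto. }
  destruct HL' as [Lp [HLp [L0 L1]]].
  destruct (linv_of_loop A X u k' Lp) as [m [Hm1 Hm2]]; auto.
  - eapply hmt_fm_r, Hc.
  - intros l v Hl Hul Hv; unfold k', s. destruct Rle_dec; [lra|].
    rewrite Rmin_right, H1; auto; try split; auto; lra.
  - exists m; split; auto. eapply hmt_trans; [|exact Hm2].
    apply (hmt_comp_l A X X X k k' m); auto.
Qed.

(** Over the overlap [h1 ~ h1 g h2 ~ h2], because [h2] is there also a right inverse. Sliding along
    this homotopy with time [u] joins [h1] to [h2]; the result [h] satisfies [h g ~ id] over each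
    piece separately, and [linv_of_local_id] corrects it by a factor [m] to a left inverse over the
    union. *)
Lemma linv_union (A : L -> Prop) X Y (u : L -> R) g h1 :
  contD dist dR A u -> fm A X Y g ->
  linv (fun l => A l /\ u l <= 1) X Y g h1 ->
  fheq (fun l => A l /\ 0 <= u l) X Y g ->
  exists h, linv A X Y g h.
Proof.
  intros Hu Hg [Hh1 HH1] [_ [h2 [[Hh2 HH2] HH3]]].
  assert (HK : hmt (fun l => A l /\ 0 <= u l <= 1) Y X h1 h2).
  { apply (hmt_trans _ _ _ _ (fun l w => h1 l (g l (h2 l w)))).
    - apply hmt_sym.
      apply (hmt_comp_l _ Y Y X (fun l w => g l (h2 l w)) (fun _ w => w) h1).
      + eapply hmt_sub; [|exact HH3]. simpl; intuition.
      + eapply fm_sub; [|exact Hh1]. simpl; intuition.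
    - apply (hmt_comp_r _ Y X X (fun l v => h1 l (g l v)) (fun _ v => v) h2).
      + eapply hmt_sub; [|exact HH1]. simpl; intuition.
      + eapply fm_sub; [|exact Hh2]. simpl; intuition. }
  pose proof (hmt_sym _ _ _ _ _ HK) as HKs.
  destruct HK as [K [HK [K0 K1]]].
  set (h := fun l v => if Rle_dec (u l) 0 then h1 l v else
                       if Rle_dec (u l) 1 then K (u l) l v else h2 l v).
  assert (C1 : hmt (fun l => A l /\ u l <= 1) Y X h1 h).
  { eapply hmt_ext; [intros; reflexivity| |
      apply (hmt_cut_above (fun l => A l /\ u l <= 1) Y X u u 0 h1 h2 K)]; simpl; auto.
    - intros l v [Hl Hul] Hv; unfold h; destruct Rle_dec; auto. destruct Rle_dec; auto; lra.
    - eapply contD_sub; [|exact Hu]; tauto.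
    - eapply contD_sub; [|exact Hu]; tauto.
    - intros l [Hl Hul] Hul'; split; lra.
    - destruct HK as [HKa HKb]; split.
      + intros; apply HKa; intuition.
      + eapply contD_sub; [|exact HKb]. unfold hdom, fdom; intuition.
    - intros l v [? ?] ? ?; apply K0; auto.
    - intros l v [? ?] ? ?; apply K1; auto. }
  assert (C2 : hmt (fun l => A l /\ 0 <= u l) Y X h2 h).
  { eapply hmt_ext; [intros; reflexivity| |
      apply (hmt_cut_below (fun l => A l /\ 0 <= u l) Y X u (fun l => 1 - u l) 1 h2 h1 (fun t => K (1 - t)))];
      simpl; auto.
    - intros l v [Hl Hul] Hv; unfold h. destruct (Rle_dec (- u l) (- (1))).
      + destruct (Rle_dec (u l) 0); [lra|]. destruct (Rle_dec (u l) 1); [|auto].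
        assert (E : u l = 1) by lra. rewrite E, K1; auto; split; auto; lra.
      + replace (1 - (1 - u l)) with (u l) by ring. destruct (Rle_dec (u l) 0).
        * assert (E : u l = 0) by lra. rewrite E, K0; auto; split; auto; lra.
        * destruct (Rle_dec (u l) 1); [auto|lra].
    - eapply contD_sub; [|exact Hu]; tauto.
    - apply contD_minus; [apply contD_cR|]. eapply contD_sub; [|exact Hu]; tauto.
    - intros l [Hl Hul] Hul'; split; lra.
    - intros; lra.
    - split.
      + intros t l v Ht [[Hl Hul] Hul'] Hv; apply HK; auto. unfold I01 in *; lra.
      + apply (hm_eval (dH (fdim Y)) _ (fun l => A l /\ 0 <= u l <= 1) Y X K (fun q => 1 - fst q) _ _ HK);
          auto using contH_l, contH_v.
        * apply contD_minus; auto using contD_cR, contH_t.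
        * intros q [Hq1 [[[Hq2 Hq3] Hq4] Hq5]]; repeat split; auto; unfold I01 in Hq1; lra.
    - intros l v [? ?] ? ?; rewrite Rminus_0_r; apply K1; auto.
    - intros l v [? ?] ? ?; rewrite Rminus_diag; apply K0; auto. }
  assert (Hh : fm A Y X h).
  { apply (fm_glue A Y X h u (1 / 2) Hu).
    - eapply fm_sub; [|eapply hmt_fm_r, C1]. simpl; intuition; lra.
    - eapply fm_sub; [|eapply hmt_fm_r, C2]. simpl; intuition; lra. }
  destruct (linv_of_local_id A X u (fun l v => h l (g l v))) as [m [Hm1 Hm2]]; auto.
  - apply (fm_comp A X Y X); auto.
  - eapply hmt_trans; [|exact HH1]. apply hmt_sym.
    apply (hmt_comp_r _ X Y X h1 h g C1). eapply fm_sub; [|exact Hg]; simpl; tauto.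
  - eapply hmt_trans; [|exact HH2]. apply hmt_sym.
    apply (hmt_comp_r _ X Y X h2 h g C2). eapply fm_sub; [|exact Hg]; simpl; tauto.
  - exists (fun l w => m l (h l w)); split; auto.
    apply (fm_comp A Y X X); auto.
Qed.

Definition covered (ws : list (L -> R)) (c : R) (l : L) : Prop :=
  exists w, In w ws /\ w l <= c.

Lemma fheq_sub (A B : L -> Prop) X Y g : (forall l, B l -> A l) -> fheq A X Y g -> fheq B X Y g.
Proof.
  intros H [Hg [h [[H1 H2] H3]]]; split; [eapply fm_sub; eauto|].
  exists h; split; [split|]; [eapply fm_sub|eapply hmt_sub|eapply hmt_sub]; eauto.
Qed.

(** Every union consumes some overlap, so the left inverse is claimed over [u <= a] for all [a < 2]:
    the piece for level [a] is built from the one for [a + e = (a + 2) / 2], still below 2. The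
    function [u] is the minimum of [ws] and 3. *)
Lemma linv_covered X Y g (ws : list (L -> R)) :
  fm (fun _ => True) X Y g ->
  (forall w, In w ws -> contD dist dR (fun _ => True) w /\ fheq (fun l => w l <= 2) X Y g) ->
  exists u, contD dist dR (fun _ => True) u /\ (forall l c, c < 3 -> u l <= c <-> covered ws c l) /\
    forall a, a < 2 -> exists h, linv (fun l => u l <= a) X Y g h.
Proof.
  intros Hg; induction ws as [|w ws IH]; intros Hws.
  (* The default 3 lies above every level in question, so the empty cover has empty pieces. *)
  - exists (fun _ => 3); split; [apply contD_cR|split].
    + intros l c Hc; split; [lra|intros [w [[] _]]].
    + intros a Ha; exists (fun _ v => v); repeat split; try (intros; lra).
      * intros x [Hx _]; lra.
      * exists (fun _ _ v => v); repeat split; try (intros; lra).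
        intros x [_ [Hx _]]; lra.
  - destruct IH as [u [Hu [Hcov Hl]]]; [intros; apply Hws; now right|].
    destruct (Hws w (or_introl eq_refl)) as [Hw Hfh].
    exists (fun l => Rmin (u l) (w l)); split; [now apply contD_min|split].
    + intros l c Hc; split.
      * intros H. unfold Rmin in H; destruct Rle_dec.
        -- apply Hcov in H; auto. destruct H as [w' [Hw' H]]; exists w'; split; [now right|auto].
        -- exists w; split; [now left|auto].
      * intros [w' [[->|Hw'] H]].
        -- eapply Rle_trans; [apply Rmin_r|auto].
        -- eapply Rle_trans; [apply Rmin_l|]. apply Hcov; auto. exists w'; auto.
    + intros a Ha. set (e := (2 - a) / 2).
      destruct (Hl (a + e)) as [h1 Hh1]; [unfold e; lra|].
      (* Where [(u - w) / e <= 1], the bound on the minimum gives [u <= a + e], which is the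
         inductive piece; where [u - w >= 0], it gives [w <= a], which lies in the new piece. *)
      apply (linv_union (fun l => Rmin (u l) (w l) <= a) X Y (fun l => / e * (u l - w l)) g h1).
      * apply contD_scal, contD_minus; (eapply contD_sub; [|eassumption]; exact (fun _ _ => I)).
      * apply (fm_sub (fun _ => True)); auto.
      * assert (Hs : forall l, Rmin (u l) (w l) <= a /\ / e * (u l - w l) <= 1 -> u l <= a + e).
        { intros l [H1 H2]. assert (He : 0 < e) by (unfold e; lra).
          assert (u l - w l <= e).
          { apply (Rmult_le_reg_l (/ e)); [now apply Rinv_0_lt_compat|]. rewrite Rinv_l; lra. }
          unfold Rmin in H1; destruct Rle_dec; lra. }
        destruct Hh1 as [Ha1 Ha2]; split; [apply (fm_sub (fun l => u l <= a + e))|apply (hmt_sub (fun l => u l <= a + e))]; auto.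
      * eapply fheq_sub; [|exact Hfh]. simpl; intros l [H1 H2].
        assert (He : 0 < e) by (unfold e; lra).
        assert (0 <= u l - w l).
        { apply (Rmult_le_reg_l (/ e)); [now apply Rinv_0_lt_compat|]. lra. }
        unfold Rmin in H1; destruct Rle_dec; lra.
Qed.

(* Dold's theorem for finite covers: local left inverses are glued, and a left inverse
   of a left inverse makes both of them homotopy equivalences. *)
Lemma fheq_of_cover X Y g (ws : list (L -> R)) :
  fm (fun _ => True) X Y g ->
  (forall w, In w ws -> contD dist dR (fun _ => True) w /\ fheq (fun l => w l <= 2) X Y g) ->
  (forall l, covered ws 1 l) -> fheq (fun _ => True) X Y g.
Proof.
  intros Hg Hws Hc.
  assert (Hglob : forall X Y g, fm (fun _ => True) X Y g ->
    (forall w, In w ws -> contD dist dR (fun _ => True) w /\ fheq (fun l => w l <= 2) X Y g) ->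
    exists h, linv (fun _ => True) X Y g h).
  { intros X' Y' g' Hg' Hws'.
    destruct (linv_covered X' Y' g' ws Hg' Hws') as [u [_ [Hcov Hl]]].
    destruct (Hl 1) as [h [H1 H2]]; [lra|].
    assert (Hs : forall l, True -> u l <= 1) by (intros l _; apply Hcov; [lra|auto]).
    exists h; split; [apply (fm_sub (fun l => u l <= 1))|apply (hmt_sub (fun l => u l <= 1))]; auto. }
  destruct (Hglob X Y g Hg Hws) as [h [Hh1 Hh2]].
  (* Over each piece [h] is homotopic to the local inverse [k], so it is a local equivalence itself,
     with inverse [g]. *)
  destruct (Hglob Y X h Hh1) as [h' [Hh'1 Hh'2]].
  { intros w Hw; destruct (Hws w Hw) as [Hwc [Hgw [k [[Hk1 Hk2] Hk3]]]]; split; auto.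
    split; [apply (fm_sub (fun _ => True)); auto|].
    assert (Hhk : hmt (fun l => w l <= 2) Y X h k).
    { apply (hmt_trans _ _ _ _ (fun l y => h l (g l (k l y)))).
      - apply hmt_sym, (hmt_comp_l _ Y Y X (fun l y => g l (k l y)) (fun _ y => y) h Hk3).
        apply (fm_sub (fun _ => True)); auto.
      - apply (hmt_comp_r _ Y X X (fun l x => h l (g l x)) (fun _ x => x) k); auto.
        apply (hmt_sub (fun _ => True)); auto. }
    exists g; split; [split|].
    - exact Hgw.
    - eapply hmt_trans; [|exact Hk3]. apply (hmt_comp_l _ Y X Y h k g); auto.
    - apply (hmt_sub (fun _ => True)); auto. }
  split; auto. exists h; split; [split; auto|].
  (* The chain is [g h ~ h' h g h ~ h' h ~ id]. *)
  apply (hmt_trans _ _ _ _ (fun l y => h' l (h l (g l (h l y))))).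
  - apply hmt_sym. apply (hmt_comp_r _ Y Y Y (fun l y => h' l (h l y)) (fun _ y => y) (fun l y => g l (h l y))); auto.
    apply (fm_comp _ Y X Y); auto.
  - eapply hmt_trans; [|exact Hh'2].
    apply (hmt_comp_r _ Y X Y (fun l x => h' l (h l (g l x))) h' h); auto.
    apply (hmt_comp_l _ X X Y (fun l x => h l (g l x)) (fun _ x => x) h'); auto.
Qed.

(** * Sphere bundles and their local triviality *)

Lemma fiber_supp (E : bundle L) l v : fiber E l v -> supp (bN E) v.
Proof. intros H; apply H. Qed.

Lemma fiber_fix (E : bundle L) l v : fiber E l v -> mv (bN E) (bQ E l) v = v.
Proof. intros [H1 H2]; apply (supp_ext (bN E)); auto using supp_mv. Qed.

Lemma fiber_intro (E : bundle L) l v : mv (bN E) (bQ E l) v = v -> fiber E l v.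
Proof. intros H; split; [rewrite <- H; apply supp_mv|]. intros i Hi; now rewrite H. Qed.

Lemma fiber_vadd (E : bundle L) l u v : fiber E l u -> fiber E l v -> fiber E l (vadd u v).
Proof.
  intros Hu Hv; apply fiber_intro. rewrite mv_vadd, (fiber_fix E l u), (fiber_fix E l v); auto.
Qed.

Lemma fiber_vscal (E : bundle L) l c v : fiber E l v -> fiber E l (vscal c v).
Proof. intros Hv; apply fiber_intro. rewrite mv_vscal, (fiber_fix E l v); auto. Qed.

Lemma fiber_proj (E : bundle L) l v : is_bundle dist E -> fiber E l (mv (bN E) (bQ E l) v).
Proof.
  intros [_ [_ H]]; apply fiber_intro. rewrite <- mv_mm. apply mv_meq, H.
Qed.

Definition sobj (E : bundle L) : fsp L := mkFsp (bN E) (sph E).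

Lemma sph_nrm (E : bundle L) l v : fiber E l v -> vnorm (bN E) v <> 0 -> sph E l (nrm (bN E) v).
Proof. intros; split; [now apply fiber_vscal|now apply vnorm_nrm]. Qed.

Lemma fm_nrm (A : L -> Prop) X (E : bundle L) g :
  contD (dP (fdim X)) (dV (bN E)) (fdom A X) (fun p => g (fst p) (snd p)) ->
  (forall l v, A l -> fset X l v -> fiber E l (g l v) /\ vnorm (bN E) (g l v) <> 0) ->
  fm A X (sobj E) (fun l v => nrm (bN E) (g l v)).
Proof.
  intros Hc H; split.
  - intros; apply sph_nrm; apply H; auto.
  - apply contD_vscal; auto. apply contD_inv; [now apply contD_vnorm|].
    intros x [Hx1 Hx2]; apply H; auto.
Qed.

Lemma hmt_nrm (A : L -> Prop) X (E : bundle L) (G : R -> L -> vec -> vec) :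
  contD (dH (fdim X)) (dV (bN E)) (hdom A X) (fun q => G (fst q) (fst (snd q)) (snd (snd q))) ->
  (forall t l v, I01 t -> A l -> fset X l v -> fiber E l (G t l v) /\ vnorm (bN E) (G t l v) <> 0) ->
  hmt A X (sobj E) (fun l v => nrm (bN E) (G 0 l v)) (fun l v => nrm (bN E) (G 1 l v)).
Proof.
  intros Hc H; exists (fun t l v => nrm (bN E) (G t l v)); split; [split|split]; auto.
  - intros; apply sph_nrm; apply H; auto.
  - apply contD_vscal; auto. apply contD_inv; [now apply contD_vnorm|].
    intros x [Hx1 [Hx2 Hx3]]; apply H; auto.
Qed.

Lemma contD_proj2 (A : L -> Prop) X n (g : L -> vec -> vec) :
  contD (dP (fdim X)) (dV n) (fdom A X) (fun p => g (fst p) (snd p)) ->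
  contD (dH (fdim X)) (dV n) (hdom A X) (fun q => g (fst (snd q)) (snd (snd q))).
Proof.
  intros H; apply (contD_comp (dH (fdim X)) (dP (fdim X)) (dV n) (hdom A X) (fdom A X) snd
    (fun p => g (fst p) (snd p))); auto using contH_p.
  intros q Hq; apply Hq.
Qed.

(** The segment from the unit vector [g0] to [g1] stays within distance less than 1 of [g0]; it
    avoids 0 and can be normalized. *)
Lemma hmt_close (A : L -> Prop) X (E : bundle L) g0 g1 :
  fm A X (sobj E) g0 ->
  contD (dP (fdim X)) (dV (bN E)) (fdom A X) (fun p => g1 (fst p) (snd p)) ->
  (forall l v, A l -> fset X l v -> fiber E l (g1 l v) /\ vnorm (bN E) (vsub (g1 l v) (g0 l v)) < 1) ->
  hmt A X (sobj E) g0 (fun l v => nrm (bN E) (g1 l v)).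
Proof.
  intros [H0 C0] C1 H1.
  set (G := fun t l v => vadd (g0 l v) (vscal t (vsub (g1 l v) (g0 l v)))).
  assert (H0' : forall l v, A l -> fset X l v -> sph E l (g0 l v)) by exact H0.
  apply (hmt_ext A X (sobj E) (fun l v => nrm (bN E) (G 0 l v)) (fun l v => nrm (bN E) (G 1 l v))).
  - intros l v Hl Hv. replace (G 0 l v) with (g0 l v).
    + apply nrm_unit, H0'; auto.
    + unfold G; extensionality i; unfold vadd, vscal; ring.
  - intros l v Hl Hv; f_equal. unfold G; extensionality i; unfold vadd, vscal, vsub; ring.
  - apply hmt_nrm.
    + apply contD_vadd; [apply contD_proj2, C0|].
      apply contD_vscal; [now apply contH_t|]. apply contD_vsub; apply contD_proj2; [exact C1|exact C0].
    + intros t l v Ht Hl Hv. destruct (H1 l v Hl Hv) as [Hf Hlt]. destruct (H0' l v Hl Hv) as [Hf0 Hn].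
      split.
      * apply fiber_vadd, fiber_vscal; auto. rewrite vsub_vadd. apply fiber_vadd, fiber_vscal; auto.
      * assert (vnorm (bN E) (vsub (g0 l v) (G t l v)) < 1).
        { rewrite (vnorm_ext _ _ (vscal (- t) (vsub (g1 l v) (g0 l v))))
            by (intros i _; unfold G, vadd, vscal, vsub; ring).
          rewrite vnorm_scal, Rabs_Ropp, Rabs_pos_eq by apply Ht.
          pose proof (vnorm_nonneg (bN E) (vsub (g1 l v) (g0 l v))). destruct Ht; nra. }
        pose proof (vnorm_triang_sub (bN E) (g0 l v) (G t l v)). lra.
Qed.

Lemma fheq_hmt (A : L -> Prop) X Y g g' :
  hmt A X Y g g' -> fheq A X Y g -> fheq A X Y g'.
Proof.
  intros Hgg [Hg [h [[H1 H2] H3]]]. pose proof (hmt_sym _ _ _ _ _ Hgg) as Hs.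
  split; [now apply (hmt_fm_l A X Y g' g)|].
  exists h; split; [split; auto|].
  - eapply hmt_trans; [|exact H2]. now apply (hmt_comp_l A X Y X g' g h).
  - eapply hmt_trans; [|exact H3]. now apply (hmt_comp_r A Y X Y g' g h).
Qed.

Lemma fheq_comp (A : L -> Prop) X Y Z g k :
  fheq A X Y g -> fheq A Y Z k -> fheq A X Z (fun l v => k l (g l v)).
Proof.
  intros [Hg [h [[H1 H2] H3]]] [Hk [m [[H4 H5] H6]]].
  split; [now apply (fm_comp A X Y Z)|].
  exists (fun l z => h l (m l z)); split; [split|].
  - now apply (fm_comp A Z Y X).
  - eapply hmt_trans; [|exact H2].
    apply (hmt_comp_l A X Y X (fun l v => m l (k l (g l v))) g h); auto.
    now apply (hmt_comp_r A X Y Y (fun l y => m l (k l y)) (fun _ y => y) g).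
  - eapply hmt_trans; [|exact H6].
    apply (hmt_comp_l A Z Y Z (fun l z => g l (h l (m l z))) m k); auto.
    now apply (hmt_comp_r A Z Y Y (fun l y => g l (h l y)) (fun _ y => y) m).
Qed.

Section Const.
Variables (l : L) (A : L -> Prop).

(** With the two lemmas that follow, the passage from one fibre to a set over which both spaces are
    constant: everything is spread without change along the base. *)
Lemma fm_const (X Y X' Y' : fsp L) k :
  fdim X' = fdim X -> fdim Y' = fdim Y ->
  (forall l' v, A l' -> fset X' l' v <-> fset X l v) ->
  (forall l' v, A l' -> fset Y' l' v <-> fset Y l v) ->
  fm (eq l) X Y k -> fm A X' Y' (fun _ => k l).
Proof.
  intros EX EY HX HY [H C]; split.
  - intros l' v Hl Hv; apply HY, H, HX with l'; auto.
  - rewrite EX, EY.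
    apply (contD_comp (dP (fdim X)) (dP (fdim X)) (dV (fdim Y)) (fdom A X') (fdom (eq l) X)
      (fun p => (l, snd p)) (fun p => k (fst p) (snd p))); auto.
    + apply contD_pair; [apply contD_const, metric_refl; auto|now apply contP_v].
    + intros p [Hp1 Hp2]; split; auto. simpl; now apply (HX (fst p)).
Qed.

Lemma hmt_const (X Y X' Y' : fsp L) k0 k1 :
  fdim X' = fdim X -> fdim Y' = fdim Y ->
  (forall l' v, A l' -> fset X' l' v <-> fset X l v) ->
  (forall l' v, A l' -> fset Y' l' v <-> fset Y l v) ->
  hmt (eq l) X Y k0 k1 -> hmt A X' Y' (fun _ => k0 l) (fun _ => k1 l).
Proof.
  intros EX EY HX HY [H [[HH C] [H0 H1]]]; exists (fun t _ => H t l); split; [split|split].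
  - intros t l' v Ht Hl Hv; apply HY, HH, HX with l'; auto.
  - rewrite EX, EY.
    apply (contD_comp (dH (fdim X)) (dH (fdim X)) (dV (fdim Y)) (hdom A X') (hdom (eq l) X)
      (fun q => (fst q, (l, snd (snd q)))) (fun q => H (fst q) (fst (snd q)) (snd (snd q)))); auto.
    + apply contD_pair; [now apply contH_t|].
      apply contD_pair; [apply contD_const, metric_refl; auto|now apply contH_v].
    + intros q [Hq1 [Hq2 Hq3]]; split; auto. split; auto. simpl; now apply (HX (fst (snd q))).
  - intros l' v Hl Hv; apply H0; auto; now apply (HX l').
  - intros l' v Hl Hv; apply H1; auto; now apply (HX l').
Qed.

Lemma fheq_const (X Y X' Y' : fsp L) k :
  fdim X' = fdim X -> fdim Y' = fdim Y ->
  (forall l' v, A l' -> fset X' l' v <-> fset X l v) ->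
  (forall l' v, A l' -> fset Y' l' v <-> fset Y l v) ->
  fheq (eq l) X Y k -> fheq A X' Y' (fun _ => k l).
Proof.
  intros EX EY HX HY [Hk [h [[H1 H2] H3]]].
  split; [eapply fm_const; eauto|]. exists (fun _ => h l); split; [split|].
  - now apply (fm_const Y X Y' X').
  - now apply (hmt_const X X X' X' (fun l v => h l (k l v)) (fun _ v => v)).
  - now apply (hmt_const Y Y Y' Y' (fun l v => k l (h l v)) (fun _ v => v)).
Qed.
End Const.

(** The product with the fibre over [l1], the local model of [E] near [l1]. *)
Definition cobj (E : bundle L) (l1 : L) : fsp L := mkFsp (bN E) (fun _ => sph E l1).

Definition sphM (M : nat) : fsp L := mkFsp M (fun _ => usphere M).

Lemma bundle_near (E : bundle L) l1 eps : is_bundle dist E -> 0 < eps ->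
  exists del, 0 < del /\ forall l, dist l1 l < del ->
    fnorm (bN E) (bN E) (msub (bQ E l) (bQ E l1)) < eps.
Proof.
  intros [_ [Hc _]] He. set (n := bN E).
  assert (H : contD dist dR (fun _ => True)
    (fun l => sumn n (fun i => sumn n (fun j => Rabs (bQ E l i j - bQ E l1 i j))))).
  { apply contD_sumn; intros i Hi; apply contD_sumn; intros j Hj.
    apply contD_abs, contD_minus; [|apply contD_cR]. intros x _ e He'.
    destruct (Hc i j x e He') as [d [Hd H]]; exists d; split; auto. intros y _; apply H. }
  destruct (H l1 I eps He) as [d [Hd Hd']]; exists d; split; auto.
  intros l Hl. eapply Rle_lt_trans; [apply fnorm_le_sumn|].
  specialize (Hd' l I Hl); unfold dR in Hd'.
  rewrite (sumn_zero n (fun i => sumn n (fun j => Rabs (bQ E l1 i j - bQ E l1 i j)))), Rminus_0_r in Hd'.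
  - eapply Rle_lt_trans; [apply Rle_abs|exact Hd'].
  - intros i Hi; apply sumn_zero; intros j Hj; now rewrite Rminus_diag, Rabs_R0.
Qed.

Lemma contD_bQ {C} (dC : C -> C -> R) (D : C -> Prop) (E : bundle L) (a : C -> L) (f : C -> vec) :
  is_bundle dist E -> contD dC dist D a -> contD dC (dV (bN E)) D f ->
  contD dC (dV (bN E)) D (fun c => mv (bN E) (bQ E (a c)) (f c)).
Proof.
  intros [_ [HE _]] Ha Hf; apply contD_mvr; auto. intros i j _ _.
  apply (contD_comp dC dist dR D (fun _ => True) a (fun l => bQ E l i j)); auto.
  intros x _ e He; destruct (HE i j x e He) as [d [Hd H]]; exists d; split; auto. intros y _; apply H.
Qed.

Lemma proj_close (E : bundle L) l l' (eps : R) w : fiber E l w ->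
  fnorm (bN E) (bN E) (msub (bQ E l') (bQ E l)) < eps -> vnorm (bN E) w = 1 ->
  vnorm (bN E) (vsub (mv (bN E) (bQ E l') w) w) < eps.
Proof.
  intros Hf He Hw. rewrite <- (fiber_fix E l w Hf) at 2. rewrite <- mv_msub.
  eapply Rle_lt_trans; [apply mv_bound|]. rewrite Hw, Rmult_1_r; exact He.
Qed.

Lemma fnorm_msub_sym (n : nat) (A B : mat) : fnorm n n (msub A B) = fnorm n n (msub B A).
Proof.
  unfold fnorm; f_equal; apply sumn_ext; intros; apply sumn_ext; intros; unfold msub; ring.
Qed.

Lemma mv_near_bound (n : nat) (A B : mat) v : fnorm n n (msub A B) < 1 ->
  vnorm n (mv n A v) <= (fnorm n n B + 1) * vnorm n v.
Proof.
  intros H. eapply Rle_trans; [apply (vnorm_triang_sub n _ (mv n B v))|].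
  rewrite <- mv_msub. pose proof (mvr_bound n n B v). pose proof (mvr_bound n n (msub A B) v).
  pose proof (vnorm_nonneg n v). unfold mv in *. nra.
Qed.

Lemma fnorm_self_sub (n : nat) (B : mat) : fnorm n n (msub B B) = 0.
Proof.
  unfold fnorm; rewrite sumn_zero; [apply sqrt_0|].
  intros; apply sumn_zero; intros; unfold msub; ring.
Qed.

(** The normalized projections between nearby fibres are inverse to each other up to short straight
    homotopies. With [eps = / (4 * C)] the first projection moves a unit vector by less than [eps],
    normalizing doubles this, and the second projection enlarges it by a factor of at most [C]: the
    total is at most [1 / 2], as [hmt_close] requires. *)
Lemma local_trivial (E : bundle L) (l1 : L) : is_bundle dist E ->
  exists del, 0 < del /\ forall A : L -> Prop, (forall l, A l -> dist l1 l < del) ->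
    fheq A (cobj E l1) (sobj E) (fun l w => nrm (bN E) (mv (bN E) (bQ E l) w)).
Proof.
  intros HE. set (n := bN E). set (C := fnorm n n (bQ E l1) + 1).
  assert (HC : 1 <= C) by (unfold C; pose proof (fnorm_nonneg n n (bQ E l1)); lra).
  set (eps := / (4 * C)).
  assert (Heps : 0 < eps) by (apply Rinv_0_lt_compat; lra).
  assert (HepsC : 4 * C * eps = 1) by (unfold eps; field; lra).
  destruct (bundle_near E l1 eps HE Heps) as [del [Hd Hdel]].
  exists del; split; auto. intros A HA.
  assert (Hnear : forall l, A l -> fnorm n n (msub (bQ E l) (bQ E l1)) < eps) by auto.
  set (U := fun (l : L) w => nrm n (mv n (bQ E l) w)).
  set (V := fun (l : L) w => nrm n (mv n (bQ E l1) w)).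
  assert (Ueps : forall l w, A l -> sph E l1 w -> vnorm n (vsub (mv n (bQ E l) w) w) < eps).
  { intros l w Hl [Hw1 Hw2]; apply (proj_close E l1 l); auto. }
  assert (Veps : forall l w, A l -> sph E l w -> vnorm n (vsub (mv n (bQ E l1) w) w) < eps).
  { intros l w Hl [Hw1 Hw2]; apply (proj_close E l l1); auto. rewrite fnorm_msub_sym; auto. }
  assert (CU : contD (dP n) (dV n) (fdom A (cobj E l1)) (fun p => mv n (bQ E (fst p)) (snd p))).
  { apply contD_bQ; auto using contP_l, contP_v. }
  assert (CV : contD (dP n) (dV n) (fdom A (sobj E)) (fun p => mv n (bQ E l1) (snd p))).
  { apply contD_mvr; auto using contP_v. intros; apply contD_cR. }
  assert (Hlt1 : forall u w, vnorm n w = 1 -> vnorm n (vsub u w) < eps ->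
    vnorm n u <> 0 /\ vnorm n (vsub (nrm n u) w) < 2 * eps).
  { intros u w Hw Hu. destruct (nrm_close n u w Hw) as [H1 H2]; [nra|]. split; auto. lra. }
  assert (HU : fm A (cobj E l1) (sobj E) U).
  { apply fm_nrm; auto. intros l v Hl Hv; split; [now apply fiber_proj|].
    apply (Hlt1 _ v); [apply Hv|auto]. }
  set (V1 := fun (l : L) (w : vec) => mv n (bQ E l1) w).
  assert (HV : fm A (sobj E) (cobj E l1) V).
  { split.
    - intros l v Hl Hv; apply sph_nrm; [now apply fiber_proj|]. apply (Hlt1 _ v); [apply Hv|]. now apply (Veps l).
    - apply contD_vscal; auto. apply contD_inv; [now apply contD_vnorm|].
      intros x [Hx1 Hx2]. apply (Hlt1 _ (snd x)); [apply Hx2|]. now apply (Veps (fst x)). }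
  assert (Cnrm : forall D (f : L * vec -> vec), contD (dP n) (dV n) D f ->
    (forall x, D x -> vnorm n (f x) <> 0) -> contD (dP n) (dV n) D (fun x => nrm n (f x))).
  { intros D f Hf H. apply contD_vscal; auto. apply contD_inv; auto. now apply contD_vnorm. }
  split; auto. exists V; split; [split; auto|].
  - (* The target is constant: view it as the bundle with constant projection [bQ E l1]. *)
    set (E1 := mkBundle (L := L) n (fun _ => bQ E l1)).
    change (hmt A (cobj E l1) (sobj E1) (fun l v => V l (U l v)) (fun _ v => v)).
    apply hmt_sym. unfold V.
    apply (hmt_close A (cobj E l1) E1 (fun _ v => v) (fun l v => mv n (bQ E l1) (U l v))).
    + apply (fm_id A (cobj E l1)).
    + apply contD_mvr; [intros; apply contD_cR|]. apply HU.
    + intros l v Hl Hv; split; [now apply (fiber_proj E l1)|]. simpl.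
      destruct Hv as [Hv1 Hv2]. rewrite <- (fiber_fix E l1 v Hv1) at 2.
      change (bN E) with n. rewrite <- mv_vsub.
      eapply Rle_lt_trans; [apply (mv_near_bound n _ (bQ E l1)); rewrite fnorm_self_sub; lra|].
      fold C. destruct (Hlt1 (mv n (bQ E l) v) v Hv2) as [_ Hu]; [apply Ueps; auto; split; auto|].
      unfold U. nra.
  - apply hmt_sym. unfold U.
    apply (hmt_close A (sobj E) E (fun _ v => v) (fun l v => mv n (bQ E l) (V l v))).
    + now apply fm_id.
    + apply contD_bQ; auto using contP_l. apply HV.
    + intros l v Hl Hv; split; [now apply fiber_proj|].
      pose proof (Veps l v Hl Hv) as He. destruct Hv as [Hv1 Hv2].
      rewrite <- (fiber_fix E l v Hv1) at 2. change (bN E) with n. rewrite <- mv_vsub.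
      eapply Rle_lt_trans; [apply (mv_near_bound n _ (bQ E l1)); specialize (Hnear l Hl); nra|].
      fold C. destruct (Hlt1 (mv n (bQ E l1) v) v Hv2 He) as [_ Hu].
      unfold V. nra.
Qed.

(** Together with [local_trivial] this reduces [g] near [l1], up to homotopy, to the single map
    [g l1] followed by the local trivialization. *)
Lemma local_const (E : bundle L) (M : nat) g (l1 : L) : is_bundle dist E ->
  fm (fun _ => True) (sphM M) (sobj E) g ->
  exists del, 0 < del /\ forall A : L -> Prop, (forall l, A l -> dist l1 l < del) ->
    hmt A (sphM M) (sobj E) g (fun l v => nrm (bN E) (mv (bN E) (bQ E l) (g l1 v))).
Proof.
  intros HE Hg. set (n := bN E). set (C := fnorm n n (bQ E l1) + 1).
  assert (HC : 1 <= C) by (unfold C; pose proof (fnorm_nonneg n n (bQ E l1)); lra).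
  destruct (bundle_near E l1 1 HE Rlt_0_1) as [d1 [Hd1 H1]].
  destruct (sphere_uniform M n g) with (l := l1) (eps := / (2 * C)) as [d2 [Hd2 H2]].
  - eapply contD_sub; [|apply Hg]. intros x Hx; split; auto.
  - apply Rinv_0_lt_compat; lra.
  - exists (Rmin d1 d2); split; [now apply Rmin_pos|]. intros A HA.
    assert (HA1 : forall l, A l -> dist l1 l < d1) by (intros l Hl; eapply Rlt_le_trans; [apply HA, Hl|apply Rmin_l]).
    assert (HA2 : forall l, A l -> dist l1 l < d2) by (intros l Hl; eapply Rlt_le_trans; [apply HA, Hl|apply Rmin_r]).
    apply hmt_close.
    + apply (fm_sub (fun _ => True)); auto.
    + apply contD_bQ; auto using contP_l.
      apply (fm_eval (dP M) (fdom A (sphM M)) (fun _ => True) (sphM M) (sobj E) g (fun _ => l1) snd Hg).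
      * apply contD_const, metric_refl.
      * now apply contP_v.
      * intros c Hc; split; auto. apply Hc.
    + intros l v Hl Hv; split; [now apply fiber_proj|].
      assert (Hgf : sph E l (g l v)) by (apply Hg; auto).
      rewrite <- (fiber_fix E l (g l v) (proj1 Hgf)) at 1. fold n. rewrite <- mv_vsub.
      eapply Rle_lt_trans; [apply (mv_near_bound n _ (bQ E l1)), H1; auto|]. fold C.
      specialize (H2 l v (HA2 l Hl) Hv). rewrite vnorm_sub_sym.
      apply (Rmult_lt_compat_l C) in H2; [|lra]. replace (C * / (2 * C)) with (/ 2) in H2 by (field; lra).
      lra.
Qed.

(** Near [l1] the map is a constant map followed by an equivalence. Hence being an equivalence on
    the fibre is a locally constant property, which spreads along paths from [l0], and it implies
    equivalence over a whole neighbourhood; a finite cover by such neighbourhoods is fed to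
    [fheq_of_cover]. *)
Theorem sphere_map_fheq (E : bundle L) (M : nat) g (l0 : L) :
  mcompact dist -> mpath_connected dist -> is_bundle dist E ->
  fm (fun _ => True) (sphM M) (sobj E) g ->
  fheq (eq l0) (sphM M) (sobj E) g ->
  fheq (fun _ => True) (sphM M) (sobj E) g.
Proof.
  intros Hc Hp HE Hg H0.
  assert (Hloc : forall l1, exists del, 0 < del /\ forall A : L -> Prop, (forall l, A l -> dist l1 l < del) ->
    (fheq (eq l1) (sphM M) (sobj E) g -> fheq A (sphM M) (sobj E) g) /\
    (forall l, A l -> fheq (eq l) (sphM M) (sobj E) g -> fheq (eq l1) (sphM M) (sobj E) g)).
  { intros l1. destruct (local_trivial E l1 HE) as [d1 [Hd1 H1]].
    destruct (local_const E M g l1 HE Hg) as [d2 [Hd2 H2]].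
    exists (Rmin d1 d2); split; [now apply Rmin_pos|]. intros A HA.
    assert (HA1 : forall l, A l -> dist l1 l < d1) by (intros l Hl; eapply Rlt_le_trans; [apply HA, Hl|apply Rmin_l]).
    assert (HA2 : forall l, A l -> dist l1 l < d2) by (intros l Hl; eapply Rlt_le_trans; [apply HA, Hl|apply Rmin_r]).
    split.
    - intros Hf. eapply fheq_hmt; [apply hmt_sym, (H2 A HA2)|].
      apply (fheq_comp A (sphM M) (cobj E l1) (sobj E) (fun _ => g l1) (fun l w => nrm (bN E) (mv (bN E) (bQ E l) w))).
      + apply (fheq_const l1 A (sphM M) (sobj E) (sphM M) (cobj E l1) g); auto; intros; reflexivity.
      + now apply H1.
    - intros l Hl Hf.
      (* With [U] the local trivialization at [l] and [V] its inverse, [V g ~ V U (g l1) ~ g l1]. *)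
      assert (Hf1 : fheq (eq l) (sphM M) (cobj E l1) (fun _ => g l1)).
      { destruct (H1 (eq l)) as [HU [V [[HV1 HV2] HV3]]]; [intros ? <-; auto|].
        assert (HV : fheq (eq l) (sobj E) (cobj E l1) V).
        { split; auto. eexists; split; [split; [exact HU|exact HV3]|exact HV2]. }
        set (U := fun l w => nrm (bN E) (mv (bN E) (bQ E l) w)) in *.
        eapply fheq_hmt; [|apply (fheq_comp (eq l) (sphM M) (sobj E) (cobj E l1) g V Hf HV)].
        apply (hmt_trans (eq l) (sphM M) (cobj E l1) _ (fun l v => V l (U l (g l1 v)))).
        - apply (hmt_comp_l (eq l) (sphM M) (sobj E) (cobj E l1) g (fun l v => U l (g l1 v)) V); auto.
          apply H2; intros ? <-; auto.
        - apply (hmt_comp_r (eq l) (sphM M) (cobj E l1) (cobj E l1)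
            (fun l w => V l (U l w)) (fun _ w => w) (fun _ => g l1)); auto.
          apply (fm_const l1 (eq l) (sphM M) (sobj E) (sphM M) (cobj E l1) g); auto; try (intros; reflexivity).
          apply (fm_sub (fun _ => True)); auto. }
      assert (Hf2 : fheq (eq l1) (sphM M) (sobj E) (fun _ => g l1)).
      { apply (fheq_const l (eq l1) (sphM M) (cobj E l1) (sphM M) (sobj E) (fun _ => g l1)); auto.
        - intros; reflexivity.
        - intros ? v <-; reflexivity. }
      destruct Hf2 as [Hm Hrest]. eapply fheq_hmt; [|split; [exact Hm|exact Hrest]].
      apply (hmt_ext (eq l1) (sphM M) (sobj E) (fun _ => g l1) (fun _ => g l1)); auto.
      + intros ? v <- _; reflexivity.
      + now apply hmt_refl. }
  assert (Hall : forall l, fheq (eq l) (sphM M) (sobj E) g).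
  { intros l; apply (path_connected_ind (fun l => fheq (eq l) (sphM M) (sobj E) g) Hp) with (x := l0); auto.
    intros l1; destruct (Hloc l1) as [del [Hd H]]. exists del; split; auto. intros l' Hl'.
    split.
    - apply (H (eq l')); intros ? <-; auto.
    - apply (proj2 (H (eq l') ltac:(intros ? <-; auto)) l' eq_refl). }
  apply functional_choice in Hloc; destruct Hloc as [F HF].
  (* Scaled so that the sets [w < 1] cover while [w <= 2] still lies inside the ball of radius
     [F l1]. *)
  set (w := fun l1 l => 3 / F l1 * dist l1 l).
  assert (HF0 : forall l, 0 < 3 / F l) by (intros l; apply Rdiv_lt_0_compat; [lra|apply HF]).
  destruct (Hc L (fun l1 l => w l1 l < 1)) as [ls Hls].
  - intros l1 x Hx. exists ((1 - w l1 x) / (3 / F l1)).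
    split; [apply Rdiv_lt_0_compat; [lra|auto]|]. intros y Hy.
    apply (Rmult_lt_compat_l (3 / F l1)) in Hy; auto.
    assert (Hdiv : forall c z, 0 < c -> c * (z / c) = z) by (intros; field; lra).
    rewrite Hdiv in Hy by auto.
    unfold w in *. pose proof (metric_triang l1 x y). specialize (HF0 l1). nra.
  - intros x; exists x; unfold w. rewrite (metric_refl); lra.
  - apply (fheq_of_cover (sphM M) (sobj E) g (map w ls) Hg).
    + intros u Hu; apply in_map_iff in Hu; destruct Hu as [l1 [<- Hl1]]. split.
      * apply contD_scal. now apply contD_dist.
      * apply (proj2 (HF l1) (fun l => w l1 l <= 2)); [|apply Hall].
        intros l Hl; unfold w in Hl. pose proof (proj1 (HF l1)).
        apply (Rmult_lt_reg_l (3 / F l1)); auto. replace (3 / F l1 * F l1) with 3 by (field; lra). lra.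
    + intros l; destruct (Hls l) as [l1 [Hin Hl]]. exists (w l1); split; [now apply in_map|lra].
Qed.

End Metric.

(** * Dimension and rank *)

Definition lincomb (r : nat) (c : nat -> R) (b : nat -> vec) : vec :=
  fun i => sumn r (fun k => c k * b k i).

Definition basis_of (N : nat) (V : vec -> Prop) (r : nat) (b : nat -> vec) : Prop :=
  (forall k, (k < r)%nat -> V (b k)) /\ lin_indep N r b /\
  forall v, V v -> exists c, eqv N v (lincomb r c b).

Definition has_dim (N : nat) (V : vec -> Prop) (r : nat) : Prop := exists b, basis_of N V r b.

Definition subspace (N : nat) (V : vec -> Prop) : Prop :=
  (forall v, V v -> supp N v) /\ V zerov /\
  (forall u v, V u -> V v -> V (vadd u v)) /\ (forall c v, V v -> V (vscal c v)).

(** The increasing enumeration of all indices other than [p]. *)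
Definition skip (p k : nat) : nat := if Nat.ltb k p then k else S k.

Lemma sumn_skip (n p : nat) (g : nat -> R) : (p <= n)%nat ->
  sumn (S n) g = g p + sumn n (fun k => g (skip p k)).
Proof.
  induction n as [|n IH]; intros Hp.
  - replace p with 0%nat by lia; simpl; ring.
  - destruct (Nat.eq_dec p (S n)) as [->|Hne].
    + rewrite (sumn_ext (S n) (fun k => g (skip (S n) k)) g); [simpl; ring|].
      intros k Hk; unfold skip; now rewrite (proj2 (Nat.ltb_lt k (S n))).
    + change (sumn (S (S n)) g) with (sumn (S n) g + g (S n)). rewrite IH by lia.
      simpl. unfold skip at 3. rewrite (proj2 (Nat.ltb_ge n p)) by lia. ring.
Qed.

(** Gaussian elimination on the last coordinate: either all vectors vanish there, or a pivot [b p]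
    clears it from the others, at the cost of one vector and one coordinate. *)
Lemma dependent_family (m n : nat) (b : nat -> vec) : (m < n)%nat ->
  exists c, (exists k, (k < n)%nat /\ c k <> 0) /\ eqv m (lincomb n c b) zerov.
Proof.
  revert n b; induction m as [|m IH]; intros n b Hmn.
  - exists (fun _ => 1); split; [exists 0%nat; split; [lia|lra]|]. intros i Hi; lia.
  - destruct (classic (exists p, (p < n)%nat /\ b p m <> 0)) as [[p [Hp Hb]]|Hn].
    + destruct n as [|n]; [lia|].
      destruct (IH n (fun k => vsub (b (skip p k)) (vscal (b (skip p k) m / b p m) (b p)))) as [c [[k [Hk Hck]] Hc]]; [lia|].
      set (c' := fun j => if Nat.eqb j p then - sumn n (fun k => c k * (b (skip p k) m / b p m))
                          else if Nat.ltb j p then c j else c (j - 1)%nat).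
      assert (Hskip : forall k, c' (skip p k) = c k).
      { intros j; unfold c', skip. destruct (Nat.ltb_spec j p) as [H1|H1].
        - now rewrite (proj2 (Nat.eqb_neq j p)), (proj2 (Nat.ltb_lt j p)) by lia.
        - rewrite (proj2 (Nat.eqb_neq (S j) p)), (proj2 (Nat.ltb_ge (S j) p)) by lia. f_equal; lia. }
      assert (Hp' : c' p = - sumn n (fun k => c k * (b (skip p k) m / b p m)))
        by (unfold c'; now rewrite Nat.eqb_refl).
      assert (Hcomb : forall i, lincomb (S n) c' b i =
        sumn n (fun k => c k * (b (skip p k) i - b (skip p k) m / b p m * b p i))).
      { intros i; unfold lincomb; rewrite (sumn_skip n p) by lia. rewrite Hp'.
        rewrite (sumn_ext n (fun k => c k * (b (skip p k) i - b (skip p k) m / b p m * b p i))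
          (fun k => c' (skip p k) * b (skip p k) i + (- b p i) * (c k * (b (skip p k) m / b p m))))
          by (intros; rewrite Hskip; ring).
        rewrite sumn_plus, sumn_scal; ring. }
      exists c'; split.
      * exists (skip p k); rewrite Hskip; split; auto. unfold skip; destruct Nat.ltb; lia.
      * intros i Hi; rewrite Hcomb. destruct (Nat.eq_dec i m) as [->|Hne].
        -- apply sumn_zero; intros; field; auto.
        -- apply (Hc i); lia.
    + destruct (IH n b) as [c [Hc1 Hc2]]; [lia|]. exists c; split; auto.
      intros i Hi; destruct (Nat.eq_dec i m) as [->|Hne]; [|apply Hc2; lia].
      apply sumn_zero; intros k Hk. destruct (Req_dec (b k m) 0) as [E|E]; [rewrite E; ring|].
      exfalso; apply Hn; exists k; auto.
Qed.

Lemma lincomb_lincomb (r s : nat) (c : nat -> R) (a : nat -> nat -> R) (e : nat -> vec) :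
  lincomb r c (fun k => lincomb s (a k) e) = lincomb s (lincomb r c a) e.
Proof.
  extensionality i; unfold lincomb.
  rewrite (sumn_ext r _ (fun k => sumn s (fun j => c k * a k j * e j i))).
  - rewrite sumn_swap; apply sumn_ext; intros j _.
    rewrite Rmult_comm, <- sumn_scal; apply sumn_ext; intros; ring.
  - intros k _; rewrite <- sumn_scal; apply sumn_ext; intros; ring.
Qed.

(** If [s < r], the coefficient vectors [a k] of the images in the basis of [W] are linearly
    dependent, and injectivity carries the relation back to the basis of [V]. *)
Lemma dim_le_of_inj (N M : nat) (V W : vec -> Prop) (r s : nat) (t : vec -> vec) :
  subspace N V -> has_dim N V r -> has_dim M W s ->
  (forall v, V v -> W (t v)) ->
  (forall n c b, (forall k, (k < n)%nat -> V (b k)) ->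
     eqv M (t (lincomb n c b)) (lincomb n c (fun k => t (b k)))) ->
  (forall v, V v -> eqv M (t v) zerov -> eqv N v zerov) -> (r <= s)%nat.
Proof.
  intros HV [b [Hb1 [Hb2 Hb3]]] [e [He1 [He2 He3]]] HW Hlin Hinj.
  destruct (Nat.le_gt_cases r s) as [H|H]; auto. exfalso.
  assert (Ha : forall k, exists a, (k < r)%nat -> eqv M (t (b k)) (lincomb s a e)).
  { intros k; destruct (Nat.lt_ge_cases k r) as [Hk|Hk].
    - destruct (He3 (t (b k))) as [a Ha]; auto. now exists a.
    - exists (fun _ => 0); lia. }
  apply functional_choice in Ha; destruct Ha as [a Ha].
  destruct (dependent_family s r a H) as [c [[k [Hk Hck]] Hc]].
  apply Hck, (Hb2 c); auto. apply (Hinj (lincomb r c b)).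
  - destruct HV as [_ [H0 [Hadd Hsc]]]. clear - Hb1 H0 Hadd Hsc.
    induction r as [|r IH]; [exact H0|].
    change (lincomb (S r) c b) with (vadd (lincomb r c b) (vscal (c r) (b r))). auto with arith.
  - intros i Hi. rewrite (Hlin r c b) by auto.
    transitivity (lincomb r c (fun k => lincomb s (a k) e) i).
    + apply sumn_ext; intros j Hj; now rewrite Ha.
    + rewrite lincomb_lincomb. apply sumn_zero; intros j Hj; rewrite (Hc j Hj); unfold zerov; ring.
Qed.

Lemma dim_unique (N : nat) (V : vec -> Prop) (r s : nat) :
  subspace N V -> has_dim N V r -> has_dim N V s -> r = s.
Proof.
  intros HV Hr Hs; apply Nat.le_antisymm;
    apply (dim_le_of_inj N N V V _ _ (fun v => v)); auto; intros; intros i Hi; auto.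
Qed.

(** Induction on the ambient dimension: a basis of the part of [V] with vanishing last coordinate
    needs at most one further vector [w]. *)
Lemma dim_exists (N : nat) (V : vec -> Prop) : subspace N V -> exists r, has_dim N V r.
Proof.
  revert V; induction N as [|N IH]; intros V [Hs [H0 [Hadd Hsc]]].
  - exists 0%nat, (fun _ => zerov); split; [|split].
    + intros; lia.
    + intros c _ k Hk; lia.
    + intros v Hv; exists (fun _ => 0); intros i Hi; lia.
  - destruct (IH (fun v => V v /\ supp N v)) as [r [b [Hb1 [Hb2 Hb3]]]].
    { split; [tauto|]. split; [split; auto; apply supp_zerov|]. split.
      - intros u v [? ?] [? ?]; split; auto using supp_vadd.
      - intros c v [? ?]; split; auto using supp_vscal. }
    destruct (classic (exists w, V w /\ w N <> 0)) as [[w [Hw HwN]]|Hn].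
    + set (b' := fun k => if Nat.eqb k r then w else b k).
      assert (Hb'r : b' r = w) by (unfold b'; now rewrite Nat.eqb_refl).
      assert (Hb'k : forall k, (k < r)%nat -> b' k = b k).
      { intros k Hk; unfold b'; now rewrite (proj2 (Nat.eqb_neq k r)) by lia. }
      assert (Hcomb : forall c i, lincomb (S r) c b' i = lincomb r c b i + c r * w i).
      { intros c i; unfold lincomb; simpl; rewrite Hb'r. f_equal.
        apply sumn_ext; intros k Hk; now rewrite Hb'k. }
      assert (HN : forall c, lincomb r c b N = 0).
      { intros c; apply sumn_zero; intros k Hk. rewrite (proj2 (Hb1 k Hk)) by lia; ring. }
      exists (S r), b'; split; [|split].
      * intros k Hk; destruct (Nat.eq_dec k r) as [->|Hne]; [now rewrite Hb'r|].
        rewrite Hb'k by lia. apply Hb1; lia.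
      * intros c Hc.
        assert (Hcr : c r = 0).
        { specialize (Hc N (Nat.lt_succ_diag_r N)). change (lincomb (S r) c b' N = 0) in Hc.
          rewrite Hcomb, HN in Hc. nra. }
        intros k Hk; destruct (Nat.eq_dec k r) as [->|Hne]; auto.
        apply Hb2; [|lia]. intros i Hi. specialize (Hc i (Nat.lt_lt_succ_r _ _ Hi)).
        change (lincomb (S r) c b' i = 0) in Hc. rewrite Hcomb, Hcr in Hc.
        unfold zerov; unfold lincomb in Hc; lra.
      * intros v Hv. set (a := v N / w N).
        destruct (Hb3 (vsub v (vscal a w))) as [c Hc].
        { split; [rewrite vsub_vadd; auto|]. intros i Hi. destruct (Nat.eq_dec i N) as [->|Hne].
          - unfold vsub, vscal, a; field; auto.
          - unfold vsub, vscal. rewrite (Hs v Hv), (Hs w Hw) by lia; ring. }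
        exists (fun k => if Nat.eqb k r then a else c k). intros i Hi. rewrite Hcomb, Nat.eqb_refl.
        replace (lincomb r (fun k => if Nat.eqb k r then a else c k) b i) with (lincomb r c b i)
          by (apply sumn_ext; intros k Hk; now rewrite (proj2 (Nat.eqb_neq k r)) by lia).
        destruct (Nat.eq_dec i N) as [->|Hne].
        -- change (v N = lincomb r c b N + a * w N). rewrite HN; unfold a; field; auto.
        -- assert (Hi' : (i < N)%nat) by lia. specialize (Hc i Hi').
           change (v i - a * w i = lincomb r c b i) in Hc; lra.
    + assert (HVN : forall v, V v -> V v /\ supp N v).
      { intros v Hv; split; auto. intros i Hi. destruct (Nat.eq_dec i N) as [->|Hne].
        - destruct (Req_dec (v N) 0) as [E|E]; auto. exfalso; apply Hn; exists v; auto.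
        - apply Hs; auto; lia. }
      exists r, b; split; [intros; apply Hb1; auto|split].
      * intros c Hc; apply Hb2. intros i Hi; apply Hc; lia.
      * intros v Hv; destruct (Hb3 v (HVN v Hv)) as [c Hc]. exists c; intros i Hi.
        destruct (Nat.eq_dec i N) as [->|Hne]; [|apply Hc; lia].
        rewrite (proj2 (HVN v Hv)) by lia. symmetry; apply sumn_zero; intros k Hk.
        rewrite (proj2 (Hb1 k Hk)) by lia; ring.
Qed.

Lemma linear_lincomb (N : nat) (V : vec -> Prop) (t : vec -> vec) :
  subspace N V ->
  (forall u v, V u -> V v -> t (vadd u v) = vadd (t u) (t v)) ->
  (forall c v, V v -> t (vscal c v) = vscal c (t v)) ->
  forall n c b, (forall k, (k < n)%nat -> V (b k)) ->
    t (lincomb n c b) = lincomb n c (fun k => t (b k)) /\ V (lincomb n c b).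
Proof.
  intros [_ [H0 [Hadd Hsc]]] Ha Hs n c b; induction n as [|n IH]; intros Hb.
  - split; [|exact H0]. change (t zerov = zerov).
    replace zerov with (vscal 0 zerov) at 1 by (extensionality i; unfold vscal, zerov; ring).
    rewrite Hs by auto. extensionality i; unfold vscal, zerov; ring.
  - destruct IH as [IH1 IH2]; [auto with arith|].
    change (lincomb (S n) c b) with (vadd (lincomb n c b) (vscal (c n) (b n))).
    split; [|auto with arith].
    rewrite Ha, Hs, IH1 by auto with arith. reflexivity.
Qed.

Section Rank.
Context {L : Type} (dist : L -> L -> R).
Hypothesis Hmet : is_metric dist.

Lemma fiber_subspace (E : bundle L) l : subspace (bN E) (fiber E l).
Proof.
  split; [apply fiber_supp|split; [|split]].
  - apply fiber_intro, mv_zerov.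
  - intros; now apply fiber_vadd.
  - intros; now apply fiber_vscal.
Qed.

(** For [v] in the fibre over [l] that is killed by the projection over [l'], the difference of the
    projections sends [v] to [- v], impossible for [v <> 0] when its norm is below 1. Applied both
    ways, this makes the rank locally constant. *)
Lemma proj_inj (E : bundle L) l l' v : fiber E l v ->
  fnorm (bN E) (bN E) (msub (bQ E l') (bQ E l)) < 1 ->
  eqv (bN E) (mv (bN E) (bQ E l') v) zerov -> eqv (bN E) v zerov.
Proof.
  intros Hv Hn H0. apply vnorm_zero_eqv.
  pose proof (mvr_bound (bN E) (bN E) (msub (bQ E l') (bQ E l)) v) as Hb.
  change (mvr (bN E) (bN E)) with (mv (bN E)) in Hb.
  rewrite mv_msub, (fiber_fix E l v Hv) in Hb.
  rewrite (vnorm_ext _ (vsub (mv (bN E) (bQ E l') v) v) (vscal (-1) v)) in Hb.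
  - rewrite vnorm_scal, Rabs_left in Hb by lra. pose proof (vnorm_nonneg (bN E) v). nra.
  - intros i Hi. unfold vsub, vscal. rewrite H0 by auto. unfold zerov; ring.
Qed.

Lemma dim_near (E : bundle L) l l' r s : is_bundle dist E ->
  fnorm (bN E) (bN E) (msub (bQ E l') (bQ E l)) < 1 ->
  has_dim (bN E) (fiber E l) r -> has_dim (bN E) (fiber E l') s -> r = s.
Proof.
  intros HE Hn Hr Hs.
  assert (Hle : forall a b p q, fnorm (bN E) (bN E) (msub (bQ E b) (bQ E a)) < 1 ->
    has_dim (bN E) (fiber E a) p -> has_dim (bN E) (fiber E b) q -> (p <= q)%nat).
  { intros a b p q Hab Hp Hq.
    apply (dim_le_of_inj (bN E) (bN E) (fiber E a) (fiber E b) p q (mv (bN E) (bQ E b))); auto.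
    - apply fiber_subspace.
    - intros; now apply (fiber_proj dist).
    - intros n c e He i _.
      destruct (linear_lincomb (bN E) (fiber E a) (mv (bN E) (bQ E b)) (fiber_subspace E a)) with n c e
        as [-> _]; auto.
      + intros; apply mv_vadd.
      + intros; apply mv_vscal.
    - intros v Hv; now apply (proj_inj E a b). }
  apply Nat.le_antisymm; [apply (Hle l l')|apply (Hle l' l)]; auto. now rewrite fnorm_msub_sym.
Qed.

Lemma bundle_rank_of_fiber (E : bundle L) l0 r : is_bundle dist E -> mpath_connected dist ->
  has_dim (bN E) (fiber E l0) r -> bundle_rank E r.
Proof.
  intros HE Hp H0 l.
  apply (path_connected_ind dist (fun l => has_dim (bN E) (fiber E l) r) Hp) with (x := l0); auto.
  intros l1. destruct (bundle_near dist E l1 1 HE Rlt_0_1) as [del [Hd Hdel]].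
  exists del; split; auto. intros l' Hl'; specialize (Hdel l' Hl').
  destruct (dim_exists _ _ (fiber_subspace E l1)) as [p Hp1].
  destruct (dim_exists _ _ (fiber_subspace E l')) as [q Hq].
  assert (p = q) by (eapply dim_near; eauto). subst q.
  split; intros H.
  - now rewrite (dim_unique _ _ _ _ (fiber_subspace E l1) H Hp1).
  - now rewrite (dim_unique _ _ _ _ (fiber_subspace E l') H Hq).
Qed.

Lemma bundle_rank_exists (E : bundle L) (l0 : L) : is_bundle dist E -> mpath_connected dist ->
  exists r, bundle_rank E r.
Proof.
  intros HE Hp; destruct (dim_exists _ _ (fiber_subspace E l0)) as [r Hr].
  exists r; now apply (bundle_rank_of_fiber E l0).
Qed.

End Rank.

(** * Isomorphisms of vector bundles *)

Definition vcat (n : nat) (u v : vec) : vec := fun i => if Nat.ltb i n then u i else v (i - n)%nat.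
Definition vdrop (n : nat) (v : vec) : vec := fun i => v (n + i)%nat.

Lemma vcat_lt (n : nat) (u v : vec) (i : nat) : (i < n)%nat -> vcat n u v i = u i.
Proof. intros H; unfold vcat; now rewrite (proj2 (Nat.ltb_lt i n)). Qed.

Lemma vcat_ge (n : nat) (u v : vec) (i : nat) : vcat n u v (n + i)%nat = v i.
Proof. unfold vcat; rewrite (proj2 (Nat.ltb_ge (n + i) n)) by lia. f_equal; lia. Qed.

Lemma vcat_le (n : nat) (u v : vec) (i : nat) : (n <= i)%nat -> vcat n u v i = v (i - n)%nat.
Proof. intros H; unfold vcat; now rewrite (proj2 (Nat.ltb_ge i n)). Qed.

Lemma vtrunc_vcat n u v : supp n u -> vtrunc n (vcat n u v) = u.
Proof.
  intros H; apply (supp_ext n); auto using supp_vtrunc.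
  intros i Hi; rewrite vtrunc_eqv by auto. now apply vcat_lt.
Qed.

Lemma vdrop_vcat n u v : vdrop n (vcat n u v) = v.
Proof. extensionality i; apply vcat_ge. Qed.

Lemma vcat_split n v : vcat n (vtrunc n v) (vdrop n v) = v.
Proof.
  extensionality i; destruct (Nat.lt_ge_cases i n) as [H|H].
  - rewrite vcat_lt by auto; now apply vtrunc_eqv.
  - replace i with (n + (i - n))%nat by lia. now rewrite vcat_ge.
Qed.

Lemma supp_vcat (n m : nat) (u v : vec) : supp m v -> supp (n + m)%nat (vcat n u v).
Proof.
  intros H i Hi. replace i with (n + (i - n))%nat by lia. rewrite vcat_ge. apply H; lia.
Qed.

Lemma supp_vdrop (n m : nat) (v : vec) : supp (n + m)%nat v -> supp m (vdrop n v).
Proof. intros H i Hi; unfold vdrop; apply H; lia. Qed.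

Lemma vtrunc_vadd n u v : vtrunc n (vadd u v) = vadd (vtrunc n u) (vtrunc n v).
Proof. extensionality i; unfold vtrunc, vadd; destruct Nat.ltb; ring. Qed.
Lemma vtrunc_vscal n c v : vtrunc n (vscal c v) = vscal c (vtrunc n v).
Proof. extensionality i; unfold vtrunc, vscal; destruct Nat.ltb; ring. Qed.
Lemma vcat_vadd n u v u' v' : vcat n (vadd u u') (vadd v v') = vadd (vcat n u v) (vcat n u' v').
Proof. extensionality i; unfold vcat, vadd; destruct Nat.ltb; ring. Qed.
Lemma vcat_vscal n c u v : vcat n (vscal c u) (vscal c v) = vscal c (vcat n u v).
Proof. extensionality i; unfold vcat, vscal; destruct Nat.ltb; ring. Qed.

Lemma vec_decomp (n : nat) (v : vec) : supp n v -> v = lincomb n v unitv.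
Proof.
  intros Hv; extensionality i; unfold lincomb. destruct (Nat.lt_ge_cases i n) as [Hi|Hi].
  - rewrite (sumn_delta n i); auto; unfold unitv.
    + rewrite Nat.eqb_refl; ring.
    + intros k Hk Hki; rewrite (proj2 (Nat.eqb_neq i k)) by auto; ring.
  - rewrite Hv by auto. symmetry; apply sumn_zero; intros k Hk; unfold unitv.
    rewrite (proj2 (Nat.eqb_neq i k)) by lia; ring.
Qed.

Lemma supp_subspace (n : nat) : subspace n (supp n).
Proof. split; auto. split; [apply supp_zerov|]. auto using supp_vadd, supp_vscal. Qed.

Lemma dim_supp (n : nat) : has_dim n (supp n) n.
Proof.
  exists unitv; split; [|split].
  - intros; now apply supp_unitv.
  - intros c Hc k Hk. specialize (Hc k Hk); cbv beta in Hc. rewrite (sumn_delta n k) in Hc; auto; unfold unitv in *.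
    + rewrite Nat.eqb_refl in Hc; unfold zerov in Hc; lra.
    + intros i Hi Hik; rewrite (proj2 (Nat.eqb_neq k i)) by auto; ring.
  - intros v Hv; exists v; intros i _. now rewrite <- (vec_decomp n v Hv).
Qed.

Lemma mv_bsum {L : Type} (E F : bundle L) l v :
  mv (bN E + bN F) (bQ (bsum E F) l) v =
  vcat (bN E) (mv (bN E) (bQ E l) (vtrunc (bN E) v)) (mv (bN F) (bQ F l) (vdrop (bN E) v)).
Proof.
  set (n := bN E); set (m := bN F).
  apply (supp_ext (n + m)); [apply supp_mv|apply supp_vcat, supp_mv|].
  intros i Hi; unfold mv at 1; rewrite mvr_lt, sumn_app by auto. fold n.
  destruct (Nat.lt_ge_cases i n) as [H|H].
  - rewrite vcat_lt by auto; unfold mv; rewrite mvr_lt by auto.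
    rewrite (sumn_zero m), Rplus_0_r.
    + apply sumn_ext; intros j Hj; rewrite vtrunc_eqv by auto. simpl; fold n.
      now rewrite (proj2 (Nat.ltb_lt i n)), (proj2 (Nat.ltb_lt j n)).
    + intros j Hj; simpl; fold n. rewrite (proj2 (Nat.ltb_lt i n)), (proj2 (Nat.ltb_ge (n + j) n)) by lia.
      rewrite (proj2 (Nat.leb_gt n i)) by lia; simpl; ring.
  - rewrite vcat_le by auto. unfold mv; rewrite mvr_lt by lia. rewrite (sumn_zero n), Rplus_0_l.
    + apply sumn_ext; intros j Hj. simpl; fold n.
      rewrite (proj2 (Nat.ltb_ge i n)), (proj2 (Nat.leb_le n i)), (proj2 (Nat.leb_le n (n + j))) by lia.
      simpl. unfold vdrop. do 2 f_equal; lia.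
    + intros j Hj; simpl; fold n.
      rewrite (proj2 (Nat.ltb_ge i n)), (proj2 (Nat.leb_gt n j)) by lia.
      rewrite Bool.andb_false_r; simpl; ring.
Qed.

Lemma fiber_bsum {L : Type} (E F : bundle L) l v :
  fiber (bsum E F) l v <-> fiber E l (vtrunc (bN E) v) /\ fiber F l (vdrop (bN E) v).
Proof.
  split.
  - intros H; apply fiber_fix in H.
    change (bN (bsum E F)) with (bN E + bN F)%nat in H. rewrite mv_bsum in H. split; apply fiber_intro.
    + rewrite <- H at 2. now rewrite vtrunc_vcat by apply supp_mv.
    + rewrite <- H at 2. now rewrite vdrop_vcat.
  - intros [H1 H2]; apply fiber_intro.
    change (bN (bsum E F)) with (bN E + bN F)%nat. rewrite mv_bsum.
    rewrite (fiber_fix E), (fiber_fix F) by auto. apply vcat_split.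
Qed.

Lemma fiber_triv {L : Type} (n : nat) (l : L) v : fiber (triv n) l v <-> supp n v.
Proof.
  split; [apply fiber_supp|]. intros H; apply fiber_intro; simpl. now apply mv_idm_supp.
Qed.

(** The kernels of the projectors, presented as images of the complementary projectors, the form in
    which bundles are encoded. *)
Definition KER {L : Type} (d : nat) (P : L -> Z -> mat) (k : Z) : bundle L :=
  mkBundle d (fun l i j =>
    if andb (Nat.ltb i d) (Nat.ltb j d) then idm d i j - P l k i j else 0).

Lemma mv_IM {L : Type} d (P : L -> Z -> mat) k l v : mv d (bQ (IM d P k) l) v = mv d (P l k) v.
Proof.
  apply mv_meq; intros i j Hi Hj; simpl.
  now rewrite (proj2 (Nat.ltb_lt i d)), (proj2 (Nat.ltb_lt j d)).
Qed.

Lemma mv_KER {L : Type} d (P : L -> Z -> mat) k l v :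
  mv d (bQ (KER d P k) l) v = mv d (msub (idm d) (P l k)) v.
Proof.
  apply mv_meq; intros i j Hi Hj; simpl.
  now rewrite (proj2 (Nat.ltb_lt i d)), (proj2 (Nat.ltb_lt j d)).
Qed.

Lemma fiber_IM {L : Type} d (P : L -> Z -> mat) k l v :
  fiber (IM d P k) l v <-> mv d (P l k) v = v.
Proof.
  split.
  - intros H; apply fiber_fix in H. now rewrite <- (mv_IM d P k).
  - intros H; apply fiber_intro. now rewrite mv_IM.
Qed.

Lemma fiber_KER {L : Type} d (P : L -> Z -> mat) k l v :
  fiber (KER d P k) l v <-> in_ker d (P l k) v.
Proof.
  split.
  - intros H; pose proof (fiber_supp _ _ _ H) as Hs; apply fiber_fix in H. simpl bN in H, Hs.
    rewrite mv_KER, mv_msub, mv_idm_supp in H by auto. split; auto.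
    intros i Hi. apply (f_equal (fun f => f i)) in H; unfold vsub in H. unfold zerov; lra.
  - intros [Hs H]; apply fiber_intro. simpl bN.
    rewrite mv_KER, mv_msub, mv_idm_supp by auto. extensionality i; unfold vsub.
    destruct (Nat.lt_ge_cases i d) as [Hi|Hi].
    + rewrite H by auto; unfold zerov; ring.
    + rewrite (supp_mv d (P l k)) by auto; ring.
Qed.

Section Iso.
Context {L : Type} (dist : L -> L -> R).
Hypothesis Hmet : is_metric dist.

Definition contS (n : nat) (f : L -> vec) : Prop := contD dist (dV n) (fun _ => True) f.

Lemma cont_L_contD (g : L -> R) : cont_L dist g <-> contD dist dR (fun _ => True) g.
Proof.
  split.
  - intros H x _ e He; destruct (H x e He) as [d [Hd H']]; exists d; split; auto. intros y _; apply H'.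
  - intros H x e He; destruct (H x I e He) as [d [Hd H']]; exists d; split; auto. intros y; now apply H'.
Qed.

Lemma cont_L_const (c : R) : cont_L dist (fun _ => c).
Proof. apply cont_L_contD, contD_cR. Qed.

Lemma is_bundle_triv n : is_bundle dist (triv (L := L) n).
Proof.
  split; [|split].
  - intros l i j H; simpl in *; unfold idm. destruct H as [H|H].
    + now rewrite (proj2 (Nat.ltb_ge i n)).
    + now rewrite (proj2 (Nat.ltb_ge j n)), Bool.andb_false_r.
  - intros i j; apply (cont_L_const (idm n i j)).
  - intros l; apply meq_of_mv; intros v Hv; simpl. now rewrite mv_mm, !(mv_idm_supp n v Hv).
Qed.

Lemma is_bundle_bsum E F : is_bundle dist E -> is_bundle dist F -> is_bundle dist (bsum E F).
Proof.
  intros [E1 [E2 E3]] [F1 [F2 F3]]; split; [|split].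
  - intros l i j H; simpl in *.
    destruct (Nat.ltb_spec i (bN E)), (Nat.ltb_spec j (bN E)); simpl; try lia;
    destruct (Nat.leb_spec (bN E) i), (Nat.leb_spec (bN E) j); simpl; auto; try lia.
    apply F1; lia.
  - intros i j; simpl. destruct (andb _ _); auto. destruct (andb _ _); auto.
    apply cont_L_const.
  - intros l; apply meq_of_mv; intros v Hv; simpl bN in *.
    rewrite mv_mm, !mv_bsum, vtrunc_vcat, vdrop_vcat, <- !mv_mm by apply supp_mv.
    now rewrite (mv_meq _ _ _ _ (E3 l)), (mv_meq _ _ _ _ (F3 l)).
Qed.

Lemma is_bundle_IM d (P : L -> Z -> mat) k :
  (forall i j, (i < d)%nat -> (j < d)%nat -> cont_L dist (fun l => P l k i j)) ->
  (forall l, meq d (mm d (P l k) (P l k)) (P l k)) -> is_bundle dist (IM d P k).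
Proof.
  intros Hc Hp; split; [|split].
  - intros l i j [H|H]; simpl in *.
    + now rewrite (proj2 (Nat.ltb_ge i d)).
    + now rewrite (proj2 (Nat.ltb_ge j d)), Bool.andb_false_r.
  - intros i j; simpl. destruct (Nat.ltb_spec i d), (Nat.ltb_spec j d); simpl; auto;
      apply cont_L_const.
  - intros l; apply meq_of_mv; intros v Hv; simpl bN.
    rewrite mv_mm, !mv_IM, <- mv_mm. apply mv_meq, Hp.
Qed.

Lemma is_bundle_KER d (P : L -> Z -> mat) k :
  (forall i j, (i < d)%nat -> (j < d)%nat -> cont_L dist (fun l => P l k i j)) ->
  (forall l, meq d (mm d (P l k) (P l k)) (P l k)) -> is_bundle dist (KER d P k).
Proof.
  intros Hc Hp; split; [|split].
  - intros l i j [H|H]; simpl in *.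
    + now rewrite (proj2 (Nat.ltb_ge i d)).
    + now rewrite (proj2 (Nat.ltb_ge j d)), Bool.andb_false_r.
  - intros i j; simpl. destruct (Nat.ltb_spec i d), (Nat.ltb_spec j d); simpl;
      try (apply cont_L_const).
    apply cont_L_contD, contD_minus; [apply contD_cR|]. apply cont_L_contD; auto.
  - intros l; apply meq_of_mv; intros v Hv; simpl bN.
    rewrite mv_mm, !mv_KER, !mv_msub, !mv_vsub, !mv_idm_supp by auto using supp_vsub, supp_mv.
    rewrite <- mv_mm, (mv_meq _ _ _ _ (Hp l)). extensionality i; unfold vsub; ring.
Qed.

(** Continuous families of linear maps without matrices: continuity is tested on continuous families
    of vectors, which composes well. [clin_matrix] recovers the matrix from the images of the unit
    vectors. *)
Definition clin (n m : nat) (t : L -> vec -> vec) : Prop :=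
  (forall l u v, supp n u -> supp n v -> t l (vadd u v) = vadd (t l u) (t l v)) /\
  (forall l c v, supp n v -> t l (vscal c v) = vscal c (t l v)) /\
  (forall l v, supp n v -> supp m (t l v)) /\
  (forall f, (forall l, supp n (f l)) -> contS n f -> contS m (fun l => t l (f l))).

(** A working form of [bundle_iso] with genuine equalities of vectors in place of [eqv]. *)
Definition biso (E F : bundle L) : Prop :=
  exists t s, clin (bN E) (bN F) t /\ clin (bN F) (bN E) s /\
    (forall l v, fiber E l v -> fiber F l (t l v) /\ s l (t l v) = v) /\
    (forall l w, fiber F l w -> fiber E l (s l w) /\ t l (s l w) = w).

Lemma clin_matrix n m t : clin n m t -> exists T : L -> mat,
  (forall i j, cont_L dist (fun l => T l i j)) /\
  forall l v, supp n v -> mvr m n (T l) v = t l v.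
Proof.
  intros [Ha [Hs [Hm Hc]]].
  exists (fun l i j => if andb (Nat.ltb i m) (Nat.ltb j n) then t l (unitv j) i else 0). split.
  - intros i j. destruct (Nat.ltb_spec i m), (Nat.ltb_spec j n); simpl;
      try (apply cont_L_const).
    apply cont_L_contD, (contD_coord dist (fun _ => True) m i (fun l => t l (unitv j))); auto.
    apply Hc; [intros; now apply supp_unitv|]. apply contD_vec; intros; apply contD_cR.
  - intros l v Hv. apply (supp_ext m); [apply supp_mvr|now apply Hm|]. intros i Hi.
    destruct (linear_lincomb n (supp n) (t l) (supp_subspace n)) with n v unitv as [E _]; auto using supp_unitv.
    rewrite <- (vec_decomp n v Hv) in E. rewrite E, mvr_lt by auto.
    apply sumn_ext; intros j Hj. rewrite (proj2 (Nat.ltb_lt i m)), (proj2 (Nat.ltb_lt j n)) by auto.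
    simpl; ring.
Qed.

Lemma bundle_iso_of_biso E F : biso E F -> bundle_iso dist E F.
Proof.
  intros [t [s [Ht [Hs [H1 H2]]]]].
  destruct (clin_matrix _ _ _ Ht) as [T [HT HT']]. destruct (clin_matrix _ _ _ Hs) as [S [HS HS']].
  exists T, S; split; auto; split; auto. intros l; split.
  - intros v Hv; destruct (H1 l v Hv) as [Hv1 Hv2].
    rewrite HT', HS' by (eapply fiber_supp; eauto). split; auto. rewrite Hv2; intros i _; reflexivity.
  - intros v Hv; destruct (H2 l v Hv) as [Hv1 Hv2].
    rewrite HS', HT' by (eapply fiber_supp; eauto). split; auto. rewrite Hv2; intros i _; reflexivity.
Qed.

Lemma clin_id n : clin n n (fun _ v => v).
Proof. repeat split; auto. Qed.

Lemma clin_comp n m k t s : clin n m t -> clin m k s -> clin n k (fun l v => s l (t l v)).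
Proof.
  intros [A1 [A2 [A3 A4]]] [B1 [B2 [B3 B4]]]; split; [|split; [|split]].
  - intros; rewrite A1, B1; auto.
  - intros; rewrite A2, B2; auto.
  - intros; auto.
  - intros f Hf Hc; apply (B4 (fun l => t l (f l))); auto.
Qed.

Lemma biso_refl E : biso E E.
Proof. exists (fun _ v => v), (fun _ v => v); repeat split; auto using clin_id; intros; apply H. Qed.

Lemma biso_sym E F : biso E F -> biso F E.
Proof. intros [t [s [Ht [Hs [H1 H2]]]]]; now exists s, t. Qed.

Lemma biso_trans E F G : biso E F -> biso F G -> biso E G.
Proof.
  intros [t [s [Ht [Hs [H1 H2]]]]] [t' [s' [Ht' [Hs' [H1' H2']]]]].
  exists (fun l v => t' l (t l v)), (fun l w => s l (s' l w)).
  split; [eapply clin_comp; eauto|]. split; [eapply clin_comp; eauto|]. split.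
  - intros l v Hv; destruct (H1 l v Hv) as [Ha Hb]; destruct (H1' l _ Ha) as [Hc Hd].
    split; auto. now rewrite Hd.
  - intros l v Hv; destruct (H2' l v Hv) as [Ha Hb]; destruct (H2 l _ Ha) as [Hc Hd].
    split; auto. now rewrite Hd.
Qed.

Lemma contS_vtrunc n m f : (n <= m)%nat -> contS m f -> contS n (fun l => vtrunc n (f l)).
Proof.
  intros Hnm Hf; apply contD_vec; intros i Hi.
  apply (contD_ext dist dR _ (fun l => f l i)); [intros; now rewrite vtrunc_eqv|].
  apply (contD_coord dist _ m); auto; lia.
Qed.

Lemma contS_vdrop n m f : contS (n + m) f -> contS m (fun l => vdrop n (f l)).
Proof.
  intros Hf; apply contD_vec; intros i Hi. apply (contD_coord dist _ (n + m)); auto; lia.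
Qed.

Lemma contD_vcat {C} (dC : C -> C -> R) D n m (f g : C -> vec) :
  contD dC (dV n) D f -> contD dC (dV m) D g -> contD dC (dV (n + m)) D (fun l => vcat n (f l) (g l)).
Proof.
  intros Hf Hg; apply contD_vec; intros i Hi. destruct (Nat.lt_ge_cases i n) as [H|H].
  - apply (contD_ext dC dR _ (fun l => f l i)); [intros; now rewrite vcat_lt|].
    now apply (contD_coord dC _ n).
  - apply (contD_ext dC dR _ (fun l => g l (i - n)%nat)).
    + intros; now rewrite vcat_le.
    + apply (contD_coord dC _ m); auto; lia.
Qed.

Lemma clin_block n m n' m' t s : clin n n' t -> clin m m' s ->
  clin (n + m) (n' + m') (fun l v => vcat n' (t l (vtrunc n v)) (s l (vdrop n v))).
Proof.
  intros [A1 [A2 [A3 A4]]] [B1 [B2 [B3 B4]]]; split; [|split; [|split]].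
  - intros l u v Hu Hv. rewrite vtrunc_vadd, A1 by apply supp_vtrunc.
    change (vdrop n (vadd u v)) with (vadd (vdrop n u) (vdrop n v)).
    rewrite B1 by now apply supp_vdrop. apply vcat_vadd.
  - intros l c v Hv. rewrite vtrunc_vscal, A2 by apply supp_vtrunc.
    change (vdrop n (vscal c v)) with (vscal c (vdrop n v)).
    rewrite B2 by now apply supp_vdrop. apply vcat_vscal.
  - intros l v Hv. now apply supp_vcat, B3, supp_vdrop.
  - intros f Hf Hc. apply contD_vcat.
    + apply (A4 (fun l => vtrunc n (f l))); [intros; apply supp_vtrunc|]. apply (contS_vtrunc n (n + m)); auto; lia.
    + apply (B4 (fun l => vdrop n (f l))); [intros; now apply supp_vdrop|]. now apply contS_vdrop.
Qed.

Lemma biso_bsum E E' F F' : biso E E' -> biso F F' -> biso (bsum E F) (bsum E' F').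
Proof.
  intros [t [s [Ht [Hs [H1 H2]]]]] [t' [s' [Ht' [Hs' [H1' H2']]]]].
  exists (fun l v => vcat (bN E') (t l (vtrunc (bN E) v)) (t' l (vdrop (bN E) v))).
  exists (fun l v => vcat (bN E) (s l (vtrunc (bN E') v)) (s' l (vdrop (bN E') v))).
  split; [now apply clin_block|]. split; [now apply clin_block|]. split.
  - intros l v Hv; apply fiber_bsum in Hv; destruct Hv as [Ha Hb].
    destruct (H1 l _ Ha) as [Hc Hd]. destruct (H1' l _ Hb) as [Hc' Hd'].
    rewrite fiber_bsum, vtrunc_vcat, vdrop_vcat, Hd, Hd' by (eapply fiber_supp; eauto).
    repeat split; try apply Hc; try apply Hc'. apply vcat_split.
  - intros l v Hv; apply fiber_bsum in Hv; destruct Hv as [Ha Hb].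
    destruct (H2 l _ Ha) as [Hc Hd]. destruct (H2' l _ Hb) as [Hc' Hd'].
    rewrite fiber_bsum, vtrunc_vcat, vdrop_vcat, Hd, Hd' by (eapply fiber_supp; eauto).
    repeat split; try apply Hc; try apply Hc'. apply vcat_split.
Qed.

Lemma biso_of_fiber E F : bN E = bN F -> (forall l v, fiber E l v <-> fiber F l v) -> biso E F.
Proof.
  intros HN H; exists (fun _ v => v), (fun _ v => v). rewrite HN.
  split; [apply clin_id|]. split; [apply clin_id|]. split; intros l v Hv; (split; [now apply H|reflexivity]).
Qed.

Lemma biso_comm E F : biso (bsum E F) (bsum F E).
Proof.
  assert (Hclin : forall n m, clin (n + m) (m + n) (fun _ v => vcat m (vdrop n v) (vtrunc n v))).
  { intros n m; split; [|split; [|split]].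
    - intros l u v Hu Hv. rewrite vtrunc_vadd.
      change (vdrop n (vadd u v)) with (vadd (vdrop n u) (vdrop n v)). apply vcat_vadd.
    - intros l c v Hv. rewrite vtrunc_vscal.
      change (vdrop n (vscal c v)) with (vscal c (vdrop n v)). apply vcat_vscal.
    - intros l v Hv. apply supp_vcat, supp_vtrunc.
    - intros f Hf Hc. apply contD_vcat; [now apply contS_vdrop|]. apply (contS_vtrunc n (n + m)); auto; lia. }
  assert (Hfib : forall (E F : bundle L) l v, fiber (bsum E F) l v ->
    fiber (bsum F E) l (vcat (bN F) (vdrop (bN E) v) (vtrunc (bN E) v)) /\
    vcat (bN E) (vdrop (bN F) (vcat (bN F) (vdrop (bN E) v) (vtrunc (bN E) v)))
      (vtrunc (bN F) (vcat (bN F) (vdrop (bN E) v) (vtrunc (bN E) v))) = v).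
  { intros E' F' l v Hv. apply fiber_bsum in Hv; destruct Hv as [Ha Hb].
    rewrite fiber_bsum, vtrunc_vcat, vdrop_vcat by (eapply fiber_supp; eauto).
    repeat split; try apply Ha; try apply Hb. apply vcat_split. }
  exists (fun _ v => vcat (bN F) (vdrop (bN E) v) (vtrunc (bN E) v)).
  exists (fun _ v => vcat (bN E) (vdrop (bN F) v) (vtrunc (bN F) v)).
  split; [apply Hclin|]. split; [apply Hclin|]. split; intros l v Hv; now apply Hfib.
Qed.

Lemma biso_assoc E F G : biso (bsum (bsum E F) G) (bsum E (bsum F G)).
Proof.
  apply biso_of_fiber; [simpl; lia|]. intros l v.
  rewrite !fiber_bsum. simpl bN.
  replace (vtrunc (bN E) (vtrunc (bN E + bN F) v)) with (vtrunc (bN E) v).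
  2:{ apply (supp_ext (bN E)); auto using supp_vtrunc. intros i Hi. rewrite !vtrunc_eqv by (auto; lia). reflexivity. }
  replace (vdrop (bN E) (vtrunc (bN E + bN F) v)) with (vtrunc (bN F) (vdrop (bN E) v)).
  2:{ extensionality i; unfold vdrop, vtrunc.
      destruct (Nat.ltb_spec i (bN F)), (Nat.ltb_spec (bN E + i) (bN E + bN F)); auto; lia. }
  replace (vdrop (bN E + bN F) v) with (vdrop (bN F) (vdrop (bN E) v)); [tauto|].
  extensionality i; unfold vdrop; f_equal; lia.
Qed.

Lemma fiber_bsum_triv0 (E : bundle L) l v : fiber (bsum E (triv 0)) l v <-> fiber E l v.
Proof.
  rewrite fiber_bsum, fiber_triv. split.
  - intros [Ha Hb]. replace v with (vtrunc (bN E) v); auto.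
    rewrite <- (vcat_split (bN E) v) at 2. extensionality i. destruct (Nat.lt_ge_cases i (bN E)).
    + now rewrite vcat_lt.
    + rewrite vcat_le, Hb, supp_vtrunc; auto; lia.
  - intros H; pose proof (fiber_supp _ _ _ H) as Hs. rewrite vtrunc_supp by auto.
    split; auto. intros i _; unfold vdrop; apply Hs; lia.
Qed.

Lemma biso_triv0_r E : biso (bsum E (triv 0)) E.
Proof. apply biso_of_fiber; [simpl; lia|apply fiber_bsum_triv0]. Qed.

Lemma biso_triv_add (a b : nat) : biso (bsum (triv a) (triv b)) (triv (a + b)%nat).
Proof.
  apply biso_of_fiber; [reflexivity|]. intros l v. rewrite fiber_bsum, !fiber_triv. simpl bN. split.
  - intros [Ha Hb]. rewrite <- (vcat_split a v). now apply supp_vcat.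
  - intros H; split; [apply supp_vtrunc|now apply supp_vdrop].
Qed.

(** The isomorphism is [(u, w) -> u + w], with inverse [w -> (P w, w - P w)]. *)
Lemma biso_IM_KER d (P : L -> Z -> mat) k :
  (forall i j, (i < d)%nat -> (j < d)%nat -> cont_L dist (fun l => P l k i j)) ->
  (forall l, meq d (mm d (P l k) (P l k)) (P l k)) ->
  biso (bsum (IM d P k) (KER d P k)) (triv d).
Proof.
  intros Hc Hp.
  assert (HPP : forall l v, mv d (P l k) (mv d (P l k) v) = mv d (P l k) v).
  { intros; rewrite <- mv_mm; apply mv_meq, Hp. }
  exists (fun _ v => vadd (vtrunc d v) (vdrop d v)).
  exists (fun l w => vcat d (mv d (P l k) w) (vsub w (mv d (P l k) w))).
  assert (HcP : forall f, contS d f -> contS d (fun l => mv d (P l k) (f l))).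
  { intros f Hf; apply contD_mvr; auto. intros; apply cont_L_contD; auto. }
  split; [|split; [|split]].
  - split; [|split; [|split]].
    + intros; rewrite vtrunc_vadd. extensionality i; unfold vadd, vdrop; ring.
    + intros; rewrite vtrunc_vscal. extensionality i; unfold vadd, vdrop, vscal; ring.
    + intros l v Hv; apply supp_vadd; [apply supp_vtrunc|now apply supp_vdrop].
    + intros f Hf Hcf; apply contD_vadd; [|now apply contS_vdrop]. apply (contS_vtrunc d (d + d)); auto; lia.
  - split; [|split; [|split]].
    + intros; rewrite mv_vadd, <- vcat_vadd; f_equal. extensionality i; unfold vadd, vsub; ring.
    + intros; rewrite mv_vscal, <- vcat_vscal; f_equal. extensionality i; unfold vscal, vsub; ring.
    + intros l v Hv; apply supp_vcat, supp_vsub; auto using supp_mv.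
    + intros f Hf Hcf; apply contD_vcat; [now apply HcP|apply contD_vsub; auto]. now apply HcP.
  - intros l v Hv; apply fiber_bsum in Hv; destruct Hv as [Ha Hb]; simpl bN in *.
    pose proof (fiber_supp _ _ _ Hb) as Hs; simpl in Hs.
    rewrite fiber_IM in Ha. rewrite fiber_KER in Hb. destruct Hb as [_ Hb].
    split; [apply fiber_triv, supp_vadd; auto using supp_vtrunc|].
    rewrite mv_vadd, Ha. replace (mv d (P l k) (vdrop d v)) with zerov.
    + rewrite <- (vcat_split d v) at 5. f_equal; extensionality i; unfold vadd, vsub, zerov; ring.
    + apply (supp_ext d); auto using supp_zerov, supp_mv. intros i Hi; symmetry; auto.
  - intros l w Hw; apply fiber_triv in Hw. rewrite fiber_bsum, fiber_IM, fiber_KER; simpl bN.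
    rewrite vtrunc_vcat, vdrop_vcat by apply supp_mv. split; [split; [apply HPP|split]|].
    + auto using supp_vsub, supp_mv.
    + intros i _; rewrite mv_vsub, HPP; unfold vsub, zerov; ring.
    + extensionality i; unfold vadd, vsub; ring.
Qed.

(** The lower bound [c] turns pointwise inversion into a continuous one: it controls the error of an
    approximate preimage by the error of its image. *)
Lemma bijection_inverse E F t (c : R) : is_bundle dist E -> is_bundle dist F -> 0 < c ->
  clin (bN E) (bN F) t ->
  (forall l v, fiber E l v -> fiber F l (t l v)) ->
  (forall l v, fiber E l v -> c * vnorm (bN E) v <= vnorm (bN F) (t l v)) ->
  (forall l w, fiber F l w -> exists v, fiber E l v /\ t l v = w) ->
  exists s, clin (bN F) (bN E) s /\ (forall l v, fiber E l v -> s l (t l v) = v) /\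
    (forall l w, fiber F l w -> fiber E l (s l w) /\ t l (s l w) = w).
Proof.
  intros HE HF Hc Ht Htf Hlow Hsurj. destruct Ht as [Ta [Tsc [Tsu Tc]]].
  assert (Hinj : forall l u v, fiber E l u -> fiber E l v -> t l u = t l v -> u = v).
  { intros l u v Hu Hv Huv. pose proof (fiber_supp _ _ _ Hu). pose proof (fiber_supp _ _ _ Hv).
    assert (Hz : vnorm (bN E) (vsub u v) = 0).
    { assert (Hf : fiber E l (vsub u v)) by (rewrite vsub_vadd; apply fiber_vadd, fiber_vscal; auto).
      specialize (Hlow l _ Hf). replace (t l (vsub u v)) with zerov in Hlow.
      - rewrite vnorm_zero in Hlow. pose proof (vnorm_nonneg (bN E) (vsub u v)). nra.
      - rewrite vsub_vadd, Ta, Tsc, Huv by auto using supp_vscal.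
        extensionality i; unfold vadd, vscal, zerov; ring. }
    apply (supp_ext (bN E)); auto. intros i Hi; pose proof (vnorm_zero_eqv _ _ Hz i Hi) as Hx.
    unfold vsub, zerov in Hx; lra. }
  (* Inverting after the projection [bQ F] defines the inverse on the whole ambient space, where it
     is linear. *)
  assert (HS : exists s : L * vec -> vec, forall p, fiber E (fst p) (s p) /\
    t (fst p) (s p) = mv (bN F) (bQ F (fst p)) (snd p)).
  { apply functional_choice with (R := fun p v => fiber E (fst p) v /\ t (fst p) v = mv (bN F) (bQ F (fst p)) (snd p)).
    intros [l w]; simpl. apply Hsurj. now apply (fiber_proj dist). }
  destruct HS as [s0 Hs0]. set (s := fun l w => s0 (l, w)).
  assert (Hs : forall l w, fiber E l (s l w) /\ t l (s l w) = mv (bN F) (bQ F l) w)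
    by (intros l w; apply (Hs0 (l, w))).
  assert (Hsupp : forall l w, supp (bN E) (s l w)) by (intros; eapply fiber_supp, Hs).
  exists s; split; [|split].
  - split; [|split; [|split]].
    + intros l u v Hu Hv. apply (Hinj l); [apply Hs|apply fiber_vadd; apply Hs|].
      rewrite Ta by auto. rewrite !(proj2 (Hs l _)). apply mv_vadd.
    + intros l a v Hv. apply (Hinj l); [apply Hs|apply fiber_vscal; apply Hs|].
      rewrite Tsc by auto. rewrite !(proj2 (Hs l _)). apply mv_vscal.
    + intros; auto.
    + intros f Hf Hcf l _ eps Heps.
      set (v := s l (f l)).
      (* The approximate preimage: the value [v] at [l] carried to the fibre over [l']. The defect
         [b] of its image is continuous and vanishes at [l]. *)
      set (a := fun l' => mv (bN E) (bQ E l') v).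
      assert (Ca : contS (bN E) a).
      { apply (contD_bQ dist); auto using contD_id. apply contD_vec; intros; apply contD_cR. }
      set (b := fun l' => vsub (mv (bN F) (bQ F l') (f l')) (t l' (a l'))).
      assert (Cb : contS (bN F) b).
      { apply contD_vsub; [apply (contD_bQ dist); auto using contD_id|]. apply Tc; auto. intros; apply supp_mv. }
      assert (Hal : a l = v) by (apply fiber_fix, Hs).
      assert (Hbl : vnorm (bN F) (b l) = 0).
      { unfold b; rewrite Hal. unfold v; rewrite (proj2 (Hs l (f l))).
        rewrite <- (vnorm_zero (bN F)); apply vnorm_ext; intros i _; unfold vsub, zerov; ring. }
      assert (Hce : 0 < c * (eps / 2)) by nra.
      destruct (Ca l I (eps / 2)) as [d1 [Hd1 H1]]; [lra|].
      destruct (contD_vnorm dist _ _ _ Cb l I _ Hce) as [d2 [Hd2 H2]].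
      exists (Rmin d1 d2); split; [now apply Rmin_pos|]. intros l' _ Hl'.
      specialize (H1 l' I (Rlt_le_trans _ _ _ Hl' (Rmin_l _ _))).
      specialize (H2 l' I (Rlt_le_trans _ _ _ Hl' (Rmin_r _ _))).
      unfold dR in H2; rewrite Hbl, Rminus_0_r, Rabs_pos_eq in H2 by apply vnorm_nonneg.
      unfold dV in *. rewrite Hal in H1. fold v.
      eapply Rle_lt_trans; [apply (vnorm_sub_triang _ _ (a l'))|].
      assert (Hfib : fiber E l' (vsub (s l' (f l')) (a l'))).
      { rewrite vsub_vadd; apply fiber_vadd; [apply Hs|]. now apply fiber_vscal, (fiber_proj dist). }
      specialize (Hlow l' _ Hfib).
      assert (Hb' : t l' (vsub (s l' (f l')) (a l')) = b l').
      { rewrite vsub_vadd, Ta, Tsc, (proj2 (Hs l' _)), <- vsub_vadd; auto.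
        - apply supp_mv.
        - apply supp_vscal, supp_mv. }
      rewrite Hb' in Hlow.
      assert (vnorm (bN E) (vsub (s l' (f l')) (a l')) < eps / 2) by (apply (Rmult_lt_reg_l c); lra).
      lra.
  - intros l v Hv. apply (Hinj l); auto; [apply Hs|].
    rewrite (proj2 (Hs l _)). apply fiber_fix; auto.
  - intros l w Hw; split; [apply Hs|]. rewrite (proj2 (Hs l w)). now apply fiber_fix.
Qed.

Lemma biso_of_bijection E F t (c : R) : is_bundle dist E -> is_bundle dist F -> 0 < c ->
  clin (bN E) (bN F) t ->
  (forall l v, fiber E l v -> fiber F l (t l v)) ->
  (forall l v, fiber E l v -> c * vnorm (bN E) v <= vnorm (bN F) (t l v)) ->
  (forall l w, fiber F l w -> exists v, fiber E l v /\ t l v = w) ->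
  biso E F.
Proof.
  intros HE HF Hc Ht Htf Hlow Hsurj.
  destruct (bijection_inverse E F t c HE HF Hc Ht Htf Hlow Hsurj) as [s [Hs [H1 H2]]].
  exists t, s; split; [exact Ht|split; [exact Hs|split; auto]].
Qed.

Lemma clin_contD {C} (dC : C -> C -> R) D n m t (a : C -> L) (g : C -> vec) : clin n m t ->
  contD dC dist D a -> contD dC (dV n) D g -> (forall x, D x -> supp n (g x)) ->
  contD dC (dV m) D (fun x => t (a x) (g x)).
Proof.
  intros Ht Ha Hg Hs. destruct (clin_matrix n m t Ht) as [T [HT E]].
  apply (contD_ext dC (dV m) D (fun x => mvr m n (T (a x)) (g x))); [intros; auto|].
  apply contD_mvr; auto. intros i j _ _.
  apply (contD_comp dC dist dR D (fun _ => True) a (fun l => T l i j)); auto.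
  now apply cont_L_contD.
Qed.

Lemma clin_of_linear n m (t : vec -> vec) :
  (forall u v, supp n u -> supp n v -> t (vadd u v) = vadd (t u) (t v)) ->
  (forall c v, supp n v -> t (vscal c v) = vscal c (t v)) ->
  (forall v, supp n v -> supp m (t v)) -> clin n m (fun _ => t).
Proof.
  intros Ha Hs Hm; split; [|split; [|split]]; auto. intros g Hg Hc.
  apply contD_vec; intros i Hi.
  apply (contD_ext dist dR _ (fun l => lincomb n (g l) (fun k => t (unitv k)) i)).
  - intros l _. destruct (linear_lincomb n (supp n) t (supp_subspace n) Ha Hs n (g l) unitv) as [E _];
      [auto using supp_unitv|]. rewrite <- vec_decomp in E by auto. now rewrite E.
  - apply contD_sumn; intros k Hk. apply contD_mult; [|apply contD_cR].
    now apply (contD_coord dist _ n).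
Qed.

(** * Finite sums of bundles, and ranks *)

Lemma bsums_perm (l1 l2 : list (bundle L)) : Permutation l1 l2 -> biso (bsums l1) (bsums l2).
Proof.
  induction 1; simpl.
  - apply biso_refl.
  - apply biso_bsum; auto using biso_refl.
  - eapply biso_trans; [apply biso_sym, biso_assoc|].
    eapply biso_trans; [|apply biso_assoc]. apply biso_bsum; auto using biso_refl, biso_comm.
  - eapply biso_trans; eauto.
Qed.

Lemma bsums_app (l1 l2 : list (bundle L)) : biso (bsum (bsums l1) (bsums l2)) (bsums (l1 ++ l2)).
Proof.
  induction l1 as [|E l1 IH]; simpl.
  - eapply biso_trans; [apply biso_comm|apply biso_triv0_r].
  - eapply biso_trans; [apply biso_assoc|]. apply biso_bsum; auto using biso_refl.
Qed.

Lemma rank_biso E F (l0 : L) r s : biso E F -> bundle_rank E r -> bundle_rank F s -> r = s.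
Proof.
  assert (Hle : forall E F r s, biso E F -> bundle_rank E r -> bundle_rank F s -> (r <= s)%nat).
  { intros E' F' p q [t [u [[Ta [Ts [Tm _]]] [_ [H1 _]]]]] Hp Hq.
    apply (dim_le_of_inj (bN E') (bN F') (fiber E' l0) (fiber F' l0) p q (t l0)).
    - apply fiber_subspace.
    - apply Hp.
    - apply Hq.
    - intros v Hv; now apply H1.
    - intros n c b Hb i _.
      destruct (linear_lincomb (bN E') (fiber E' l0) (t l0) (fiber_subspace E' l0)) with n c b as [-> _]; auto.
      + intros; apply Ta; eapply fiber_supp; eauto.
      + intros; apply Ts; eapply fiber_supp; eauto.
    - intros v Hv H0. destruct (H1 l0 v Hv) as [Ha Hb].
      assert (Hz : t l0 v = t l0 zerov).
      { transitivity zerov.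
        - apply (supp_ext (bN F')); auto using supp_zerov. eapply fiber_supp; eauto.
        - replace zerov with (vscal 0 v) at 2 by (extensionality i; unfold vscal, zerov; ring).
          rewrite Ts by (eapply fiber_supp; eauto). extensionality i; unfold vscal, zerov; ring. }
      assert (Hf0 : fiber E' l0 zerov) by apply fiber_subspace.
      destruct (H1 l0 zerov Hf0) as [_ Hb0]. rewrite <- Hb, Hz, Hb0. intros i _; reflexivity. }
  intros Hi Hr Hs; apply Nat.le_antisymm; [apply (Hle E F)|apply (Hle F E)]; auto using biso_sym.
Qed.

Lemma rank_bsum (E F : bundle L) (r s : nat) : bundle_rank E r -> bundle_rank F s ->
  bundle_rank (bsum E F) (r + s).
Proof.
  intros HE HF l. destruct (HE l) as [b [Hb1 [Hb2 Hb3]]]. destruct (HF l) as [e [He1 [He2 He3]]].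
  set (n := bN E). set (m := bN F).
  set (g := fun k => if Nat.ltb k r then b k else vcat n zerov (e (k - r)%nat)).
  assert (Hg1 : forall k, (k < r)%nat -> g k = b k).
  { intros k Hk; unfold g; now rewrite (proj2 (Nat.ltb_lt k r)). }
  assert (Hg2 : forall k, g (r + k)%nat = vcat n zerov (e k)).
  { intros k; unfold g; rewrite (proj2 (Nat.ltb_ge (r + k) r)) by lia. do 2 f_equal; lia. }
  assert (Hsb : forall k, (k < r)%nat -> supp n (b k)) by (intros k Hk; apply (Hb1 k Hk)).
  assert (Hcomb1 : forall c i, (i < n)%nat -> sumn (r + s) (fun k => c k * g k i) = sumn r (fun k => c k * b k i)).
  { intros c i Hi. rewrite sumn_app, (sumn_zero s), Rplus_0_r.
    - apply sumn_ext; intros k Hk; now rewrite Hg1.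
    - intros k Hk; rewrite Hg2, vcat_lt by auto; unfold zerov; ring. }
  assert (Hcomb2 : forall c i, sumn (r + s) (fun k => c k * g k (n + i)%nat) = sumn s (fun k => c (r + k)%nat * e k i)).
  { intros c i. rewrite sumn_app, (sumn_zero r), Rplus_0_l.
    - apply sumn_ext; intros k Hk; now rewrite Hg2, vcat_ge.
    - intros k Hk; rewrite Hg1, Hsb by (auto; lia); ring. }
  exists g; split; [|split].
  - intros k Hk. apply fiber_bsum; fold n. destruct (Nat.lt_ge_cases k r) as [H|H].
    + rewrite Hg1, vtrunc_supp by auto. split; auto.
      replace (vdrop n (b k)) with zerov; [apply fiber_subspace|].
      extensionality i; unfold vdrop; rewrite Hsb by (auto; lia); reflexivity.
    + replace k with (r + (k - r))%nat by lia. rewrite Hg2, vtrunc_vcat, vdrop_vcat by apply supp_zerov.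
      split; [apply fiber_subspace|]. apply He1; lia.
  - intros c Hc k Hk. destruct (Nat.lt_ge_cases k r) as [H|H].
    + apply (Hb2 c); auto. intros i Hi. rewrite <- Hcomb1 by auto. apply Hc; simpl; lia.
    + replace k with (r + (k - r))%nat by lia. apply (He2 (fun k => c (r + k)%nat)); [|lia].
      intros i Hi. rewrite <- Hcomb2. apply (Hc (n + i)%nat); simpl; fold n; lia.
  - intros v Hv; apply fiber_bsum in Hv; destruct Hv as [Ha Hb].
    destruct (Hb3 _ Ha) as [c1 Hc1]. destruct (He3 _ Hb) as [c2 Hc2].
    exists (fun k => if Nat.ltb k r then c1 k else c2 (k - r)%nat). intros i Hi; simpl in Hi.
    destruct (Nat.lt_ge_cases i n) as [H|H].
    + rewrite Hcomb1 by auto. rewrite <- (vtrunc_eqv n v i H), Hc1 by auto.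
      apply sumn_ext; intros k Hk; now rewrite (proj2 (Nat.ltb_lt k r)).
    + replace i with (n + (i - n))%nat by lia. rewrite Hcomb2.
      change (v (n + (i - n))%nat) with (vdrop n v (i - n)%nat). fold n in Hc2. rewrite Hc2 by (fold n in Hi; lia).
      apply sumn_ext; intros k Hk. rewrite (proj2 (Nat.ltb_ge (r + k) r)) by lia. do 2 f_equal; lia.
Qed.

Lemma rank_triv n : bundle_rank (triv (L := L) n) n.
Proof.
  intros l. destruct (dim_supp n) as [b [H1 [H2 H3]]]. exists b; split; [|split; auto].
  - intros k Hk; apply fiber_triv; auto.
  - intros v Hv; apply H3; now apply fiber_triv in Hv.
Qed.
End Iso.

(** * Exponential dichotomies on finite windows *)

(** [|i - k|], since one of the two truncated differences is 0. *)
Definition ndist (i k : nat) : nat := ((i - k) + (k - i))%nat.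

Lemma pow_le_1 (g : R) (n : nat) : 0 <= g <= 1 -> 0 <= g ^ n <= 1.
Proof.
  intros H; induction n as [|n IH]; simpl; [lra|]. split; nra.
Qed.

(** The terms before [i] and those from [i] on are two geometric series, each with sum at most
    [1 / (1 - g)]; hence the bound does not depend on the window [m]. *)
Lemma two_sided_geometric (g : R) (i m : nat) : 0 <= g < 1 ->
  sumn m (fun k => g ^ ndist i k) <= 2 / (1 - g).
Proof.
  intros Hg. assert (Hd : 0 < / (1 - g)) by (apply Rinv_0_lt_compat; lra).
  assert (E : (1 - g) * / (1 - g) = 1) by (apply Rinv_r; lra).
  assert (H1 : forall p, (p <= i)%nat -> sumn p (fun k => g ^ ndist i k) <= g ^ (i - p + 1) * / (1 - g)).
  { induction p as [|p IH]; intros Hp; cbn [sumn].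
    - apply Rmult_le_pos; [apply pow_le; lra|lra].
    - specialize (IH ltac:(lia)). replace (ndist i p) with (i - p)%nat by (unfold ndist; lia).
      replace (i - S p + 1)%nat with (i - p)%nat by lia.
      replace (i - p + 1)%nat with (S (i - p)) in IH by lia. cbn [pow] in IH.
      assert (0 <= g ^ (i - p)) by (apply pow_le; lra). nra. }
  assert (H2 : forall p, sumn (i + p) (fun k => g ^ ndist i k) <= 2 / (1 - g) - g ^ p * / (1 - g)).
  { induction p as [|p IH].
    - rewrite Nat.add_0_r. eapply Rle_trans; [apply H1; lia|].
      replace (i - i + 1)%nat with 1%nat by lia. simpl; unfold Rdiv; nra.
    - rewrite Nat.add_succ_r; cbn [sumn]. replace (ndist i (i + p)) with p by (unfold ndist; lia).
      cbn [pow]. assert (0 <= g ^ p) by (apply pow_le; lra). nra. }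
  destruct (Nat.le_gt_cases m i) as [H|H].
  - eapply Rle_trans; [apply H1; auto|]. unfold Rdiv.
    pose proof (pow_le_1 g (i - m + 1)). nra.
  - replace m with (i + (m - i))%nat by lia. eapply Rle_trans; [apply H2|].
    assert (0 <= g ^ (m - i)) by (apply pow_le; lra). unfold Rdiv; nra.
Qed.

Lemma argmax_exists (n : nat) (x : nat -> R) : exists j, (j <= n)%nat /\ forall k, (k <= n)%nat -> x k <= x j.
Proof.
  induction n as [|n [j [Hj H]]].
  - exists 0%nat; split; auto. intros k Hk; replace k with 0%nat by lia; lra.
  - destruct (Rle_or_lt (x (S n)) (x j)) as [Hx|Hx].
    + exists j; split; [lia|]. intros k Hk; destruct (Nat.eq_dec k (S n)) as [->|]; auto. apply H; lia.
    + exists (S n); split; [lia|]. intros k Hk; destruct (Nat.eq_dec k (S n)) as [->|]; [lra|].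
      assert (x k <= x j) by (apply H; lia). lra.
Qed.

(* Gronwall with a two-sided exponential kernel: compare [y] with its largest value
   relative to the weight [b^i]. *)
Lemma weighted_decay (n : nat) (y : nat -> R) (a b c e : R) :
  0 < a < b -> b <= 1 -> 0 <= c -> 0 <= e -> e * (2 / (1 - a / b)) <= 1 / 2 ->
  (forall i, (i <= n)%nat -> 0 <= y i) ->
  (forall i, (i <= n)%nat -> y i <= c * a ^ i * y 0%nat + e * sumn (S n) (fun k => a ^ ndist i k * y k)) ->
  forall i, (i <= n)%nat -> y i <= 2 * c * b ^ i * y 0%nat.
Proof.
  intros Ha Hb Hc He Hsm Hy H.
  assert (Hg : 0 <= a / b < 1).
  { split; [apply Rlt_le, Rdiv_lt_0_compat; lra|]. apply (Rmult_lt_reg_r b); [lra|].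
    unfold Rdiv; rewrite Rmult_assoc, Rinv_l; lra. }
  assert (Hbp : forall i, 0 < b ^ i) by (intros; apply pow_lt; lra).
  destruct (argmax_exists n (fun k => y k * / b ^ k)) as [j [Hj Hmax]]. set (M := y j * / b ^ j) in *.
  assert (HyM : forall k, (k <= n)%nat -> y k <= M * b ^ k).
  { intros k Hk; specialize (Hmax k Hk). apply (Rmult_le_compat_r (b ^ k)) in Hmax; [|apply Rlt_le, Hbp].
    rewrite Rmult_assoc, Rinv_l in Hmax by (apply Rgt_not_eq, Hbp). lra. }
  assert (HM : 0 <= M).
  { unfold M; apply Rmult_le_pos; auto. apply Rlt_le, Rinv_0_lt_compat, Hbp. }
  (* For [k <= i] this is an equality; for [k >= i] it costs the powers of [b <= 1]. *)
  assert (Hker : forall i k, a ^ ndist i k * b ^ k <= b ^ i * (a / b) ^ ndist i k).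
  { intros i k. destruct (Nat.le_ge_cases k i) as [Hk|Hk].
    - replace i with (k + (i - k))%nat at 2 by lia. replace (ndist i k) with (i - k)%nat by (unfold ndist; lia).
      rewrite pow_add. replace (a ^ (i - k)) with (b ^ (i - k) * (a / b) ^ (i - k)).
      + lra.
      + rewrite <- Rpow_mult_distr; f_equal; field; lra.
    - replace k with (i + (k - i))%nat at 2 by lia. replace (ndist i k) with (k - i)%nat by (unfold ndist; lia).
      rewrite pow_add. assert (a ^ (k - i) <= (a / b) ^ (k - i)).
      { apply pow_incr; split; [lra|]. apply (Rmult_le_reg_r b); [lra|].
        unfold Rdiv; rewrite Rmult_assoc, Rinv_l; nra. }
      assert (0 <= b ^ (k - i) <= 1) by (apply pow_le_1; lra).
      assert (0 <= a ^ (k - i)) by (apply pow_le; lra). pose proof (Hbp i).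
      assert (a ^ (k - i) * b ^ (k - i) <= (a / b) ^ (k - i)) by nra. nra. }
  assert (Hstep : forall i, (i <= n)%nat -> y i <= b ^ i * (c * y 0%nat + M / 2)).
  { intros i Hi. eapply Rle_trans; [apply H; auto|].
    assert (Hs : sumn (S n) (fun k => a ^ ndist i k * y k) <= M * b ^ i * (2 / (1 - a / b))).
    { eapply Rle_trans; [apply (sumn_le (S n) _ (fun k => M * b ^ i * (a / b) ^ ndist i k))|].
      - intros k Hk. assert (y k <= M * b ^ k) by (apply HyM; lia). specialize (Hker i k).
        assert (0 <= a ^ ndist i k) by (apply pow_le; lra).
        assert (a ^ ndist i k * y k <= a ^ ndist i k * (M * b ^ k)) by (apply Rmult_le_compat_l; auto).
        assert (M * (a ^ ndist i k * b ^ k) <= M * (b ^ i * (a / b) ^ ndist i k)) by (apply Rmult_le_compat_l; auto).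
        lra.
      - rewrite sumn_scal. apply Rmult_le_compat_l; [|now apply two_sided_geometric].
        apply Rmult_le_pos; [auto|apply Rlt_le, Hbp]. }
    assert (c * a ^ i * y 0%nat <= c * b ^ i * y 0%nat).
    { apply Rmult_le_compat_r; [apply Hy; lia|]. apply Rmult_le_compat_l; auto. apply pow_incr; lra. }
    assert (e * sumn (S n) (fun k => a ^ ndist i k * y k) <= M * b ^ i * (e * (2 / (1 - a / b)))).
    { eapply Rle_trans; [apply Rmult_le_compat_l; [auto|apply Hs]|]. lra. }
    assert (M * b ^ i * (e * (2 / (1 - a / b))) <= M * b ^ i * (1 / 2)).
    { apply Rmult_le_compat_l; auto. apply Rmult_le_pos; [auto|apply Rlt_le, Hbp]. }
    lra. }
  (* At the maximizing index the inequality reads [M <= c * y 0 + M / 2]. *)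
  assert (HM2 : M <= 2 * (c * y 0%nat)).
  { pose proof (Hstep j Hj) as Hs. assert (Hyj : y j = M * b ^ j).
    { unfold M; rewrite Rmult_assoc, Rinv_l; [ring|apply Rgt_not_eq, Hbp]. }
    rewrite Hyj in Hs. pose proof (Hbp j). assert (M <= c * y 0%nat + M / 2) by (apply (Rmult_le_reg_l (b ^ j)); lra).
    lra. }
  intros i Hi. specialize (HyM i Hi). pose proof (Hbp i). nra.
Qed.

Section Window.
Variable d : nat.

(** The propagator [Phi(i + m, i)] applied to a vector, with times counted from the left end of the
    window. *)
Fixpoint fl (B : nat -> mat) (i m : nat) (x : vec) : vec :=
  match m with O => x | S p => mv d (B (i + p)%nat) (fl B i p x) end.

Lemma supp_fl B i m x : supp d x -> supp d (fl B i m x).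
Proof. destruct m; simpl; auto using supp_mv. Qed.

Lemma fl_shift B i m x : fl B i (S m) x = fl B (S i) m (mv d (B i) x).
Proof.
  induction m as [|m IH]; [simpl; now rewrite Nat.add_0_r|].
  change (fl B i (S (S m)) x) with (mv d (B (i + S m)%nat) (fl B i (S m) x)).
  rewrite IH; simpl. do 2 f_equal; lia.
Qed.

Lemma fl_vadd B i m x y : fl B i m (vadd x y) = vadd (fl B i m x) (fl B i m y).
Proof. induction m as [|m IH]; simpl; auto. now rewrite IH, mv_vadd. Qed.

Lemma fl_vsub B i m x y : fl B i m (vsub x y) = vsub (fl B i m x) (fl B i m y).
Proof. induction m as [|m IH]; simpl; auto. now rewrite IH, mv_vsub. Qed.

(** The dichotomy on the window [0, ..., n] in terms of vectors. Injectivity on kernels is contained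
    in [edw_unstable], and bounds on the projectors are kept apart because they have to be uniform
    in the parameter. *)
Record edw (B P : nat -> mat) (K al : R) (n : nat) : Prop := {
  edw_K : 1 <= K;
  edw_al : 0 < al < 1;
  edw_proj : forall i x, (i <= n)%nat -> mv d (P i) (mv d (P i) x) = mv d (P i) x;
  edw_inv : forall i x, (i < n)%nat -> mv d (B i) (mv d (P i) x) = mv d (P (S i)) (mv d (B i) x);
  edw_surj : forall i y, (i < n)%nat -> supp d y -> mv d (P (S i)) y = zerov ->
    exists x, supp d x /\ mv d (P i) x = zerov /\ mv d (B i) x = y;
  edw_stable : forall i m x, (i + m <= n)%nat -> mv d (P i) x = x ->
    vnorm d (fl B i m x) <= K * al ^ m * vnorm d x;
  edw_unstable : forall i m x, (i + m <= n)%nat -> supp d x -> mv d (P i) x = zerov ->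
    vnorm d x <= K * al ^ m * vnorm d (fl B i m x) }.

Lemma edw_inv_fl B P K al n i m x : edw B P K al n -> (i + m <= n)%nat ->
  mv d (P (i + m)%nat) (fl B i m x) = fl B i m (mv d (P i) x).
Proof.
  intros H; induction m as [|m IH]; intros Hm; [now rewrite Nat.add_0_r|].
  simpl. rewrite <- IH by lia. rewrite Nat.add_succ_r. symmetry; apply (edw_inv _ _ _ _ _ H); lia.
Qed.

Lemma edw_backward B P K al n i m y : edw B P K al n -> (i + m <= n)%nat ->
  supp d y -> mv d (P (i + m)%nat) y = zerov ->
  exists z, supp d z /\ mv d (P i) z = zerov /\ fl B i m z = y /\ vnorm d z <= K * al ^ m * vnorm d y.
Proof.
  intros H Hm Hy Hk.
  assert (Hz : exists z, supp d z /\ mv d (P i) z = zerov /\ fl B i m z = y).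
  { revert y Hy Hk; induction m as [|m IH]; intros y Hy Hk.
    - exists y; rewrite Nat.add_0_r in Hk; auto.
    - rewrite Nat.add_succ_r in Hk.
      destruct (edw_surj _ _ _ _ _ H (i + m) y ltac:(lia) Hy Hk) as [x [Hx1 [Hx2 Hx3]]].
      destruct (IH ltac:(lia) x Hx1 Hx2) as [z [Hz1 [Hz2 Hz3]]]. exists z; repeat split; auto.
      simpl; now rewrite Hz3. }
  destruct Hz as [z [Hz1 [Hz2 Hz3]]]; exists z; repeat split; auto.
  rewrite <- Hz3. now apply (edw_unstable _ _ _ _ _ H).
Qed.

Lemma mv_proj_compl (P : mat) x : mv d P (mv d P x) = mv d P x -> mv d P (vsub x (mv d P x)) = zerov.
Proof. intros E; rewrite mv_vsub, E. extensionality i; unfold vsub, zerov; ring. Qed.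

(* Discrete variation of constants, the stable part summed forward and the unstable part backward. *)
Lemma edw_linear_estimate B P K al n C (phi h : nat -> vec) : edw B P K al n -> 0 <= C ->
  (forall i x, (i <= n)%nat -> vnorm d (mv d (P i) x) <= C * vnorm d x) ->
  (forall i x, (i <= n)%nat -> supp d x -> vnorm d (vsub x (mv d (P i) x)) <= C * vnorm d x) ->
  (forall i, supp d (phi i)) -> (forall i, supp d (h i)) ->
  (forall i, (i < n)%nat -> phi (S i) = vadd (mv d (B i) (phi i)) (h i)) ->
  forall i, (i <= n)%nat ->
  vnorm d (phi i) <= K * al ^ i * vnorm d (mv d (P 0%nat) (phi 0%nat))
    + K * al ^ (n - i) * vnorm d (vsub (phi n) (mv d (P n) (phi n)))
    + K * C / al * sumn n (fun k => al ^ ndist i k * vnorm d (h k)).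
Proof.
  intros H HC HP1 HP2 Hphi Hh Heq i Hi.
  pose proof (edw_K _ _ _ _ _ H) as HK. pose proof (edw_al _ _ _ _ _ H) as Hal.
  set (u := fun j => mv d (P j) (phi j)). set (w := fun j => vsub (phi j) (u j)).
  assert (Hpow : forall m, 0 < al ^ m) by (intros; apply pow_lt; lra).
  (* The stable component at time [j] is transported to time [i], so the inhomogeneities enter one
     by one, each damped over the time that remains. *)
  assert (Hu : forall j, (j <= i)%nat -> vnorm d (fl B j (i - j) (u j)) <=
    vnorm d (fl B 0 i (u 0%nat)) + sumn j (fun k => K * C * al ^ (i - 1 - k) * vnorm d (h k))).
  { induction j as [|j IH]; intros Hj; [rewrite Nat.sub_0_r; simpl; lra|].
    specialize (IH ltac:(lia)). cbn [sumn].
    assert (Eu : u (S j) = vadd (mv d (B j) (u j)) (mv d (P (S j)) (h j))).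
    { unfold u; rewrite Heq, mv_vadd by lia. now rewrite (edw_inv _ _ _ _ _ H) by lia. }
    rewrite Eu, fl_vadd. replace (i - j)%nat with (S (i - S j)) in IH by lia. rewrite fl_shift in IH.
    eapply Rle_trans; [apply vnorm_triang|].
    assert (vnorm d (fl B (S j) (i - S j) (mv d (P (S j)) (h j))) <= K * C * al ^ (i - 1 - j) * vnorm d (h j)).
    { eapply Rle_trans; [apply (edw_stable _ _ _ _ _ H); [lia|apply (edw_proj _ _ _ _ _ H); lia]|].
      replace (i - 1 - j)%nat with (i - S j)%nat by lia.
      assert (vnorm d (mv d (P (S j)) (h j)) <= C * vnorm d (h j)) by (apply HP1; lia).
      specialize (Hpow (i - S j)%nat). assert (0 <= K * al ^ (i - S j)) by nra.
      apply (Rmult_le_compat_l (K * al ^ (i - S j))) in H0; auto. lra. }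
    lra. }
  assert (Hu' : vnorm d (u i) <= K * al ^ i * vnorm d (u 0%nat)
    + sumn i (fun k => K * C * al ^ (i - 1 - k) * vnorm d (h k))).
  { specialize (Hu i (le_n i)). rewrite Nat.sub_diag in Hu. simpl in Hu.
    assert (vnorm d (fl B 0 i (u 0%nat)) <= K * al ^ i * vnorm d (u 0%nat)).
    { apply (edw_stable _ _ _ _ _ H); [lia|]. apply (edw_proj _ _ _ _ _ H); lia. }
    lra. }
  assert (Hsw : forall j, supp d (w j)) by (intros; apply supp_vsub; auto; apply supp_mv).
  assert (Hkw : forall j, (j <= n)%nat -> mv d (P j) (w j) = zerov).
  { intros j Hj; apply mv_proj_compl, (edw_proj _ _ _ _ _ H); auto. }
  (* [Z] is the preimage, in the kernel at time [i], of the unstable component at time [i + m]; each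
     step adds the preimage of one inhomogeneity, which is contracted backwards. *)
  assert (Hw : forall m, (i + m <= n)%nat -> exists Z, supp d Z /\ mv d (P i) Z = zerov /\
    fl B i m Z = w (i + m)%nat /\
    vnorm d (w i) <= vnorm d Z + sumn m (fun k => K * C * al ^ (S k) * vnorm d (h (i + k)%nat))).
  { induction m as [|m IH]; intros Hm.
    - exists (w i); rewrite Nat.add_0_r; simpl; (split; [auto|split; [apply Hkw; lia|split; [auto|lra]]]).
    - destruct (IH ltac:(lia)) as [Z [Z1 [Z2 [Z3 Z4]]]].
      set (q := vsub (h (i + m)%nat) (mv d (P (S (i + m))) (h (i + m)%nat))).
      assert (Hq : supp d q) by (apply supp_vsub; auto; apply supp_mv).
      destruct (edw_backward B P K al n i (S m) q H ltac:(lia) Hq) as [z [z1 [z2 [z3 z4]]]].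
      { rewrite Nat.add_succ_r. apply mv_proj_compl, (edw_proj _ _ _ _ _ H); lia. }
      assert (Hqn : vnorm d q <= C * vnorm d (h (i + m)%nat)) by (apply HP2; auto; lia).
      assert (Hz : vnorm d z <= K * C * al ^ S m * vnorm d (h (i + m)%nat)).
      { eapply Rle_trans; [apply z4|]. specialize (Hpow (S m)).
        assert (0 <= K * al ^ S m) by nra. apply (Rmult_le_compat_l (K * al ^ S m)) in Hqn; auto. lra. }
      exists (vadd Z z); repeat split.
      + now apply supp_vadd.
      + rewrite mv_vadd, Z2, z2. extensionality k; unfold vadd, zerov; ring.
      + rewrite fl_vadd, z3. cbn [fl]. rewrite Z3, Nat.add_succ_r.
        unfold w, u, q. rewrite Heq, mv_vsub, mv_vadd by lia. rewrite (edw_inv _ _ _ _ _ H) by lia.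
        extensionality k; unfold vadd, vsub; ring.
      + cbn [sumn]. pose proof (vnorm_triang_sub d Z (vadd Z z)) as Ht.
        rewrite (vnorm_ext d (vsub Z (vadd Z z)) (vscal (-1) z)), vnorm_scal in Ht
          by (intros k _; unfold vadd, vsub, vscal; ring).
        rewrite Rabs_left in Ht by lra. lra. }
  assert (Hw' : vnorm d (w i) <= K * al ^ (n - i) * vnorm d (w n)
    + sumn (n - i) (fun k => K * C * al ^ (S k) * vnorm d (h (i + k)%nat))).
  { destruct (Hw (n - i)%nat ltac:(lia)) as [Z [Z1 [Z2 [Z3 Z4]]]].
    assert (vnorm d Z <= K * al ^ (n - i) * vnorm d (fl B i (n - i) Z)).
    { apply (edw_unstable _ _ _ _ _ H); auto; lia. }
    rewrite Z3 in H0. replace (i + (n - i))%nat with n in H0 by lia. lra. }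
  (* The exponents are off by one from [ndist i k], in opposite directions on the two sides; the
     common factor [/ al] covers both. *)
  assert (Hsum : sumn i (fun k => K * C * al ^ (i - 1 - k) * vnorm d (h k))
    + sumn (n - i) (fun k => K * C * al ^ (S k) * vnorm d (h (i + k)%nat))
    <= K * C / al * sumn n (fun k => al ^ ndist i k * vnorm d (h k))).
  { replace n with (i + (n - i))%nat at 2 by lia. rewrite sumn_app, Rmult_plus_distr_l.
    assert (Hila : al * / al = 1) by (apply Rinv_r; lra).
    assert (Hila0 : 0 < / al) by (apply Rinv_0_lt_compat; lra).
    rewrite <- !sumn_scal. apply Rplus_le_compat; apply sumn_le; intros k Hk.
    - replace (ndist i k) with (S (i - 1 - k)) by (unfold ndist; lia). cbn [pow].
      right; unfold Rdiv. field; lra.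
    - replace (ndist i (i + k)) with k by (unfold ndist; lia). cbn [pow].
      pose proof (vnorm_nonneg d (h (i + k)%nat)). specialize (Hpow k).
      assert (al <= / al) by nra.
      assert (0 <= K * C * (al ^ k * vnorm d (h (i + k)%nat))) by (apply Rmult_le_pos; nra).
      replace (K * C * (al * al ^ k) * vnorm d (h (i + k)%nat)) with (al * (K * C * (al ^ k * vnorm d (h (i + k)%nat)))) by ring.
      replace (K * C / al * (al ^ k * vnorm d (h (i + k)%nat))) with (/ al * (K * C * (al ^ k * vnorm d (h (i + k)%nat)))) by (field; lra).
      apply Rmult_le_compat_r; auto. }
  assert (Hphi_i : vnorm d (phi i) <= vnorm d (u i) + vnorm d (w i)).
  { pose proof (vnorm_triang_sub d (phi i) (u i)). exact H0. }
  fold (u 0%nat) (u n). fold (w n).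
  set (S1 := sumn i _) in *. set (S2 := sumn (n - i) _) in *. set (S3 := sumn n _) in *.
  lra.
Qed.

(** Put [q = x - P x] and [s = K * al ^ m]. Over [m] steps the flow expands [q] and contracts [P x],
    so that [|q| <= s |fl q|], while [|fl q| <= a ^ m |x| + s (|x| + |q|)]. As [s * s <= 1 / 2], the
    term with [|q|] is absorbed. *)
Lemma edw_proj_bound B P K al n i m a x : edw B P K al n -> (i + m <= n)%nat -> 0 <= a ->
  (forall k y, vnorm d (mv d (B k) y) <= a * vnorm d y) ->
  K * al ^ m * (K * al ^ m) <= 1 / 2 -> supp d x ->
  vnorm d (vsub x (mv d (P i) x)) <= 2 * (K * al ^ m * (a ^ m + K * al ^ m)) * vnorm d x.
Proof.
  intros H Him Ha HB Hs Hx. set (q := vsub x (mv d (P i) x)). set (s := K * al ^ m) in *.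
  pose proof (edw_K _ _ _ _ _ H) as HK. pose proof (edw_al _ _ _ _ _ H) as Hal.
  assert (Hs0 : 0 < s) by (unfold s; pose proof (pow_lt al m (proj1 Hal)); nra).
  assert (Hq : vnorm d q <= s * vnorm d (fl B i m q)).
  { apply (edw_unstable _ _ _ _ _ H); auto; [apply supp_vsub; auto; apply supp_mv|].
    apply mv_proj_compl, (edw_proj _ _ _ _ _ H); lia. }
  assert (Hfl : forall k y, vnorm d (fl B i k y) <= a ^ k * vnorm d y).
  { induction k as [|k IH]; intros y; simpl; [lra|].
    eapply Rle_trans; [apply HB|]. specialize (IH y). apply (Rmult_le_compat_l a) in IH; auto. lra. }
  assert (Hp : vnorm d (fl B i m (mv d (P i) x)) <= s * vnorm d (mv d (P i) x)).
  { apply (edw_stable _ _ _ _ _ H); auto. apply (edw_proj _ _ _ _ _ H); lia. }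
  assert (Hpx : vnorm d (mv d (P i) x) <= vnorm d x + vnorm d q).
  { eapply Rle_trans; [apply (vnorm_triang_sub d _ x)|]. unfold q; rewrite (vnorm_sub_sym d x); lra. }
  assert (Hflq : vnorm d (fl B i m q) <= a ^ m * vnorm d x + s * (vnorm d x + vnorm d q)).
  { unfold q at 1; rewrite fl_vsub. eapply Rle_trans; [apply vnorm_sub_le|].
    specialize (Hfl m x). nra. }
  pose proof (vnorm_nonneg d q). nra.
Qed.

End Window.

Lemma Phi_fl (d : nat) (B : Z -> mat) (a : Z) (i m : nat) x : supp d x ->
  mv d (Phi_aux d B (a + Z.of_nat i)%Z m) x = fl d (fun k => B (a + Z.of_nat k)%Z) i m x.
Proof.
  intros Hx; induction m as [|m IH]; simpl; [now apply mv_idm_supp|].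
  rewrite mv_mm, IH. do 2 f_equal; lia.
Qed.

Lemma edw_of_ED (d : nat) (B : Z -> mat) (I : Z -> Prop) (P : Z -> mat) (K al : R) (a : Z) (n : nat) :
  ED_wrt d B I P K al -> (forall i, (i <= n)%nat -> I (a + Z.of_nat i)%Z) ->
  edw d (fun i => B (a + Z.of_nat i)%Z) (fun i => P (a + Z.of_nat i)%Z) K al n.
Proof.
  intros [[[Hp [Hi _]] Hr] [HK [Hal He]]] HI.
  assert (ES : forall i, (a + Z.of_nat (S i) = a + Z.of_nat i + 1)%Z) by lia.
  assert (Hker : forall k x, supp d x -> mv d (P k) x = zerov -> in_ker d (P k) x).
  { intros k x Hx E; split; auto. rewrite E; intros j _; reflexivity. }
  constructor; auto.
  - intros i x Hin. rewrite <- mv_mm. apply mv_meq, Hp; auto.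
  - intros i x Hin. rewrite ES, <- !mv_mm. apply mv_meq, Hi; [apply HI; lia|rewrite <- ES; apply HI; lia].
  - intros i y Hin Hy Hk. rewrite ES in Hk.
    destruct (Hr (a + Z.of_nat i)%Z) as [_ [_ Hsj]]; [apply HI; lia|rewrite <- ES; apply HI; lia|].
    destruct (Hsj y (Hker _ _ Hy Hk)) as [x [[Hx1 Hx2] Hx3]]. exists x; split; auto. split.
    + apply (supp_ext d); auto using supp_mv, supp_zerov.
    + apply (supp_ext d); auto using supp_mv.
  - intros i m x Him HPx. assert (Hx : supp d x) by (rewrite <- HPx; apply supp_mv).
    destruct (He (a + Z.of_nat (i + m))%Z (a + Z.of_nat i)%Z) with (x := x) as [H1 _]; auto; try (apply HI; lia); try lia.
    rewrite HPx in H1. unfold Phi in H1.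
    replace (a + Z.of_nat (i + m) - (a + Z.of_nat i))%Z with (Z.of_nat m) in H1 by lia.
    rewrite Nat2Z.id, Phi_fl, <- pow_powerRZ in H1 by auto. exact H1.
  - intros i m x Him Hx HPx.
    destruct (He (a + Z.of_nat (i + m))%Z (a + Z.of_nat i)%Z) with (x := x) as [_ H1]; auto; try (apply HI; lia); try lia.
    assert (E : mv d (msub (idm d) (P (a + Z.of_nat i)%Z)) x = x).
    { rewrite mv_msub, mv_idm_supp, HPx by auto. extensionality j; unfold vsub, zerov; ring. }
    rewrite E in H1. unfold Phi in H1.
    replace (a + Z.of_nat (i + m) - (a + Z.of_nat i))%Z with (Z.of_nat m) in H1 by lia.
    rewrite Nat2Z.id, Phi_fl, powerRZ_neg', <- pow_powerRZ in H1 by auto.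
    assert (Hpow : 0 < al ^ m) by (apply pow_lt; lra).
    apply Rge_le, (Rmult_le_compat_l (K * al ^ m)) in H1; [|nra].
    replace (K * al ^ m * (/ K * / al ^ m * vnorm d x)) with (vnorm d x) in H1 by (field; lra). lra.
Qed.

Lemma ED_sub (d : nat) (B : Z -> mat) (I J : Z -> Prop) (P : Z -> mat) (K al : R) :
  (forall n, J n -> I n) -> ED_wrt d B I P K al -> ED_wrt d B J P K al.
Proof.
  intros HJ [[[Hp [Hi [C HC]]] Hr] [HK [Hal He]]].
  split; [split; [split; [|split]|]|split; [|split]]; auto.
  - intros n Hn; auto.
  - exists C; auto.
Qed.

Lemma ED_proj_bound (d : nat) (B : Z -> mat) (I : Z -> Prop) (P : Z -> mat) (K al : R) :
  ED_wrt d B I P K al -> exists C, 0 <= C /\ forall n x, I n -> vnorm d (mv d (P n) x) <= C * vnorm d x.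
Proof.
  intros [[[_ [_ [C HC]]] _] _]. exists (Rmax 0 C); split; [apply Rmax_l|].
  intros n x Hn; eapply Rle_trans; [apply mv_bound|]. apply Rmult_le_compat_r; [apply vnorm_nonneg|].
  eapply Rle_trans; [apply HC; auto|apply Rmax_r].
Qed.

Lemma zero_of_geometric (x c q : R) : 0 <= x -> 0 <= q < 1 -> (forall j : nat, x <= c * q ^ j) -> x = 0.
Proof.
  intros Hx Hq H. destruct (Req_dec x 0) as [E|E]; auto. exfalso.
  assert (Hc : 0 < c) by (specialize (H 0%nat); simpl in H; lra).
  destruct (pow_lt_1_zero q) with (y := x / c) as [N HN].
  - rewrite Rabs_pos_eq; lra.
  - apply Rdiv_lt_0_compat; lra.
  - specialize (HN N (le_n N)). specialize (H N). rewrite Rabs_pos_eq in HN by (apply pow_le; lra).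
    apply (Rmult_lt_compat_l c) in HN; auto. replace (c * (x / c)) with x in HN by (field; lra). lra.
Qed.

(* Backward orbits in [ker P] decay, so they cannot have a component along [im P']. *)
Lemma ED_kernel_unique (d : nat) (B : Z -> mat) (k : Z) (P P' : Z -> mat) (K al K' al' : R) :
  ED_wrt d B (Zle k) P K al -> ED_wrt d B (Zle k) P' K' al' ->
  forall n x, (n <= k)%Z -> supp d x -> mv d (P n) x = zerov -> mv d (P' n) x = zerov.
Proof.
  intros H H' n x Hn Hx Hk.
  destruct (ED_proj_bound _ _ _ _ _ _ H') as [C [HC0 HC]].
  pose proof H as [_ [HK [Hal _]]]. pose proof H' as [_ [HK' [Hal' _]]].
  assert (Hz : vnorm d (mv d (P' n) x) = 0).
  { apply (zero_of_geometric _ (K' * C * K * vnorm d x) (al' * al)); [apply vnorm_nonneg|split; nra|].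
    intros j. set (a := (n - Z.of_nat j)%Z).
    assert (HI : forall i, (i <= j)%nat -> Zle k (a + Z.of_nat i)%Z) by (intros i Hi; unfold Zle, a; lia).
    pose proof (edw_of_ED _ _ _ _ _ _ a j H HI) as E. pose proof (edw_of_ED _ _ _ _ _ _ a j H' HI) as E'.
    assert (Ea : (a + Z.of_nat (0 + j) = n)%Z) by (unfold a; lia).
    destruct (edw_backward d _ _ _ _ _ 0 j x E) as [z [z1 [z2 [z3 z4]]]]; auto; [now rewrite Ea|].
    rewrite <- z3 at 1. rewrite <- Ea at 1.
    rewrite (edw_inv_fl d _ _ _ _ _ 0 j z E') by lia.
    eapply Rle_trans; [apply (edw_stable _ _ _ _ _ _ E'); [lia|apply (edw_proj _ _ _ _ _ _ E'); lia]|].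
    assert (HCz : vnorm d (mv d (P' (a + Z.of_nat 0)%Z) z) <= C * vnorm d z) by (apply HC, HI; lia).
    assert (Hp' : 0 < al' ^ j) by (apply pow_lt; lra).
    rewrite Rpow_mult_distr.
    apply Rle_trans with (K' * al' ^ j * (C * (K * al ^ j * vnorm d x))); [|lra].
    apply Rmult_le_compat_l; [nra|]. eapply Rle_trans; [apply HCz|]. now apply Rmult_le_compat_l. }
  apply (supp_ext d); auto using supp_mv, supp_zerov. now apply vnorm_zero_eqv.
Qed.

(** Forward orbits in [im P] decay, whereas a component along [ker P'] would have to grow. *)
Lemma ED_image_unique (d : nat) (B : Z -> mat) (k : Z) (P P' : Z -> mat) (K al K' al' : R) :
  ED_wrt d B (Zge k) P K al -> ED_wrt d B (Zge k) P' K' al' ->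
  forall n x, (k <= n)%Z -> mv d (P n) x = x -> mv d (P' n) x = x.
Proof.
  intros H H' n x Hn Hk. assert (Hx : supp d x) by (rewrite <- Hk; apply supp_mv).
  destruct (ED_proj_bound _ _ _ _ _ _ H') as [C [HC0 HC]].
  pose proof H as [_ [HK [Hal _]]]. pose proof H' as [_ [HK' [Hal' _]]].
  set (q := vsub x (mv d (P' n) x)).
  assert (Hq : supp d q) by (apply supp_vsub; auto; apply supp_mv).
  assert (Hz : vnorm d q = 0).
  { apply (zero_of_geometric _ (K' * (1 + C) * K * vnorm d x) (al' * al)); [apply vnorm_nonneg|split; nra|].
    intros j.
    assert (HI : forall i, (i <= j)%nat -> Zge k (n + Z.of_nat i)%Z) by (intros i Hi; unfold Zge; lia).
    pose proof (edw_of_ED _ _ _ _ _ _ n j H HI) as E. pose proof (edw_of_ED _ _ _ _ _ _ n j H' HI) as E'.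
    assert (En : (n + Z.of_nat 0 = n)%Z) by lia.
    set (F := fl d (fun i => B (n + Z.of_nat i)%Z) 0 j) in *.
    assert (H1 : vnorm d q <= K' * al' ^ j * vnorm d (F q)).
    { apply (edw_unstable _ _ _ _ _ _ E'); auto. rewrite En. apply mv_proj_compl.
      pose proof (edw_proj _ _ _ _ _ _ E' 0%nat x ltac:(lia)) as Hpr. cbv beta in Hpr. now rewrite En in Hpr. }
    assert (H2 : F q = vsub (F x) (mv d (P' (n + Z.of_nat (0 + j))%Z) (F x))).
    { unfold F, q. rewrite (edw_inv_fl d _ _ _ _ _ 0 j x E') by lia. rewrite En. apply fl_vsub. }
    assert (H3 : vnorm d (F x) <= K * al ^ j * vnorm d x).
    { apply (edw_stable _ _ _ _ _ _ E); auto. now rewrite En. }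
    assert (H4 : vnorm d (F q) <= (1 + C) * vnorm d (F x)).
    { rewrite H2. eapply Rle_trans; [apply vnorm_sub_le|].
      specialize (HC (n + Z.of_nat (0 + j))%Z (F x) (HI _ (le_n _))). lra. }
    assert (Hp' : 0 < al' ^ j) by (apply pow_lt; lra).
    rewrite Rpow_mult_distr. eapply Rle_trans; [apply H1|].
    apply Rle_trans with (K' * al' ^ j * ((1 + C) * (K * al ^ j * vnorm d x))); [|lra].
    apply Rmult_le_compat_l; [nra|]. eapply Rle_trans; [apply H4|]. apply Rmult_le_compat_l; lra. }
  apply (supp_ext d); auto using supp_mv. intros i Hi.
  pose proof (vnorm_zero_eqv _ _ Hz i Hi) as Hi'. unfold q, vsub, zerov in Hi'. lra.
Qed.

(** * Nonlinear perturbations *)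

Section Perturbed.
Variables (d : nat) (B P : nat -> mat) (K al b C e : R) (n : nat) (phi : nat -> vec).
Hypothesis H : edw d B P K al n.
Hypothesis HC : 0 <= C.
Hypothesis HP1 : forall i x, (i <= n)%nat -> vnorm d (mv d (P i) x) <= C * vnorm d x.
Hypothesis HP2 : forall i x, (i <= n)%nat -> supp d x -> vnorm d (vsub x (mv d (P i) x)) <= C * vnorm d x.
Hypothesis Hb : al < b <= 1.
Hypothesis He0 : 0 <= e.
Hypothesis He : K * C / al * e * (2 / (1 - al / b)) <= 1 / 2.
Hypothesis Hphi : forall i, supp d (phi i).
Hypothesis Hpert : forall i, (i < n)%nat ->
  vnorm d (vsub (phi (S i)) (mv d (B i) (phi i))) <= e * vnorm d (phi i).

Lemma coef_nonneg : 0 <= K * C / al * e.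
Proof.
  pose proof (edw_K _ _ _ _ _ _ H). pose proof (edw_al _ _ _ _ _ _ H).
  apply Rmult_le_pos; auto. unfold Rdiv; apply Rmult_le_pos; [nra|].
  apply Rlt_le, Rinv_0_lt_compat; lra.
Qed.

(** The defect of [phi] is read as an inhomogeneity of size at most [e * |phi|], which leads to an
    inequality of the type of [weighted_decay], up to the two boundary terms. *)
Lemma perturbed_estimate i : (i <= n)%nat ->
  vnorm d (phi i) <= K * al ^ i * vnorm d (mv d (P 0%nat) (phi 0%nat))
    + K * al ^ (n - i) * vnorm d (vsub (phi n) (mv d (P n) (phi n)))
    + K * C / al * e * sumn (S n) (fun k => al ^ ndist i k * vnorm d (phi k)).
Proof.
  intros Hi. pose proof (edw_K _ _ _ _ _ _ H) as HK. pose proof (edw_al _ _ _ _ _ _ H) as Hal.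
  pose proof (edw_linear_estimate d B P K al n C phi (fun k => vsub (phi (S k)) (mv d (B k) (phi k))) H HC HP1 HP2 Hphi) as Hest.
  specialize (Hest ltac:(intros; apply supp_vsub; auto; apply supp_mv)).
  specialize (Hest ltac:(intros; extensionality j; unfold vadd, vsub; ring) i Hi).
  eapply Rle_trans; [apply Hest|]. apply Rplus_le_compat_l.
  rewrite Rmult_assoc. apply Rmult_le_compat_l.
  - unfold Rdiv; apply Rmult_le_pos; [nra|]. apply Rlt_le, Rinv_0_lt_compat; lra.
  - rewrite <- sumn_scal. cbn [sumn].
    assert (Hlast : 0 <= e * (al ^ ndist i n * vnorm d (phi n))).
    { apply Rmult_le_pos; auto. apply Rmult_le_pos; [apply pow_le; lra|apply vnorm_nonneg]. }
    assert (sumn n (fun k => al ^ ndist i k * vnorm d (vsub (phi (S k)) (mv d (B k) (phi k))))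
      <= sumn n (fun k => e * (al ^ ndist i k * vnorm d (phi k)))).
    { apply sumn_le; intros k Hk. assert (0 <= al ^ ndist i k) by (apply pow_le; lra).
      specialize (Hpert k Hk). nra. }
    lra.
Qed.

(** The condition at the right end removes the unstable boundary term, and the stable one is bounded
    through [phi 0]. *)
Lemma decay_forward : mv d (P n) (phi n) = phi n ->
  forall i, (i <= n)%nat -> vnorm d (phi i) <= 2 * (K * C) * b ^ i * vnorm d (phi 0%nat).
Proof.
  intros Hn. pose proof (edw_K _ _ _ _ _ _ H) as HK. pose proof (edw_al _ _ _ _ _ _ H) as Hal.
  apply (weighted_decay n (fun i => vnorm d (phi i)) al b (K * C) (K * C / al * e)); try lra; auto.
  - nra.
  - apply coef_nonneg.
  - intros; apply vnorm_nonneg.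
  - intros i Hi. eapply Rle_trans; [apply perturbed_estimate; auto|].
    rewrite Hn. assert (E : vnorm d (vsub (phi n) (phi n)) = 0).
    { rewrite <- (vnorm_zero d); apply vnorm_ext; intros j _; unfold vsub, zerov; ring. }
    rewrite E, Rmult_0_r, Rplus_0_r. apply Rplus_le_compat_r.
    assert (0 <= K * al ^ i) by (pose proof (pow_lt al i (proj1 Hal)); nra).
    specialize (HP1 0%nat (phi 0%nat) ltac:(lia)).
    apply (Rmult_le_compat_l (K * al ^ i)) in HP1; auto. lra.
Qed.

(** The same argument after time reversal: the condition at the left end removes the stable boundary
    term. *)
Lemma decay_backward : mv d (P 0%nat) (phi 0%nat) = zerov ->
  forall i, (i <= n)%nat -> vnorm d (phi (n - i)%nat) <= 2 * (K * C) * b ^ i * vnorm d (phi n).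
Proof.
  intros Hn. pose proof (edw_K _ _ _ _ _ _ H) as HK. pose proof (edw_al _ _ _ _ _ _ H) as Hal.
  intros i Hi. replace (phi n) with (phi (n - 0)%nat) by (f_equal; lia).
  revert i Hi. apply (weighted_decay n (fun i => vnorm d (phi (n - i)%nat)) al b (K * C) (K * C / al * e)); try lra; auto.
  - nra.
  - apply coef_nonneg.
  - intros; apply vnorm_nonneg.
  - intros i Hi. eapply Rle_trans; [apply perturbed_estimate; lia|].
    rewrite Hn, vnorm_zero, Rmult_0_r, Rplus_0_l. apply Rplus_le_compat.
    + replace (n - (n - i))%nat with i by lia. rewrite Nat.sub_0_r.
      assert (0 <= K * al ^ i) by (pose proof (pow_lt al i (proj1 Hal)); nra).
      specialize (HP2 n (phi n) (le_n n) (Hphi n)).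
      apply (Rmult_le_compat_l (K * al ^ i)) in HP2; auto. lra.
    + apply Rmult_le_compat_l; [apply coef_nonneg|]. right.
      (* Reversing the order of summation matches the kernel, since [ndist] is invariant under
         [k -> n - k]. *)
      assert (Hrev : forall m g, sumn m g = sumn m (fun k => g (m - 1 - k)%nat)).
      { intros m g; induction m as [|m IH]; auto.
        change (S m) with (1 + m)%nat at 2. rewrite sumn_app. cbn [sumn].
        rewrite IH, Rplus_0_l, Rplus_comm. f_equal; [f_equal; lia|].
        apply sumn_ext; intros k Hk. f_equal; lia. }
      rewrite Hrev. apply sumn_ext; intros k Hk.
      replace (S n - 1 - k)%nat with (n - k)%nat by lia. f_equal. f_equal. unfold ndist; lia.
Qed.

(** Both boundary terms vanish, so [weighted_decay] applies with the constant [c = 0]. *)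
Lemma window_trivial : mv d (P 0%nat) (phi 0%nat) = zerov -> mv d (P n) (phi n) = phi n ->
  forall i, (i <= n)%nat -> vnorm d (phi i) = 0.
Proof.
  intros H0 Hn i Hi. pose proof (edw_K _ _ _ _ _ _ H) as HK. pose proof (edw_al _ _ _ _ _ _ H) as Hal.
  assert (Hle : vnorm d (phi i) <= 2 * 0 * b ^ i * vnorm d (phi 0%nat)).
  { revert i Hi. apply (weighted_decay n (fun i => vnorm d (phi i)) al b 0 (K * C / al * e)); try lra; auto.
    - apply coef_nonneg.
    - intros; apply vnorm_nonneg.
    - intros i Hi. eapply Rle_trans; [apply perturbed_estimate; auto|].
      rewrite Hn, H0, vnorm_zero. assert (E : vnorm d (vsub (phi n) (phi n)) = 0).
      { rewrite <- (vnorm_zero d); apply vnorm_ext; intros j _; unfold vsub, zerov; ring. }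
      rewrite E. lra. }
  pose proof (vnorm_nonneg d (phi i)). lra.
Qed.
End Perturbed.

(** * Mean value estimate and bounds uniform in the parameter *)

(** Pairing with a fixed vector [w] along the ray through [x] makes the mean value theorem for real
    functions applicable. The summand 1 in [N] keeps it positive when [w] or [x] vanishes. *)
Lemma dot_linear_deriv (d : nat) (g : vec -> vec) (x w : vec) (A : mat) (Dg : vec -> mat) :
  (forall y, supp d y -> is_deriv d g y (Dg y)) -> supp d x ->
  forall t, derivable_pt_lim (fun s => dot d w (vsub (g (vscal s x)) (mv d A (vscal s x)))) t
    (dot d w (vsub (mv d (Dg (vscal t x)) x) (mv d A x))).
Proof.
  intros Hg Hx t eps Heps.
  set (N := vnorm d w * vnorm d x + 1).
  assert (HN : 0 < N).
  { unfold N; pose proof (vnorm_nonneg d w); pose proof (vnorm_nonneg d x); nra. }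
  destruct (Hg (vscal t x) (supp_vscal d t x Hx) (eps / (2 * N))) as [del [Hdel Hd]].
  { apply Rdiv_lt_0_compat; lra. }
  assert (Hpos : 0 < del / (vnorm d x + 1)).
  { apply Rdiv_lt_0_compat; auto. pose proof (vnorm_nonneg d x); lra. }
  exists (mkposreal _ Hpos). simpl. intros h Hh0 Hh.
  assert (Hhx : vnorm d (vscal h x) < del).
  { rewrite vnorm_scal. pose proof (vnorm_nonneg d x). pose proof (Rabs_pos h).
    apply (Rmult_lt_compat_r (vnorm d x + 1)) in Hh; [|lra].
    unfold Rdiv in Hh; rewrite Rmult_assoc, Rinv_l in Hh by lra. nra. }
  specialize (Hd (vscal h x) (supp_vscal d h x Hx) Hhx).
  assert (E : vadd (vscal t x) (vscal h x) = vscal (t + h) x) by (extensionality i; unfold vadd, vscal; ring).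
  rewrite E in Hd.
  set (q := vsub (vsub (g (vscal (t + h) x)) (g (vscal t x))) (mv d (Dg (vscal t x)) (vscal h x))) in *.
  set (num := dot d w (vsub (g (vscal (t + h) x)) (mv d A (vscal (t + h) x)))
             - dot d w (vsub (g (vscal t x)) (mv d A (vscal t x)))
             - h * dot d w (vsub (mv d (Dg (vscal t x)) x) (mv d A x))).
  assert (Enum : num = dot d w q).
  { unfold num, q, dot, Rminus. rewrite !Ropp_mult_distr_l, <- E.
    replace (- sumn d (fun i => w i * vsub (g (vscal t x)) (mv d A (vscal t x)) i))
      with ((-1) * sumn d (fun i => w i * vsub (g (vscal t x)) (mv d A (vscal t x)) i)) by ring.
    rewrite <- !sumn_scal, <- !sumn_plus. apply sumn_ext; intros i _.
    rewrite mv_vadd, !mv_vscal. unfold vsub, vadd, vscal. ring. }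
  replace ((dot d w (vsub (g (vscal (t + h) x)) (mv d A (vscal (t + h) x)))
    - dot d w (vsub (g (vscal t x)) (mv d A (vscal t x)))) / h
    - dot d w (vsub (mv d (Dg (vscal t x)) x) (mv d A x))) with (num / h) by (unfold num; field; auto).
  rewrite Enum. unfold Rdiv; rewrite Rabs_mult, Rabs_inv.
  assert (Habs : Rabs (dot d w q) <= vnorm d w * vnorm d q).
  { apply Rabs_le; split; [|apply dot_le].
    pose proof (dot_le d (vscal (-1) w) q) as Hl. rewrite vnorm_scal, Rabs_left in Hl by lra.
    replace (dot d (vscal (-1) w) q) with (- dot d w q) in Hl; [lra|].
    unfold dot; replace (- sumn d (fun i => w i * q i)) with ((-1) * sumn d (fun i => w i * q i)) by ring.
    rewrite <- sumn_scal; apply sumn_ext; intros; unfold vscal; ring. }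
  assert (Hh' : 0 < Rabs h) by now apply Rabs_pos_lt.
  rewrite vnorm_scal in Hd.
  apply (Rmult_lt_reg_r (Rabs h)); auto. rewrite Rmult_assoc, Rinv_l, Rmult_1_r by lra.
  assert (Hq : vnorm d w * vnorm d q <= eps / (2 * N) * (vnorm d w * vnorm d x) * Rabs h).
  { apply (Rmult_le_compat_l (vnorm d w)) in Hd; [lra|apply vnorm_nonneg]. }
  assert (Hlt : eps / (2 * N) * (vnorm d w * vnorm d x) < eps).
  { assert (Hp : 0 < eps / (2 * N)) by (apply Rdiv_lt_0_compat; lra).
    assert (Hq' : eps / (2 * N) * N = eps / 2) by (field; lra).
    assert (vnorm d w * vnorm d x < N) by (unfold N; lra). nra. }
  nra.
Qed.

(** The remainder [w] is paired with itself: [|w| ^ 2] equals a derivative of the pairing at an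
    intermediate point, which is at most [|w| * eps * |x|]. *)
Lemma mean_value_bound (d : nat) (g : vec -> vec) (A : mat) (Dg : vec -> mat) (eta eps : R) :
  (forall y, supp d y -> is_deriv d g y (Dg y)) -> eqv d (g zerov) zerov ->
  (forall y z, supp d y -> vnorm d y <= eta ->
     vnorm d (vsub (mv d (Dg y) z) (mv d A z)) <= eps * vnorm d z) ->
  forall x, supp d x -> vnorm d x <= eta -> vnorm d (vsub (g x) (mv d A x)) <= eps * vnorm d x.
Proof.
  intros Hg H0 HD x Hx Hxe. set (w := vsub (g x) (mv d A x)).
  destruct (MVT_cor2 (fun s => dot d w (vsub (g (vscal s x)) (mv d A (vscal s x))))
    (fun t => dot d w (vsub (mv d (Dg (vscal t x)) x) (mv d A x))) 0 1) as [c [Hc1 Hc2]]; [lra| |].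
  - intros; now apply dot_linear_deriv.
  - replace (vscal 0 x) with zerov in Hc1 by (extensionality i; unfold vscal, zerov; ring).
    replace (vscal 1 x) with x in Hc1 by (extensionality i; unfold vscal; ring).
    fold w in Hc1. rewrite mv_zerov in Hc1.
    assert (E0 : dot d w (vsub (g zerov) zerov) = 0).
    { apply sumn_zero; intros i Hi; unfold vsub; rewrite H0 by auto; unfold zerov; ring. }
    rewrite E0, dot_self in Hc1.
    pose proof (dot_le d w (vsub (mv d (Dg (vscal c x)) x) (mv d A x))) as Hd.
    assert (Hcx : vnorm d (vscal c x) <= eta).
    { rewrite vnorm_scal, Rabs_pos_eq by lra. pose proof (vnorm_nonneg d x). nra. }
    specialize (HD (vscal c x) x (supp_vscal d c x Hx) Hcx).
    pose proof (vnorm_nonneg d w) as Hw.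
    destruct (Req_dec (vnorm d w) 0) as [E|E].
    + rewrite E in *. eapply Rle_trans; [|exact HD]. apply vnorm_nonneg.
    + apply (Rmult_le_reg_l (vnorm d w)); [lra|].
      apply (Rmult_le_compat_l (vnorm d w)) in HD; auto. nra.
Qed.

Section Uniform.
Context {L : Type} (dist : L -> L -> R).
Variables (d : nat) (f : Z -> L -> vec -> vec) (D2f : Z -> L -> vec -> mat).
Hypothesis Hmet : is_metric dist.
Hypothesis Hcomp : mcompact dist.
Hypothesis Hf0 : forall n l, eqv d (f n l zerov) zerov.
Hypothesis Hder : forall n l x, supp d x -> is_deriv d (f n l) x (D2f n l x).
Variable r0 : R.
Hypothesis Hr0 : 0 < r0.
Hypothesis Heq : equicontm_on dist d (closed_ball d r0) D2f.
Hypothesis Hbd : ptwise_boundedm_on d (closed_ball d r0) D2f.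

Lemma zero_in_ball l : closed_ball (L := L) d r0 l zerov.
Proof. split; [apply supp_zerov|rewrite vnorm_zero; lra]. Qed.

Lemma D2f_near ls eps : 0 < eps -> exists del, 0 < del /\ forall l n x z, supp d x ->
  vnorm d x <= r0 -> dist ls l + vnorm d x < del ->
  vnorm d (vsub (mv d (D2f n l x) z) (mv d (D2f n ls zerov) z)) <= eps * vnorm d z.
Proof.
  intros Heps. destruct (Heq ls zerov (zero_in_ball ls) eps Heps) as [del [Hd H]].
  exists del; split; auto. intros l n x z Hx Hxr Hlt.
  rewrite <- mv_msub. eapply Rle_trans; [apply mv_bound|].
  apply Rmult_le_compat_r; [apply vnorm_nonneg|]. apply Rlt_le, H; [split; auto|].
  rewrite (vnorm_ext d (vsub x zerov) x); auto. intros i _; unfold vsub, zerov; ring.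
Qed.

(** Equicontinuity at [(ls, 0)] keeps the derivative near its value on the zero section, uniformly
    in [n]; compactness adds uniformity in the parameter, and the mean value estimate integrates
    it. *)
Lemma remainder_small eps : 0 < eps -> exists eta, 0 < eta /\ forall l n x, supp d x ->
  vnorm d x <= eta -> vnorm d (vsub (f n l x) (mv d (D2f n l zerov) x)) <= eps * vnorm d x.
Proof.
  intros Heps.
  destruct (compact_uniform dist Hmet (fun r l => forall n x z, supp d x -> vnorm d x <= r ->
    vnorm d (vsub (mv d (D2f n l x) z) (mv d (D2f n l zerov) z)) <= eps * vnorm d z) Hcomp) as [eta [He H]].
  - intros r r' l Hr' Hrr H n x z Hx Hxr; apply H; auto; lra.
  - intros ls. destruct (D2f_near ls (eps / 2)) as [del [Hd H]]; [lra|].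
    exists (Rmin r0 (del / 4)), (del / 2). split; [apply Rmin_pos; lra|]. split; [lra|].
    intros l Hl n x z Hx Hxr.
    assert (vnorm d x <= r0) by (eapply Rle_trans; [exact Hxr|apply Rmin_l]).
    assert (vnorm d x <= del / 4) by (eapply Rle_trans; [exact Hxr|apply Rmin_r]).
    pose proof (H l n x z Hx H0 ltac:(lra)) as Ha.
    pose proof (H l n zerov z (supp_zerov d) ltac:(rewrite vnorm_zero; lra) ltac:(rewrite vnorm_zero; lra)) as Hb.
    eapply Rle_trans; [apply (vnorm_sub_triang d _ (mv d (D2f n ls zerov) z))|].
    rewrite (vnorm_sub_sym d (mv d (D2f n ls zerov) z)). lra.
  - exists eta; split; auto. intros l n x Hx Hxe.
    apply (mean_value_bound d (f n l) (D2f n l zerov) (D2f n l) eta eps); auto.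
Qed.

(** The bound is written as [/ r] to fit [compact_uniform]. Near [ls] it is [C + 1]: the pointwise
    bound at [ls] plus the tolerance 1 of equicontinuity. *)
Lemma linearization_bounded : exists a, 0 <= a /\ forall l n z,
  vnorm d (mv d (D2f n l zerov) z) <= a * vnorm d z.
Proof.
  destruct (compact_uniform dist Hmet (fun r l => forall n z,
    vnorm d (mv d (D2f n l zerov) z) <= / r * vnorm d z) Hcomp) as [r [Hr H]].
  - intros r r' l Hr' Hrr H n z. eapply Rle_trans; [apply H|].
    apply Rmult_le_compat_r; [apply vnorm_nonneg|]. apply Rinv_le_contravar; auto.
  - intros ls. destruct (D2f_near ls 1 Rlt_0_1) as [del [Hd H]].
    destruct (Hbd ls zerov (zero_in_ball ls)) as [C HC].
    assert (HC0 : 0 <= C) by (eapply Rle_trans; [apply mnorm_nonneg|apply (HC 0%Z)]).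
    exists (/ (C + 1)), del. split; [apply Rinv_0_lt_compat; lra|]. split; auto.
    intros l Hl n z. rewrite Rinv_inv.
    pose proof (H l n zerov z (supp_zerov d) ltac:(rewrite vnorm_zero; lra) ltac:(rewrite vnorm_zero; lra)) as Ha.
    eapply Rle_trans; [apply (vnorm_triang_sub d _ (mv d (D2f n ls zerov) z))|].
    pose proof (mv_bound d (D2f n ls zerov) z) as Hb.
    assert (mnorm d (D2f n ls zerov) * vnorm d z <= C * vnorm d z).
    { apply Rmult_le_compat_r; [apply vnorm_nonneg|apply HC]. }
    lra.
  - exists (/ r); split; auto. apply Rlt_le, Rinv_0_lt_compat; auto.
Qed.

(* The bounds on the projectors come from the dichotomy constants alone, hence are uniform
   in the parameter, at indices that have room for a fixed number of steps to their right. *)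
Lemma uniform_proj_bound (I : Z -> Prop) (P : L -> Z -> mat) (K al : R) :
  (forall l, ED_wrt d (fun n => D2f n l zerov) I (P l) K al) ->
  exists (m : nat) (C : R), 0 <= C /\ forall l n, (forall i, (i <= m)%nat -> I (n + Z.of_nat i)%Z) ->
    (forall x, vnorm d (mv d (P l n) x) <= C * vnorm d x) /\
    (forall x, supp d x -> vnorm d (vsub x (mv d (P l n) x)) <= C * vnorm d x).
Proof.
  intros HED. destruct linearization_bounded as [a [Ha HA]].
  destruct (classic (inhabited L)) as [[l0]|Hn].
  2:{ exists 0%nat, 0. split; [lra|]. intros l; exfalso; apply Hn; now constructor. }
  pose proof (HED l0) as [_ [HK [Hal _]]].
  assert (Hm : exists m, K * al ^ m * (K * al ^ m) <= 1 / 2).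
  { destruct (pow_lt_1_zero al) with (y := / (2 * K)) as [m Hm]; [rewrite Rabs_pos_eq; lra| |].
    - apply Rinv_0_lt_compat; lra.
    - exists m. specialize (Hm m (le_n m)). rewrite Rabs_pos_eq in Hm by (apply pow_le; lra).
      apply (Rmult_lt_compat_l K) in Hm; [|lra]. replace (K * / (2 * K)) with (1 / 2) in Hm by (field; lra).
      assert (0 < K * al ^ m) by (pose proof (pow_lt al m (proj1 Hal)); nra). nra. }
  destruct Hm as [m Hm]. set (c := 2 * (K * al ^ m * (a ^ m + K * al ^ m))).
  assert (Hc : 0 <= c).
  { unfold c; pose proof (pow_lt al m (proj1 Hal)); pose proof (pow_le a m Ha).
    assert (0 <= K * al ^ m) by nra. nra. }
  exists m, (c + 1). split; [lra|]. intros l n HI.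
  assert (Hq : forall x, supp d x -> vnorm d (vsub x (mv d (P l n) x)) <= c * vnorm d x).
  { intros x Hx. pose proof (edw_of_ED _ _ _ _ _ _ n m (HED l) HI) as E.
    pose proof (edw_proj_bound d _ _ _ _ m 0 m a x E (le_n m) Ha) as Hb. cbv beta in Hb.
    replace (n + Z.of_nat 0)%Z with n in Hb by lia. apply Hb; auto. }
  split.
  - intros x. rewrite (mv_eqv d (P l n) x (vtrunc d x)) by (intros i Hi; now rewrite vtrunc_eqv).
    rewrite (vnorm_ext d x (vtrunc d x)) by (intros i Hi; now rewrite vtrunc_eqv).
    set (y := vtrunc d x). specialize (Hq y (supp_vtrunc d x)).
    eapply Rle_trans; [apply (vnorm_triang_sub d _ y)|]. rewrite (vnorm_sub_sym d _ y). lra.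
  - intros x Hx. specialize (Hq x Hx). pose proof (vnorm_nonneg d x). lra.
Qed.
End Uniform.

(** * The truncated boundary value problem *)

(** Even codes for [z >= 0], odd ones for [z < 0]. Coordinate [j] at time [z] is stored at
    [zcode z * d + j], which makes a sequence over [Z] a single sequence for [vec_cluster]. *)
Definition zcode (z : Z) : nat := (2 * Z.abs_nat z + (if Z.leb 0 z then 0 else 1))%nat.
Definition zdecode (k : nat) : Z := if Nat.even k then Z.of_nat (Nat.div2 k) else (- Z.of_nat (Nat.div2 k))%Z.

Lemma zdecode_zcode z : zdecode (zcode z) = z.
Proof.
  unfold zdecode, zcode. destruct (Z.leb_spec 0 z) as [H|H].
  - rewrite Nat.add_0_r, Nat.even_mul, Nat.div2_double; simpl. lia.
  - rewrite Nat.add_1_r, Nat.even_succ, <- Nat.negb_even, Nat.even_mul, Nat.div2_succ_double; simpl. lia.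
Qed.

Lemma biseq_cluster (d : nat) (C : R) (x : nat -> Z -> vec) :
  (forall k z, supp d (x k z)) -> (forall k z, vnorm d (x k z) <= C) ->
  exists psi, (forall z, supp d (psi z)) /\ forall (Q : nat) eps J, 0 < eps ->
    exists k, (J <= k)%nat /\ forall z, (Z.abs_nat z <= Q)%nat -> vnorm d (vsub (x k z) (psi z)) < eps.
Proof.
  intros Hs HC.
  destruct (vec_cluster C (fun k m => x k (zdecode (m / d)) (m mod d)%nat)) as [y Hy].
  { intros k m. destruct (Nat.lt_ge_cases (m mod d) d) as [H|H].
    - eapply Rle_trans; [exact (coord_le_vnorm d _ _ H)|apply HC].
    - rewrite Hs, Rabs_R0 by auto. eapply Rle_trans; [apply vnorm_nonneg|apply (HC k 0%Z)]. }
  exists (fun z j => if Nat.ltb j d then y (zcode z * d + j)%nat else 0). split.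
  - intros z j Hj. now rewrite (proj2 (Nat.ltb_ge j d)).
  - intros Q eps J Heps.
    assert (Hp : 0 < eps / (INR d + 1)) by (apply Rdiv_lt_0_compat; auto; pose proof (pos_INR d); lra).
    (* The codes of the times with [|z| <= Q] are at most [2 * Q + 1]. *)
    destruct (Hy ((2 * Q + 2) * d)%nat _ J Hp) as [k [Hk Hc]]. exists k; split; auto.
    intros z Hz. eapply Rle_lt_trans; [apply vnorm_le_sumn|].
    eapply Rle_lt_trans; [apply (sumn_le d _ (fun _ => eps / (INR d + 1)))|].
    + intros j Hj. unfold vsub; rewrite (proj2 (Nat.ltb_lt j d)) by auto.
      assert (Hzc : (zcode z <= 2 * Q + 1)%nat) by (unfold zcode; destruct Z.leb; lia).
      specialize (Hc (zcode z * d + j)%nat ltac:(nia)).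
      rewrite Nat.div_add_l, Nat.div_small, Nat.add_0_r, zdecode_zcode in Hc by lia.
      rewrite Nat.add_comm, Nat.Div0.mod_add, Nat.mod_small, Nat.add_comm in Hc by lia. lra.
    + rewrite sumn_const. pose proof (pos_INR d).
      replace (INR d * (eps / (INR d + 1))) with (eps - eps / (INR d + 1)) by (field; lra). lra.
Qed.

(** A finite sequence in [R^d] is stored as one long vector, so that the sequence space is a
    Euclidean space with its unit sphere; [blk] and [unblk] pass between the two forms. *)
Definition blk (d : nat) (v : vec) (i : nat) : vec := fun j => if Nat.ltb j d then v (i * d + j)%nat else 0.
Definition unblk (d n : nat) (phi : nat -> vec) : vec :=
  fun m => if Nat.ltb m (n * d) then phi (m / d)%nat (m mod d)%nat else 0.

Lemma supp_blk d v i : supp d (blk d v i).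
Proof. intros j Hj; unfold blk; now rewrite (proj2 (Nat.ltb_ge j d)). Qed.

Lemma supp_unblk d n phi : supp (n * d) (unblk d n phi).
Proof. intros j Hj; unfold unblk; now rewrite (proj2 (Nat.ltb_ge j (n * d))). Qed.

Lemma unblk_at (d n i j : nat) phi : (i < n)%nat -> (j < d)%nat -> unblk d n phi (i * d + j)%nat = phi i j.
Proof.
  intros Hi Hj; unfold unblk. rewrite (proj2 (Nat.ltb_lt _ _)) by nia.
  rewrite Nat.div_add_l, Nat.div_small, Nat.add_0_r by lia.
  now rewrite Nat.add_comm, Nat.Div0.mod_add, Nat.mod_small by lia.
Qed.

Lemma blk_unblk d n phi i : (i < n)%nat -> blk d (unblk d n phi) i = vtrunc d (phi i).
Proof.
  intros Hi; apply (supp_ext d); [apply supp_blk|apply supp_vtrunc|].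
  intros j Hj. rewrite vtrunc_eqv by auto. unfold blk; rewrite (proj2 (Nat.ltb_lt j d)) by auto.
  now apply unblk_at.
Qed.

Lemma unblk_ext d n phi psi : (forall i, (i < n)%nat -> eqv d (phi i) (psi i)) -> unblk d n phi = unblk d n psi.
Proof.
  intros H; extensionality m; unfold unblk. destruct (Nat.ltb_spec m (n * d)) as [Hm|]; auto.
  apply H; [apply Nat.Div0.div_lt_upper_bound; lia|apply Nat.mod_upper_bound; lia].
Qed.

Lemma unblk_blk d n v : supp (n * d) v -> unblk d n (blk d v) = v.
Proof.
  intros Hv; extensionality m; unfold unblk, blk. destruct (Nat.ltb_spec m (n * d)) as [Hm|Hm].
  - assert (d <> 0)%nat by lia. rewrite (proj2 (Nat.ltb_lt _ _)) by now apply Nat.mod_upper_bound.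
    f_equal. rewrite Nat.mul_comm; symmetry; now apply Nat.div_mod.
  - now rewrite Hv.
Qed.

Lemma vnorm_blk d n v : vnorm (n * d) v ^ 2 = sumn n (fun i => vnorm d (blk d v i) ^ 2).
Proof.
  rewrite vnorm_sqr. induction n as [|n IH]; [reflexivity|].
  replace (S n * d)%nat with (n * d + d)%nat by lia. rewrite sumn_app, IH. cbn [sumn]. f_equal.
  rewrite vnorm_sqr. apply sumn_ext; intros j Hj. unfold blk; now rewrite (proj2 (Nat.ltb_lt j d)).
Qed.

Lemma vnorm_blk_le d n v i : (i < n)%nat -> vnorm d (blk d v i) <= vnorm (n * d) v.
Proof.
  intros Hi; apply Rle_of_sqr; [apply vnorm_nonneg|]. rewrite vnorm_blk.
  apply (sumn_term_le n i (fun i => vnorm d (blk d v i) ^ 2)); auto. intros; apply pow2_ge_0.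
Qed.

Lemma contD_blk {C} (dC : C -> C -> R) D (d n i : nat) (v : C -> vec) : (i < n)%nat ->
  contD dC (dV (n * d)) D v -> contD dC (dV d) D (fun c => blk d (v c) i).
Proof.
  intros Hi Hv; apply contD_vec; intros j Hj.
  apply (contD_ext dC dR D (fun c => v c (i * d + j)%nat)).
  - intros c _; unfold blk; now rewrite (proj2 (Nat.ltb_lt j d)).
  - apply (contD_coord dC D (n * d)); auto. nia.
Qed.

Lemma contD_unblk {C} (dC : C -> C -> R) D (d n : nat) (phi : C -> nat -> vec) :
  (forall i, (i < n)%nat -> contD dC (dV d) D (fun c => phi c i)) ->
  contD dC (dV (n * d)) D (fun c => unblk d n (phi c)).
Proof.
  intros H; apply contD_vec; intros m Hm. assert (d <> 0)%nat by lia.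
  apply (contD_ext dC dR D (fun c => phi c (m / d)%nat (m mod d)%nat)).
  - intros c _; unfold unblk; now rewrite (proj2 (Nat.ltb_lt _ _)).
  - apply (contD_coord dC D d _ (fun c => phi c (m / d)%nat)); [now apply Nat.mod_upper_bound|].
    apply H, Nat.Div0.div_lt_upper_bound; lia.
Qed.

(** The source has [n + 1] blocks, the target [n + 2]; the last two blocks of the values are
    confined to the image of [Pl] and to the kernel of [Pr], which allows the dimensions to
    agree. *)
Definition wmap (d n : nat) (F : nat -> vec -> vec) (Pl Pr : mat) (v : vec) : vec :=
  vcat (n * d) (unblk d n (fun i => vsub (blk d v (S i)) (F i (blk d v i))))
    (vcat d (mv d Pl (blk d v 0)) (vsub (blk d v n) (mv d Pr (blk d v n)))).

Definition wbundle {L : Type} (d n : nat) (Pm Pp : L -> Z -> mat) (a b : Z) : bundle L :=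
  bsum (triv (n * d)) (bsum (IM d Pm a) (KER d Pp b)).

Lemma wmap_fiber {L : Type} d n F (Pm Pp : L -> Z -> mat) a b l v :
  meq d (mm d (Pm l a) (Pm l a)) (Pm l a) -> meq d (mm d (Pp l b) (Pp l b)) (Pp l b) ->
  fiber (wbundle d n Pm Pp a b) l (wmap d n F (Pm l a) (Pp l b) v).
Proof.
  intros Hm Hp. unfold wbundle, wmap. rewrite fiber_bsum, fiber_triv. simpl (bN (triv _)).
  rewrite vtrunc_vcat, vdrop_vcat by apply supp_unblk. split; [apply supp_unblk|].
  rewrite fiber_bsum. simpl bN. rewrite vtrunc_vcat, vdrop_vcat by apply supp_mv.
  rewrite fiber_IM, fiber_KER. split.
  - rewrite <- mv_mm. now apply mv_meq.
  - split; [apply supp_vsub; [apply supp_blk|apply supp_mv]|].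
    rewrite mv_proj_compl; [intros i _; reflexivity|]. rewrite <- mv_mm; now apply mv_meq.
Qed.

Lemma vcat_eqv_zerov n m u w : eqv (n + m) (vcat n u w) zerov -> eqv n u zerov /\ eqv m w zerov.
Proof.
  intros H; split; intros i Hi.
  - rewrite <- (vcat_lt n u w i Hi). apply H; lia.
  - rewrite <- (vcat_ge n u w i). apply (H (n + i)%nat); lia.
Qed.

Lemma wmap_eq_zero d n F Pl Pr v : eqv (n * d + (d + d)) (wmap d n F Pl Pr v) zerov ->
  (forall i, (i < n)%nat -> eqv d (blk d v (S i)) (F i (blk d v i))) /\
  mv d Pl (blk d v 0) = zerov /\ mv d Pr (blk d v n) = blk d v n.
Proof.
  intros H; apply vcat_eqv_zerov in H; destruct H as [H1 H]. apply vcat_eqv_zerov in H; destruct H as [H2 H3].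
  split; [|split].
  - intros i Hi j Hj. specialize (H1 (i * d + j)%nat ltac:(nia)). rewrite unblk_at in H1 by auto.
    unfold vsub, zerov in H1. lra.
  - apply (supp_ext d); auto using supp_mv, supp_zerov.
  - apply (supp_ext d); auto using supp_mv, supp_blk. intros j Hj; specialize (H3 j Hj).
    unfold vsub, zerov in H3; lra.
Qed.

Lemma contD_wmap {C} (dC : C -> C -> R) D (d n : nat) (F : C -> nat -> vec -> vec) (Pl Pr : C -> mat) (v : C -> vec) :
  contD dC (dV (S n * d)) D v ->
  (forall i, (i < n)%nat -> contD dC (dV d) D (fun c => F c i (blk d (v c) i))) ->
  (forall i j, (i < d)%nat -> (j < d)%nat -> contD dC dR D (fun c => Pl c i j)) ->
  (forall i j, (i < d)%nat -> (j < d)%nat -> contD dC dR D (fun c => Pr c i j)) ->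
  contD dC (dV (n * d + (d + d))) D (fun c => wmap d n (F c) (Pl c) (Pr c) (v c)).
Proof.
  intros Hv HF Hl Hr. apply contD_vcat; [|apply contD_vcat].
  - apply (contD_unblk dC D d n (fun c i => vsub (blk d (v c) (S i)) (F c i (blk d (v c) i)))).
    intros i Hi. apply contD_vsub; auto. apply (contD_blk dC D d (S n)); auto; lia.
  - apply contD_mvr; auto. apply (contD_blk dC D d (S n)); auto; lia.
  - apply contD_vsub; [|apply contD_mvr; auto]; apply (contD_blk dC D d (S n)); auto; lia.
Qed.

Lemma blk_vadd d u v i : blk d (vadd u v) i = vadd (blk d u i) (blk d v i).
Proof. extensionality j; unfold blk, vadd; destruct Nat.ltb; ring. Qed.
Lemma blk_vscal d c v i : blk d (vscal c v) i = vscal c (blk d v i).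
Proof. extensionality j; unfold blk, vscal; destruct Nat.ltb; ring. Qed.
Lemma unblk_vadd d n phi psi : unblk d n (fun i => vadd (phi i) (psi i)) = vadd (unblk d n phi) (unblk d n psi).
Proof. extensionality m; unfold unblk, vadd; destruct Nat.ltb; ring. Qed.
Lemma unblk_vscal d n c phi : unblk d n (fun i => vscal c (phi i)) = vscal c (unblk d n phi).
Proof. extensionality m; unfold unblk, vscal; destruct Nat.ltb; ring. Qed.

Lemma wmap_vadd d n A Pl Pr u v :
  wmap d n (fun i => mv d (A i)) Pl Pr (vadd u v) =
  vadd (wmap d n (fun i => mv d (A i)) Pl Pr u) (wmap d n (fun i => mv d (A i)) Pl Pr v).
Proof.
  unfold wmap. rewrite <- !vcat_vadd, <- unblk_vadd, !blk_vadd, !mv_vadd. f_equal; [|f_equal].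
  - apply unblk_ext; intros i Hi j _. rewrite !blk_vadd, mv_vadd. unfold vadd, vsub; ring.
  - extensionality j; unfold vadd, vsub; ring.
Qed.

Lemma wmap_vscal d n A Pl Pr c v :
  wmap d n (fun i => mv d (A i)) Pl Pr (vscal c v) = vscal c (wmap d n (fun i => mv d (A i)) Pl Pr v).
Proof.
  unfold wmap. rewrite <- !vcat_vscal, <- unblk_vscal, !blk_vscal, !mv_vscal. f_equal; [|f_equal].
  - apply unblk_ext; intros i Hi j _. rewrite !blk_vscal, mv_vscal. unfold vscal, vsub; ring.
  - extensionality j; unfold vscal, vsub; ring.
Qed.

(** Surjectivity of the linear problem. The stable part [u] is solved forward from [P 0 a], the
    unstable part [w] backward from [b - P n b]. The boundary operators belong to other projectors;
    but [ker P 0] lies in [ker Pl] and [im P n] in [im Pr], so the left condition sees only [u], the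
    right one only [w], and both return the prescribed data. *)
Lemma edw_solve (d : nat) (B P : nat -> mat) (K al : R) (n : nat) (Pl Pr : mat) (h : nat -> vec) (a b : vec) :
  edw d B P K al n ->
  (forall x, supp d x -> mv d (P 0%nat) x = zerov -> mv d Pl x = zerov) ->
  (forall x, mv d (P n) x = x -> mv d Pr x = x) ->
  mv d Pl a = a -> supp d b -> mv d Pr b = zerov -> (forall i, supp d (h i)) ->
  exists phi, (forall i, supp d (phi i)) /\
    (forall i, (i < n)%nat -> phi (S i) = vadd (mv d (B i) (phi i)) (h i)) /\
    mv d Pl (phi 0%nat) = a /\ vsub (phi n) (mv d Pr (phi n)) = b.
Proof.
  intros H Hl Hr Ha Hb Hrb Hh.
  assert (Has : supp d a) by (rewrite <- Ha; apply supp_mv).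
  set (u := fix u i := match i with O => mv d (P 0%nat) a | S k => vadd (mv d (B k) (u k)) (mv d (P (S k)) (h k)) end).
  assert (Hus : forall i, supp d (u i)) by (intros [|i]; simpl; auto using supp_mv, supp_vadd).
  assert (HuP : forall i, (i <= n)%nat -> mv d (P i) (u i) = u i).
  { induction i as [|i IH]; intros Hi; simpl; [apply (edw_proj _ _ _ _ _ _ H); lia|].
    rewrite mv_vadd, <- (edw_inv _ _ _ _ _ _ H), IH, (edw_proj _ _ _ _ _ _ H) by lia. reflexivity. }
  (* The backward solution is extended one time step to the left at each stage, by redefining it at
     [i0 = n - S m]. *)
  assert (Hw : forall m, (m <= n)%nat -> exists w : nat -> vec, w n = vsub b (mv d (P n) b) /\
    (forall i, supp d (w i)) /\ (forall i, (n - m <= i <= n)%nat -> mv d (P i) (w i) = zerov) /\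
    (forall i, (n - m <= i < n)%nat -> w (S i) = vadd (mv d (B i) (w i)) (vsub (h i) (mv d (P (S i)) (h i))))).
  { induction m as [|m IH]; intros Hm.
    - exists (fun _ => vsub b (mv d (P n) b)); split; [auto|split; [|split]].
      + intros _; apply supp_vsub; auto using supp_mv.
      + intros i Hi; replace i with n by lia. apply mv_proj_compl, (edw_proj _ _ _ _ _ _ H); auto.
      + intros; lia.
    - destruct (IH ltac:(lia)) as [w [w1 [w2 [w3 w4]]]]. set (i0 := (n - S m)%nat).
      assert (E : S i0 = (n - m)%nat) by (unfold i0; lia).
      destruct (edw_surj _ _ _ _ _ _ H i0 (vsub (w (S i0)) (vsub (h i0) (mv d (P (S i0)) (h i0))))) as [x [x1 [x2 x3]]].
      + unfold i0; lia.
      + apply supp_vsub; auto. apply supp_vsub; auto using supp_mv.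
      + rewrite mv_vsub, (w3 (S i0)), mv_proj_compl by (try (apply (edw_proj _ _ _ _ _ _ H)); unfold i0; lia).
        extensionality k; unfold vsub, zerov; ring.
      + exists (fun i => if Nat.eqb i i0 then x else w i); split; [|split; [|split]].
        * rewrite (proj2 (Nat.eqb_neq n i0)) by (unfold i0; lia). auto.
        * intros i; destruct Nat.eqb; auto.
        * intros i Hi. destruct (Nat.eqb_spec i i0) as [->|Hne]; auto. apply w3. unfold i0 in *; lia.
        * intros i Hi. rewrite (proj2 (Nat.eqb_neq (S i) i0)) by (unfold i0; lia).
          destruct (Nat.eqb_spec i i0) as [->|Hne].
          -- rewrite x3. extensionality k; unfold vadd, vsub; ring.
          -- apply w4. unfold i0 in *; lia. }
  destruct (Hw n (le_n n)) as [w [w1 [w2 [w3 w4]]]].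
  exists (fun i => vadd (u i) (w i)); split; [|split; [|split]].
  - intros; now apply supp_vadd.
  - intros i Hi. rewrite w4 by lia. cbn [u]. rewrite mv_vadd.
    extensionality k; unfold vadd, vsub. fold u. ring.
  - rewrite mv_vadd, (Hl (w 0%nat)) by (auto; apply w3; lia). simpl.
    assert (Hz : mv d Pl (vsub a (mv d (P 0%nat) a)) = zerov).
    { apply Hl; [apply supp_vsub; auto using supp_mv|]. apply mv_proj_compl, (edw_proj _ _ _ _ _ _ H); lia. }
    rewrite mv_vsub, Ha in Hz. extensionality k. apply (f_equal (fun g => g k)) in Hz.
    unfold vadd, vsub, zerov in *. lra.
  - rewrite mv_vadd, (Hr (u n)), w1, mv_vsub, Hrb, (Hr (mv d (P n) b)) by (try (apply HuP; lia); apply (edw_proj _ _ _ _ _ _ H); lia).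
    extensionality k; unfold vadd, vsub, zerov; ring.
Qed.

(** * Nonvanishing on long windows *)

Lemma small_factor (X : R) : 0 <= X -> exists e, 0 < e /\ X * e <= 1 / 2.
Proof.
  intros HX; exists (/ (2 * (X + 1))). split; [apply Rinv_0_lt_compat; lra|].
  apply (Rmult_le_reg_r (2 * (X + 1))); [lra|]. rewrite Rmult_assoc, Rinv_l by lra. lra.
Qed.

Lemma kernel_coef_nonneg (K C al b : R) : 1 <= K -> 0 <= C -> 0 < al < b -> 0 <= K * C / al * (2 / (1 - al / b)).
Proof.
  intros HK HC Hal. assert (al / b < 1).
  { apply (Rmult_lt_reg_r b); [lra|]. unfold Rdiv; rewrite Rmult_assoc, Rinv_l; lra. }
  apply Rmult_le_pos; unfold Rdiv.
  - apply Rmult_le_pos; [nra|]. apply Rlt_le, Rinv_0_lt_compat; lra.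
  - apply Rmult_le_pos; [lra|]. apply Rlt_le, Rinv_0_lt_compat. unfold Rdiv in H; lra.
Qed.

(** Only an [e]-perturbed linear equation and the boundary conditions are recorded, so that orbits
    of [f], of the linearization and of the homotopy between them are covered at once. *)
Definition window_orbit {L : Type} (d : nat) (A : L -> Z -> mat) (Pm Pp : L -> Z -> mat) (e : R)
  (N : nat) (l : L) (phi : Z -> vec) : Prop :=
  (forall z, supp d (phi z)) /\
  (forall z, (- Z.of_nat N <= z < Z.of_nat N)%Z ->
     vnorm d (vsub (phi (z + 1)%Z) (mv d (A l z) (phi z))) <= e * vnorm d (phi z)) /\
  mv d (Pm l (- Z.of_nat N)%Z) (phi (- Z.of_nat N)%Z) = zerov /\
  mv d (Pp l (Z.of_nat N)) (phi (Z.of_nat N)) = phi (Z.of_nat N).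

(** The centre [|z| <= q] of an orbit controls all of it, with constants that depend neither on the
    length of the window nor on the parameter. *)
Definition decay_property {L : Type} (d : nat) (A : L -> Z -> mat) (Pm Pp : L -> Z -> mat)
  (e b C : R) (q : nat) : Prop :=
  forall l N phi, (q <= N)%nat -> window_orbit d A Pm Pp e N l phi ->
  forall mu, (forall z, (Z.abs_nat z <= q)%nat -> vnorm d (phi z) <= mu) ->
  forall z, (Z.abs_nat z <= N)%nat -> vnorm d (phi z) <= C * b ^ (Z.abs_nat z) * mu.

Lemma window_orbit_le {L : Type} (d : nat) (A : L -> Z -> mat) Pm Pp e e' N l phi :
  e <= e' -> window_orbit d A Pm Pp e N l phi -> window_orbit d A Pm Pp e' N l phi.
Proof.
  intros He [H1 [H2 [H3 H4]]]; split; auto; split; auto.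
  intros z Hz. specialize (H2 z Hz). pose proof (vnorm_nonneg d (phi z)). nra.
Qed.

Section Nonvanishing.
Context {L : Type} (dist : L -> L -> R).
Variables (d : nat) (f : Z -> L -> vec -> vec) (D2f : Z -> L -> vec -> mat).
Hypothesis Hmet : is_metric dist.
Hypothesis Hcomp : mcompact dist.
Variable r0 : R.
Hypothesis Hr0 : 0 < r0.
Hypothesis Heq : equicontm_on dist d (closed_ball d r0) D2f.
Hypothesis Hbd : ptwise_boundedm_on d (closed_ball d r0) D2f.
Variables (kl kh : Z) (Pm Pp : L -> Z -> mat) (Km am Kp ap : R).
Let A (l : L) (n : Z) := D2f n l zerov.
Hypothesis HEDm : forall l, ED_wrt d (A l) (Zle kl) (Pm l) Km am.
Hypothesis HEDp : forall l, ED_wrt d (A l) (Zge kh) (Pp l) Kp ap.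

(** Outside the centre both halves of the window lie in the domains of the dichotomies, and each has
    a boundary condition at its outer end: [decay_forward] serves the right half, [decay_backward]
    the left one. *)
Lemma window_decay (l0 : L) : exists e b C q, 0 < e /\ 0 < b < 1 /\ 0 <= C /\
  decay_property d A Pm Pp e b C q.
Proof.
  pose proof (HEDm l0) as [_ [HKm [Ham _]]]. pose proof (HEDp l0) as [_ [HKp [Hap _]]].
  destruct (uniform_proj_bound dist d D2f Hmet Hcomp r0 Hr0 Heq Hbd _ Pm Km am HEDm) as [m [Cm [HCm0 HCm]]].
  destruct (uniform_proj_bound dist d D2f Hmet Hcomp r0 Hr0 Heq Hbd _ Pp Kp ap HEDp) as [m' [Cp [HCp0 HCp]]].
  (* Halfway between the slower dichotomy rate and 1; the loss of rate pays for the perturbation. *)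
  set (b := (1 + Rmax am ap) / 2).
  assert (Hbm : am < b) by (unfold b, Rmax; destruct Rle_dec; lra).
  assert (Hbp : ap < b) by (unfold b, Rmax; destruct Rle_dec; lra).
  assert (Hb1 : b < 1) by (unfold b, Rmax; destruct Rle_dec; lra).
  pose proof (kernel_coef_nonneg Km Cm am b HKm HCm0 ltac:(lra)) as Xm.
  pose proof (kernel_coef_nonneg Kp Cp ap b HKp HCp0 ltac:(lra)) as Xp.
  destruct (small_factor (Km * Cm / am * (2 / (1 - am / b)) + Kp * Cp / ap * (2 / (1 - ap / b)))) as [e [He Hs]]; [lra|].
  (* The projector bounds need room to the right of an index. On the left half this takes [m] more
     steps below [kl]; on the right half every further step stays above [kh]. *)
  set (q := (Z.to_nat kh + Z.to_nat (- kl) + m)%nat).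
  set (C0 := 1 + 2 * (Kp * Cp) + 2 * (Km * Cm)).
  assert (HC0 : 1 <= C0) by (unfold C0; nra).
  assert (Hbq : 0 < b ^ q) by (apply pow_lt; lra).
  (* The halves decay as [b ^ (|z| - q)]; dividing by [b ^ q] expresses this through [|z|]. The
     summand 1 in [C0] covers the centre. *)
  exists e, b, (C0 / b ^ q), q. split; auto. split; [lra|]. split.
  { unfold Rdiv; apply Rmult_le_pos; [lra|]. apply Rlt_le, Rinv_0_lt_compat; auto. }
  intros l N phi HN [Hsup [Hpert [HL HR]]] mu Hmu z Hz.
  assert (Hmu0 : 0 <= mu) by (eapply Rle_trans; [apply vnorm_nonneg|apply (Hmu 0%Z); lia]).
  assert (Hfin : forall i, (Z.abs_nat z = q + i)%nat -> vnorm d (phi z) <= C0 * b ^ i * mu ->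
    vnorm d (phi z) <= C0 / b ^ q * b ^ Z.abs_nat z * mu).
  { intros i Hi H. rewrite Hi, pow_add. replace (C0 / b ^ q * (b ^ q * b ^ i) * mu) with (C0 * b ^ i * mu) by (field; lra). exact H. }
  destruct (Nat.le_gt_cases (Z.abs_nat z) q) as [Hzq|Hzq].
  - eapply Rle_trans; [now apply Hmu|].
    assert (1 <= C0 / b ^ q * b ^ Z.abs_nat z).
    { assert (b ^ q <= b ^ Z.abs_nat z).
      { replace q with (Z.abs_nat z + (q - Z.abs_nat z))%nat by lia. rewrite pow_add.
        pose proof (pow_le_1 b (q - Z.abs_nat z) ltac:(lra)). pose proof (pow_lt b (Z.abs_nat z) ltac:(lra)). nra. }
      apply (Rmult_le_reg_r (b ^ q)); auto. replace (C0 / b ^ q * b ^ Z.abs_nat z * b ^ q) with (C0 * b ^ Z.abs_nat z) by (field; lra).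
      nra. }
    nra.
  - set (n := (N - q)%nat). destruct (Z.le_ge_cases 0 z) as [Hz0|Hz0].
    + assert (HI : forall i, (i <= n)%nat -> Zge kh (Z.of_nat q + Z.of_nat i)%Z) by (intros i Hi; unfold Zge, q; lia).
      pose proof (edw_of_ED _ _ _ _ _ _ (Z.of_nat q) n (HEDp l) HI) as E.
      assert (HB : forall i, (i <= n)%nat -> forall j, (j <= m')%nat -> Zge kh (Z.of_nat q + Z.of_nat i + Z.of_nat j)%Z)
        by (intros i Hi j Hj; unfold Zge, q; lia).
      apply (Hfin (Z.abs_nat z - q)%nat); [lia|]. set (i := (Z.abs_nat z - q)%nat).
      assert (Ez : z = (Z.of_nat q + Z.of_nat i)%Z) by (unfold i; lia).
      assert (En : (Z.of_nat q + Z.of_nat n = Z.of_nat N)%Z) by (unfold n; lia).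
      pose proof (decay_forward d _ _ Kp ap b Cp e n (fun i => phi (Z.of_nat q + Z.of_nat i)%Z) E HCp0) as Hd.
      assert (Hres : vnorm d (phi (Z.of_nat q + Z.of_nat i)%Z) <= 2 * (Kp * Cp) * b ^ i * vnorm d (phi (Z.of_nat q + Z.of_nat 0)%Z)).
      { apply Hd; auto.
        - intros j x Hj; apply HCp; auto.
        - intros j x Hj Hx; apply HCp; auto.
        - lra.
        - lra.
        - assert (0 <= Km * Cm / am * (2 / (1 - am / b)) * e) by (apply Rmult_le_pos; lra). lra.
        - intros j Hj. replace (Z.of_nat q + Z.of_nat (S j))%Z with (Z.of_nat q + Z.of_nat j + 1)%Z by lia.
          apply Hpert; unfold n in Hj; lia.
        - rewrite En; auto.
        - unfold i, n; lia. }
      rewrite <- Ez in Hres. eapply Rle_trans; [apply Hres|].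
      assert (vnorm d (phi (Z.of_nat q + Z.of_nat 0)%Z) <= mu) by (apply Hmu; lia).
      pose proof (vnorm_nonneg d (phi (Z.of_nat q + Z.of_nat 0)%Z)).
      assert (0 < b ^ i) by (apply pow_lt; lra). assert (2 * (Kp * Cp) <= C0) by (unfold C0; nra).
      assert (0 <= 2 * (Kp * Cp)) by nra.
      apply Rmult_le_compat; auto; [apply Rmult_le_pos; lra|]. apply Rmult_le_compat_r; lra.
    + set (a := (- Z.of_nat N)%Z).
      assert (HI : forall i, (i <= n)%nat -> Zle kl (a + Z.of_nat i)%Z) by (intros i Hi; unfold Zle, q, n, a in *; lia).
      pose proof (edw_of_ED _ _ _ _ _ _ a n (HEDm l) HI) as E.
      assert (HB : forall i, (i <= n)%nat -> forall j, (j <= m)%nat -> Zle kl (a + Z.of_nat i + Z.of_nat j)%Z)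
        by (intros i Hi j Hj; unfold Zle, n, q, a in *; lia).
      apply (Hfin (Z.abs_nat z - q)%nat); [lia|]. set (i := (Z.abs_nat z - q)%nat).
      assert (Hin : (i <= n)%nat) by (unfold i, n; lia).
      assert (Ez : z = (a + Z.of_nat (n - i))%Z) by (unfold i, n, a in *; lia).
      pose proof (decay_backward d _ _ Km am b Cm e n (fun i => phi (a + Z.of_nat i)%Z) E HCm0) as Hd.
      cbv beta in Hd.
      assert (Hres : vnorm d (phi (a + Z.of_nat (n - i))%Z) <= 2 * (Km * Cm) * b ^ i * vnorm d (phi (a + Z.of_nat n)%Z)).
      { apply Hd; auto.
        - intros j x Hj; apply HCm; auto.
        - intros j x Hj Hx; apply HCm; auto.
        - lra.
        - lra.
        - assert (0 <= Kp * Cp / ap * (2 / (1 - ap / b)) * e) by (apply Rmult_le_pos; lra). lra.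
        - intros j Hj. replace (a + Z.of_nat (S j))%Z with (a + Z.of_nat j + 1)%Z by lia.
          apply Hpert; unfold n, a in *; lia.
        - replace (a + Z.of_nat 0)%Z with (- Z.of_nat N)%Z by (unfold a; lia). auto. }
      rewrite <- Ez in Hres. eapply Rle_trans; [apply Hres|].
      assert (vnorm d (phi (a + Z.of_nat n)%Z) <= mu) by (apply Hmu; unfold a, n; lia).
      pose proof (vnorm_nonneg d (phi (a + Z.of_nat n)%Z)).
      assert (0 < b ^ i) by (apply pow_lt; lra). assert (2 * (Km * Cm) <= C0) by (unfold C0; nra).
      assert (0 <= 2 * (Km * Cm)) by nra.
      apply Rmult_le_compat; auto; [apply Rmult_le_pos; lra|]. apply Rmult_le_compat_r; lra.
Qed.

(** By uniqueness, [ker P-] and [im P+] lie in the kernel and the image of the projector of the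
    dichotomy on [Z]. The boundary conditions are therefore homogeneous for that dichotomy, and
    [window_trivial] applies with a tolerance independent of [N]. *)
Lemma window_rigid (l0 : L) : has_ED d (A l0) Zall -> exists e, 0 < e /\
  forall N phi, (kh <= Z.of_nat N)%Z -> (- Z.of_nat N <= kl)%Z -> window_orbit d A Pm Pp e N l0 phi ->
  forall z, (- Z.of_nat N <= z <= Z.of_nat N)%Z -> vnorm d (phi z) = 0.
Proof.
  intros [P [K [al HED]]]. pose proof HED as [_ [HK [Hal _]]].
  destruct (ED_proj_bound _ _ _ _ _ _ HED) as [C [HC0 HC]].
  set (b := (1 + al) / 2).
  pose proof (kernel_coef_nonneg K (1 + C) al b HK ltac:(lra) ltac:(unfold b; lra)) as X.
  destruct (small_factor _ X) as [e [He Hs]]. exists e; split; auto.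
  intros N phi Hkh Hkl [Hsup [Hpert [HL HR]]] z Hz.
  set (a := (- Z.of_nat N)%Z). set (n := (2 * N)%nat).
  pose proof (edw_of_ED _ _ _ _ _ _ a n HED ltac:(intros; exact Logic.I)) as E.
  assert (En : (a + Z.of_nat n = Z.of_nat N)%Z) by (unfold a, n; lia).
  assert (E0 : (a + Z.of_nat 0 = a)%Z) by lia.
  pose proof (window_trivial d _ _ K al b (1 + C) e n (fun i => phi (a + Z.of_nat i)%Z) E ltac:(lra)) as Ht.
  cbv beta in Ht. replace z with (a + Z.of_nat (Z.to_nat (z - a)))%Z by lia. apply Ht.
  - intros i x Hi. specialize (HC (a + Z.of_nat i)%Z x Logic.I). pose proof (vnorm_nonneg d x). lra.
  - intros i x Hi Hx. eapply Rle_trans; [apply vnorm_sub_le|].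
    specialize (HC (a + Z.of_nat i)%Z x Logic.I). lra.
  - unfold b; lra.
  - lra.
  - lra.
  - auto.
  - intros i Hi. replace (a + Z.of_nat (S i))%Z with (a + Z.of_nat i + 1)%Z by lia.
    apply Hpert. unfold a, n in *; lia.
  - rewrite E0. apply (ED_kernel_unique d (A l0) kl (Pm l0) P Km am K al); auto.
    apply (ED_sub d _ Zall); auto. intros; exact Logic.I.
  - rewrite En. apply (ED_image_unique d (A l0) kh (Pp l0) P Kp ap K al); auto.
    apply (ED_sub d _ Zall); auto. intros; exact Logic.I.
  - unfold n, a; lia.
Qed.

(* If the truncated problems had zeros of norm [eta] on arbitrarily long windows, then by
   compactness a subsequence would converge to a nonzero homoclinic solution. *)
Lemma window_nonvanishing (e b C eta : R) (q N1 : nat) :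
  0 < b < 1 -> 0 <= C -> 0 < eta -> decay_property d A Pm Pp e b C q ->
  (forall n, contf_on dist d (whole_space d) (f n)) ->
  (forall l phi, ell0 d phi -> (forall n, vnorm d (phi n) <= eta) ->
     (forall n, eqv d (phi (n + 1)%Z) (f n l (phi n))) -> forall n, eqv d (phi n) zerov) ->
  exists N, (N1 <= N)%nat /\ forall l phi, window_orbit d A Pm Pp e N l phi ->
    (forall z, (- Z.of_nat N <= z < Z.of_nat N)%Z -> eqv d (phi (z + 1)%Z) (f z l (phi z))) ->
    sumn (2 * N + 1) (fun i => vnorm d (phi (- Z.of_nat N + Z.of_nat i)%Z) ^ 2) <> eta ^ 2.
Proof.
  intros Hb HC Heta Hdec Hcont Hno. apply NNPP; intros Hn.
  assert (Hseq : forall k : nat, exists p : L * (Z -> vec),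
    window_orbit d A Pm Pp e (N1 + q + k) (fst p) (snd p) /\
    (forall z, (- Z.of_nat (N1 + q + k) <= z < Z.of_nat (N1 + q + k))%Z ->
       eqv d (snd p (z + 1)%Z) (f z (fst p) (snd p z))) /\
    sumn (2 * (N1 + q + k) + 1) (fun i => vnorm d (snd p (- Z.of_nat (N1 + q + k) + Z.of_nat i)%Z) ^ 2) = eta ^ 2).
  { intros k; apply NNPP; intros Hk; apply Hn. exists (N1 + q + k)%nat; split; [lia|].
    intros l phi H1 H2 H3; apply Hk; exists (l, phi); auto. }
  apply functional_choice in Hseq; destruct Hseq as [s Hs].
  set (NN := fun k => (N1 + q + k)%nat).
  (* Each zero is continued by 0 outside its window, which keeps the bounds; the equation is only
     used inside, and the windows eventually contain any given time. *)
  set (x := fun k z => if Nat.leb (Z.abs_nat z) (NN k) then snd (s k) z else zerov).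
  assert (Hx : forall k z, (Z.abs_nat z <= NN k)%nat -> x k z = snd (s k) z).
  { intros k z Hz; unfold x; now rewrite (proj2 (Nat.leb_le _ _)). }
  assert (Hxs : forall k z, supp d (x k z)).
  { intros k z; unfold x; destruct Nat.leb; [apply (Hs k)|apply supp_zerov]. }
  assert (Hxn : forall k z, vnorm d (x k z) <= eta).
  { intros k z; unfold x; destruct (Nat.leb_spec (Z.abs_nat z) (NN k)) as [Hz|Hz]; [|rewrite vnorm_zero; lra].
    apply Rle_of_sqr; [lra|]. rewrite <- (proj2 (proj2 (Hs k))). fold (NN k).
    eapply Rle_trans; [|apply (sumn_term_le _ (Z.to_nat (z + Z.of_nat (NN k)))); [intros; apply pow2_ge_0|lia]].
    right; f_equal; f_equal; f_equal. lia. }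
  assert (Hxd : forall k mu, (forall z, (Z.abs_nat z <= q)%nat -> vnorm d (x k z) <= mu) ->
    forall z, vnorm d (x k z) <= C * b ^ Z.abs_nat z * mu).
  { intros k mu Hmu z. assert (Hmu0 : 0 <= mu) by (eapply Rle_trans; [apply vnorm_nonneg|apply (Hmu 0%Z); lia]).
    destruct (Nat.le_gt_cases (Z.abs_nat z) (NN k)) as [Hz|Hz].
    - rewrite Hx by auto. apply (Hdec (fst (s k)) (NN k)); auto.
      + unfold NN; lia.
      + apply Hs.
      + intros z' Hz'. rewrite <- Hx by (unfold NN; lia). auto.
    - unfold x; rewrite (proj2 (Nat.leb_gt _ _)), vnorm_zero by auto.
      apply Rmult_le_pos; auto. apply Rmult_le_pos; auto. apply pow_le; lra. }
  destruct (compact_cluster dist Hmet (fun k => fst (s k)) Hcomp) as [ls Hls].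
  (* The parameters are made to converge before a cluster point of the sequences is taken, so that
     both limits are reached along the same indices. *)
  assert (Hsub : forall j : nat, exists k, (j <= k)%nat /\ dist ls (fst (s k)) < / (INR j + 1)).
  { intros j; apply Hls, Rinv_0_lt_compat. pose proof (pos_INR j); lra. }
  apply functional_choice in Hsub; destruct Hsub as [sg Hsg].
  destruct (biseq_cluster d eta (fun j => x (sg j))) as [psi [Hpsi Hcl]]; auto.
  assert (Hpd : forall z, vnorm d (psi z) <= C * b ^ Z.abs_nat z * eta).
  { intros z; apply le_epsilon; intros ep Hep.
    destruct (Hcl (Z.abs_nat z) ep 0%nat Hep) as [k [_ Hk]]. specialize (Hk z (le_n _)).
    pose proof (Hxd (sg k) eta (fun z _ => Hxn (sg k) z) z).
    pose proof (vnorm_triang_sub d (psi z) (x (sg k) z)) as Ht. rewrite (vnorm_sub_sym d (psi z)) in Ht. lra. }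
  assert (Hpn : forall z, vnorm d (psi z) <= eta).
  { intros z; apply le_epsilon; intros ep Hep.
    destruct (Hcl (Z.abs_nat z) ep 0%nat Hep) as [k [_ Hk]]. specialize (Hk z (le_n _)).
    specialize (Hxn (sg k) z).
    pose proof (vnorm_triang_sub d (psi z) (x (sg k) z)) as Ht. rewrite (vnorm_sub_sym d (psi z)) in Ht. lra. }
  assert (Hell : ell0 d psi).
  { split; auto. intros ep Hep.
    assert (HX : 0 < ep / (C * eta + 1)) by (apply Rdiv_lt_0_compat; nra).
    destruct (pow_lt_1_zero b) with (y := ep / (C * eta + 1)) as [M HM]; [rewrite Rabs_pos_eq; lra|auto|].
    exists (Z.of_nat M). intros z Hz. specialize (HM (Z.abs_nat z) ltac:(lia)).
    rewrite Rabs_pos_eq in HM by (apply pow_le; lra). eapply Rle_lt_trans; [apply Hpd|].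
    apply (Rmult_lt_compat_l (C * eta + 1)) in HM; [|nra].
    replace ((C * eta + 1) * (ep / (C * eta + 1))) with ep in HM by (field; nra).
    assert (0 <= b ^ Z.abs_nat z) by (apply pow_le; lra). nra. }
  assert (Hsol : forall z, eqv d (psi (z + 1)%Z) (f z ls (psi z))).
  { intros z. assert (Hz0 : vnorm d (vsub (psi (z + 1)%Z) (f z ls (psi z))) = 0).
    2:{ intros i Hi. pose proof (vnorm_zero_eqv _ _ Hz0 i Hi) as Hv. unfold vsub, zerov in Hv; lra. }
    apply Rle_antisym; [|apply vnorm_nonneg]. apply le_epsilon; intros ep Hep. rewrite Rplus_0_l.
    destruct (Hcont z ls (psi z) (Hpsi z) (ep / 2)) as [del [Hdel Hc]]; [lra|].
    destruct (inv_succ_small (del / 2)) as [j0 Hj0]; [lra|].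
    set (Q := (Z.abs_nat z + 1)%nat).
    assert (Hmin : 0 < Rmin (del / 2) (ep / 2)) by (apply Rmin_pos; lra).
    destruct (Hcl Q _ (Nat.max j0 Q) Hmin) as [k [Hk1 Hk2]].
    destruct (Hsg k) as [Hsg1 Hsg2]. specialize (Hj0 k ltac:(lia)).
    assert (Hwin : (Q <= NN (sg k))%nat) by (unfold NN; lia).
    pose proof (Hk2 z ltac:(unfold Q; lia)) as Ha. pose proof (Hk2 (z + 1)%Z ltac:(unfold Q; lia)) as Hb'.
    assert (Heqn : eqv d (x (sg k) (z + 1)%Z) (f z (fst (s (sg k))) (x (sg k) z))).
    { rewrite !Hx by (unfold Q in *; lia). apply (Hs (sg k)). unfold Q, NN in *; lia. }
    assert (Hfc : vnorm d (vsub (f z (fst (s (sg k))) (x (sg k) z)) (f z ls (psi z))) < ep / 2).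
    { apply Hc; [apply Hxs|]. pose proof (Rmin_l (del / 2) (ep / 2)). lra. }
    eapply Rle_trans; [apply (vnorm_sub_triang d _ (x (sg k) (z + 1)%Z))|].
    rewrite (vnorm_sub_sym d (psi (z + 1)%Z)).
    rewrite (vnorm_ext d (vsub (x (sg k) (z + 1)%Z) (f z ls (psi z)))
      (vsub (f z (fst (s (sg k))) (x (sg k) z)) (f z ls (psi z)))).
    - pose proof (Rmin_r (del / 2) (ep / 2)). lra.
    - intros i Hi; unfold vsub; now rewrite Heqn. }
  assert (Hzero : forall z, psi z = zerov).
  { intros z; apply (supp_ext d); auto using supp_zerov. now apply (Hno ls psi). }
  assert (Hgeo : 0 < 2 / (1 - b * b)) by (apply Rdiv_lt_0_compat; nra).
  assert (HG : 0 < C * C * (2 / (1 - b * b)) + 1) by nra.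
  (* Since the limit is 0, some zero has its centre below [tau], so its squared norm is at most
     [tau ^ 2 * G] with [G] the geometric constant; this is less than
     [(tau * (G + 1)) ^ 2 = eta ^ 2]. *)
  set (tau := eta / (C * C * (2 / (1 - b * b)) + 1)).
  assert (Htau : 0 < tau) by (apply Rdiv_lt_0_compat; auto).
  assert (Htaue : tau * (C * C * (2 / (1 - b * b)) + 1) = eta) by (unfold tau; field; nra).
  destruct (Hcl q tau 0%nat Htau) as [k [_ Hk]].
  assert (Hsmall : forall z, vnorm d (x (sg k) z) <= C * b ^ Z.abs_nat z * tau).
  { apply Hxd. intros z Hz. specialize (Hk z Hz). rewrite Hzero in Hk.
    rewrite (vnorm_ext d _ (x (sg k) z)) in Hk by (intros i _; unfold vsub, zerov; ring). lra. }
  pose proof (proj2 (proj2 (Hs (sg k)))) as Hsum. fold (NN (sg k)) in Hsum. set (N := NN (sg k)) in *.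
  assert (Hle : eta ^ 2 <= C * C * tau ^ 2 * (2 / (1 - b * b))).
  { rewrite <- Hsum.
    eapply Rle_trans; [apply (sumn_le _ _ (fun i => C * C * tau ^ 2 * (b * b) ^ ndist N i))|].
    - intros i Hi. rewrite <- Hx by (unfold N in *; lia).
      specialize (Hsmall (- Z.of_nat N + Z.of_nat i)%Z).
      replace (Z.abs_nat (- Z.of_nat N + Z.of_nat i)) with (ndist N i) in Hsmall by (unfold ndist; lia).
      pose proof (vnorm_nonneg d (x (sg k) (- Z.of_nat N + Z.of_nat i)%Z)).
      rewrite Rpow_mult_distr.
      replace (C * C * tau ^ 2 * (b ^ ndist N i * b ^ ndist N i)) with ((C * b ^ ndist N i * tau) ^ 2) by ring.
      apply pow_incr; auto.
    - rewrite sumn_scal. apply Rmult_le_compat_l; [|apply two_sided_geometric; nra]. nra. }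
  set (G := C * C * (2 / (1 - b * b))) in *.
  assert (HG0 : 0 <= G) by (unfold G; nra).
  assert (eta ^ 2 <= tau ^ 2 * G) by (unfold G; lra).
  rewrite <- Htaue in H. nra.
Qed.
End Nonvanishing.

(** * Reduction to K-theory *)

Lemma nrm_vscal (n : nat) (c : R) (v : vec) : 0 < c -> nrm n (vscal c v) = nrm n v.
Proof.
  intros Hc; unfold nrm. rewrite vnorm_scal, Rabs_pos_eq by lra.
  destruct (Req_dec (vnorm n v) 0) as [E|E].
  - rewrite E, Rmult_0_r, Rinv_0. extensionality i; unfold vscal; ring.
  - extensionality i; unfold vscal; field; split; lra.
Qed.

(** Unit vectors with images tending to 0 would cluster at a unit vector in the kernel; homogeneity
    extends the bound from the sphere. *)
Lemma injective_lower_bound (n m : nat) (t : vec -> vec) :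
  (forall c v, supp n v -> t (vscal c v) = vscal c (t v)) ->
  contD (dV n) (dV m) (supp n) t ->
  (forall v, supp n v -> vnorm m (t v) = 0 -> vnorm n v = 0) ->
  exists c, 0 < c /\ forall v, supp n v -> c * vnorm n v <= vnorm m (t v).
Proof.
  intros Hs Hc Hinj.
  assert (H : exists c, 0 < c /\ forall v, usphere n v -> c <= vnorm m (t v)).
  { apply NNPP; intros Hn.
    assert (Hk : forall k : nat, exists v, usphere n v /\ vnorm m (t v) < / (INR k + 1)).
    { intros k; apply NNPP; intros H; apply Hn; exists (/ (INR k + 1)); split.
      - apply Rinv_0_lt_compat; pose proof (pos_INR k); lra.
      - intros v Hv; apply Rnot_lt_le; intros Hlt; apply H; now exists v. }
    apply functional_choice in Hk; destruct Hk as [x Hx].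
    destruct (sphere_cluster n x) as [y [[Hy1 Hy2] Hy]]; [intros; apply Hx|].
    assert (Hz : vnorm m (t y) = 0).
    { apply Rle_antisym; [|apply vnorm_nonneg]. apply le_epsilon; intros ep Hep.
      destruct (Hc y Hy1 (ep / 2)) as [del [Hd Hdel]]; [lra|].
      destruct (inv_succ_small (ep / 2)) as [k0 Hk0]; [lra|].
      destruct (Hy del k0 Hd) as [k [Hk1 Hk2]]. destruct (Hx k) as [[Hxs _] Hxt].
      specialize (Hk0 k Hk1). specialize (Hdel (x k) Hxs Hk2). unfold dV in Hdel.
      pose proof (vnorm_triang_sub m (t y) (t (x k))) as Ht. rewrite vnorm_sub_sym in Ht. lra. }
    rewrite (Hinj y Hy1 Hz) in Hy2. lra. }
  destruct H as [c [Hc0 H]]; exists c; split; auto. intros v Hv.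
  destruct (Req_dec (vnorm n v) 0) as [E|E]; [rewrite E, Rmult_0_r; apply vnorm_nonneg|].
  assert (Hp : 0 < vnorm n v) by (pose proof (vnorm_nonneg n v); lra).
  specialize (H (nrm n v) (conj (supp_vscal n _ v Hv) (vnorm_nrm n v E))).
  unfold nrm in H. rewrite Hs, vnorm_scal, Rabs_pos_eq in H by (auto; apply Rlt_le, Rinv_0_lt_compat; auto).
  apply (Rmult_le_compat_r (vnorm n v)) in H; [|lra].
  replace (/ vnorm n v * vnorm m (t v) * vnorm n v) with (vnorm m (t v)) in H by (field; auto). lra.
Qed.

Section Reduction.
Context {L : Type} (dist : L -> L -> R).
Hypothesis Hmet : is_metric dist.

(** The normalized linear map has the normalized linear inverse as its inverse: by positive
    homogeneity the intermediate normalization disappears after the final one, so the composites are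
    equal to the identity. *)
Lemma linear_fibre_equiv (E : bundle L) (M : nat) (t : vec -> vec) (l0 : L) : is_bundle dist E ->
  (forall u v, t (vadd u v) = vadd (t u) (t v)) -> (forall c v, t (vscal c v) = vscal c (t v)) ->
  (forall v, supp M v -> fiber E l0 (t v)) ->
  (forall v, supp M v -> vnorm (bN E) (t v) = 0 -> vnorm M v = 0) ->
  (forall w, fiber E l0 w -> exists v, supp M v /\ t v = w) ->
  has_dim (bN E) (fiber E l0) M /\
  fheq dist (eq l0) (sphM M) (sobj E) (fun _ v => nrm (bN E) (t v)).
Proof.
  intros HE Ha Hs Hf Hinj Hsurj.
  assert (Ht : clin dist M (bN E) (fun _ => t)).
  { apply clin_of_linear; auto. intros v Hv; eapply fiber_supp; eauto. }
  assert (Hct : contD (dV M) (dV (bN E)) (supp M) t).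
  { apply (clin_contD dist (dV M) (supp M) M (bN E) (fun _ => t) (fun _ => l0) (fun v => v)); auto.
    - apply contD_const, (metric_refl dist Hmet).
    - apply contD_id. }
  destruct (injective_lower_bound M (bN E) t) as [c [Hc Hlow]]; auto.
  (* The fibre over [l0] spread constantly over the base, so that the results on bundles supply the
     linear algebra of a single fibre. *)
  set (F := mkBundle (L := L) (bN E) (fun _ => bQ E l0)).
  assert (HF : is_bundle dist F).
  { destruct HE as [E1 [E2 E3]]; split; [|split]; simpl; auto. intros i j; apply cont_L_const. }
  assert (HFf : forall l w, fiber F l w <-> fiber E l0 w) by reflexivity.
  assert (HM : forall l v, fiber (triv (L := L) M) l v <-> supp M v) by (intros; apply fiber_triv).
  assert (Htf : forall l v, fiber (triv (L := L) M) l v -> fiber F l (t v)) by (intros l v Hv; apply Hf, (HM l v), Hv).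
  assert (Hlow' : forall l v, fiber (triv (L := L) M) l v -> c * vnorm (bN (triv (L := L) M)) v <= vnorm (bN F) (t v)).
  { intros l v Hv; apply Hlow, (HM l v), Hv. }
  assert (Hsurj' : forall l w, fiber F l w -> exists v, fiber (triv (L := L) M) l v /\ t v = w).
  { intros l w Hw; destruct (Hsurj w Hw) as [v [Hv1 Hv2]]; exists v; split; auto. now apply HM. }
  assert (HTM : is_bundle dist (triv (L := L) M)) by apply is_bundle_triv.
  split.
  - destruct (dim_exists _ _ (fiber_subspace E l0)) as [p Hp].
    assert (Hbi : biso dist (triv M) F) by (apply (biso_of_bijection dist (triv M) F (fun _ => t) c); auto).
    assert (E0 : M = p).
    { apply (rank_biso dist (triv M) F l0 M p Hbi); [apply rank_triv|]. intros l; exact Hp. }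
    now rewrite E0.
  - destruct (bijection_inverse dist (triv M) F (fun _ => t) c) as [s [Hs1 [Hs2 Hs3]]]; auto.
    assert (Hsph : forall w, sph E l0 w -> vnorm M (s l0 w) <> 0).
    { intros w [Hw1 Hw2] H0. destruct (Hs3 l0 w Hw1) as [Hv Htw]. apply (HM l0) in Hv.
      assert (Hz : s l0 w = zerov) by (apply (supp_ext M); auto using supp_zerov, vnorm_zero_eqv).
      rewrite Hz in Htw. assert (Ht0 : t zerov = zerov).
      { replace zerov with (vscal 0 zerov) at 1 by (extensionality i; unfold vscal, zerov; ring).
        rewrite Hs. extensionality i; unfold vscal, zerov; ring. }
      rewrite <- Htw, Ht0, vnorm_zero in Hw2. lra. }
    assert (Ht0 : forall v, usphere M v -> vnorm (bN E) (t v) <> 0).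
    { intros v [Hv1 Hv2] H0. rewrite (Hinj v Hv1 H0) in Hv2. lra. }
    assert (Hh : fm dist (eq l0) (sobj E) (sphM M) (fun _ w => nrm M (s l0 w))).
    { split.
      - intros l w <- Hw. destruct (Hs3 l0 w (proj1 Hw)) as [Hv _]. apply (HM l0) in Hv.
        split; [now apply supp_vscal|]. apply vnorm_nrm; auto.
      - assert (Hcs : contD (dP dist (bN E)) (dV M) (fdom (eq l0) (sobj E)) (fun p => s l0 (snd p))).
        { apply (clin_contD dist (dP dist (bN E)) _ (bN E) M s (fun _ => l0) snd Hs1).
          - apply contD_const, (metric_refl dist Hmet).
          - apply (contP_v dist Hmet).
          - intros x [_ Hx]. exact (fiber_supp _ _ _ (proj1 Hx)). }
        apply contD_vscal; auto. apply contD_inv; [now apply contD_vnorm|].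
        intros [l w] [Hl Hw]; simpl in *; subst l. now apply Hsph. }
    assert (Hg : fm dist (eq l0) (sphM M) (sobj E) (fun _ v => nrm (bN E) (t v))).
    { apply fm_nrm.
      - apply (clin_contD dist (dP dist M) _ M (bN E) (fun _ => t) fst snd Ht).
        + apply contP_l.
        + apply (contP_v dist Hmet).
        + intros x [_ Hx]; apply Hx.
      - intros l v <- Hv; split; [apply Hf, Hv|now apply Ht0]. }
    split; auto. exists (fun _ w => nrm M (s l0 w)). split; [split; auto|].
    + apply (hmt_ext dist (eq l0) (sphM M) (sphM M) (fun _ v => v) (fun _ v => v)).
      * intros l v <- [Hv1 Hv2]. unfold nrm at 2.
        destruct Hs1 as [_ [Hsc _]]. rewrite Hsc by (apply (fiber_supp E l0), Hf; auto).
        rewrite nrm_vscal by (apply Rinv_0_lt_compat; pose proof (vnorm_nonneg (bN E) (t v)); pose proof (Ht0 v (conj Hv1 Hv2)); lra).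
        rewrite Hs2 by now apply (HM l0). symmetry; now apply nrm_unit.
      * auto.
      * apply hmt_refl; auto. now apply fm_id.
    + apply (hmt_ext dist (eq l0) (sobj E) (sobj E) (fun _ w => w) (fun _ w => w)).
      * intros l w <- Hw. unfold nrm at 2. rewrite Hs, nrm_vscal.
        -- destruct (Hs3 l0 w (proj1 Hw)) as [_ ->]. symmetry; apply nrm_unit, Hw.
        -- apply Rinv_0_lt_compat. pose proof (vnorm_nonneg M (s l0 w)). pose proof (Hsph w Hw). lra.
      * auto.
      * apply hmt_refl; auto. now apply fm_id.
Qed.

Lemma fhe_of_fheq (X Y : fsp L) (E F : bundle L) g : bN E = fdim X -> bN F = fdim Y ->
  (forall l v, fset X l v <-> sph E l v) -> (forall l v, fset Y l v <-> sph F l v) ->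
  fheq dist (fun _ => True) X Y g -> fhe dist E F.
Proof.
  intros EX EY HX HY [[Hg1 Hg2] [h [[[Hh1 Hh2] [G [[HG1 HG2] [HG3 HG4]]]] [G' [[HG1' HG2'] [HG3' HG4']]]]]].
  exists g, h. split; [|split; [|split; [|split; [|split]]]].
  - intros l v Hv; apply HY, Hg1; auto; now apply HX.
  - intros l v Hv; apply HX, Hh1; auto; now apply HY.
  - intros l v Hv eps He. rewrite EX, EY.
    destruct (Hg2 (l, v) (conj Logic.I (proj2 (HX l v) Hv)) eps He) as [del [Hd H]].
    exists del; split; auto. intros l' v' Hv' Hlt.
    apply (H (l', v') (conj Logic.I (proj2 (HX l' v') Hv'))). exact Hlt.
  - intros l v Hv eps He. rewrite EX, EY.
    destruct (Hh2 (l, v) (conj Logic.I (proj2 (HY l v) Hv)) eps He) as [del [Hd H]].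
    exists del; split; auto. intros l' v' Hv' Hlt.
    apply (H (l', v') (conj Logic.I (proj2 (HY l' v') Hv'))). exact Hlt.
  - exists G. split; [|split; [|split]].
    + intros t l v Ht Hv; apply HX, HG1; auto; now apply HX.
    + intros t l v Ht Hv eps He. rewrite EX.
      destruct (HG2 (t, (l, v)) (conj Ht (conj Logic.I (proj2 (HX l v) Hv))) eps He) as [del [Hd H]].
      exists del; split; auto. intros t' l' v' Ht' Hv' Hlt.
      apply (H (t', (l', v')) (conj Ht' (conj Logic.I (proj2 (HX l' v') Hv')))).
      unfold dH, dP, dsum, dR, dV; simpl. lra.
    + intros l v Hv i _; rewrite HG3; auto; now apply HX.
    + intros l v Hv i _; rewrite HG4; auto; now apply HX.
  - exists G'. split; [|split; [|split]].
    + intros t l v Ht Hv; apply HY, HG1'; auto; now apply HY.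
    + intros t l v Ht Hv eps He. rewrite EY.
      destruct (HG2' (t, (l, v)) (conj Ht (conj Logic.I (proj2 (HY l v) Hv))) eps He) as [del [Hd H]].
      exists del; split; auto. intros t' l' v' Ht' Hv' Hlt.
      apply (H (t', (l', v')) (conj Ht' (conj Logic.I (proj2 (HY l' v') Hv')))).
      unfold dH, dP, dsum, dR, dV; simpl. lra.
    + intros l v Hv i _; rewrite HG3'; auto; now apply HY.
    + intros l v Hv i _; rewrite HG4'; auto; now apply HY.
Qed.

Lemma sph_triv0 (E : bundle L) l v : sph E l v <-> sph (bsum E (triv 0)) l v.
Proof.
  unfold sph. simpl (bN (bsum E (triv 0))). rewrite Nat.add_0_r, fiber_bsum_triv0. reflexivity.
Qed.

Lemma stably_fhe_of_fheq (M : nat) (E : bundle L) g :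
  fheq dist (fun _ => True) (sphM M) (sobj E) g -> stably_fhe dist (triv M) E.
Proof.
  intros H; exists 0%nat, 0%nat. eapply fhe_of_fheq; [| | | |exact H]; simpl; auto.
  - intros l v. rewrite <- sph_triv0. unfold sph; rewrite fiber_triv. reflexivity.
  - intros l v; apply sph_triv0.
Qed.

(** Nested sums are flattened to lists, which turns rearrangements of summands into permutations. *)
Lemma biso_flat (A B : bundle L) l1 l2 :
  biso dist A (bsums l1) -> biso dist B (bsums l2) -> biso dist (bsum A B) (bsums (l1 ++ l2)).
Proof.
  intros H1 H2; eapply biso_trans; [apply (biso_bsum dist A (bsums l1) B (bsums l2)); auto|].
  apply bsums_app.
Qed.

Lemma biso_atom (A : bundle L) : biso dist A (bsums (A :: nil)).
Proof. apply biso_sym, biso_triv0_r. Qed.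

(** Both sides reduce to [Q]: on the left [Ip + Kp'] and [Im' + Km] are trivial, on the right
    [Im + Km] is, and [triv (d + e)] splits. Adding [Km] is what allows [Im'] to be compared with
    [Im] without an isomorphism between them. *)
Lemma ko_identity (d e : nat) (Ip Kp Kp' Im Km Im' Km' T : bundle L) :
  biso dist Kp' Kp -> biso dist Km' Km -> biso dist (bsum Ip Kp) (triv d) ->
  biso dist (bsum Im Km) (triv d) -> biso dist (bsum Im' Km') (triv d) ->
  biso dist (bsum (bsum (bsum Ip T) (bsum (bsum (triv e) (bsum Im' Kp')) (triv 0))) Km)
            (bsum (bsum (bsum (triv (d + e)) (triv 0)) (bsum Im T)) Km).
Proof.
  intros HKp HKm Hp Hm Hm'.
  set (C := bsums (T :: triv 0 :: nil)). set (Q := bsum (triv d) (bsum (triv d) (bsum (triv e) C))).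
  apply (biso_trans dist _ Q).
  - eapply biso_trans; [repeat apply biso_flat; apply biso_atom|]. simpl app.
    eapply biso_trans; [apply (bsums_perm dist _ (Ip :: Kp' :: Im' :: Km :: triv e :: T :: triv 0 :: nil))|].
    + apply perm_skip. apply Permutation_sym.
      apply Permutation_trans with (Im' :: Kp' :: Km :: triv e :: T :: triv 0 :: nil); [apply perm_swap|].
      apply Permutation_sym.
      change (Permutation ((T :: triv e :: nil) ++ (Im' :: Kp' :: triv 0 :: Km :: nil))
        (Im' :: Kp' :: Km :: triv e :: T :: triv 0 :: nil)).
      eapply Permutation_trans; [apply Permutation_app_comm|]. simpl. do 2 apply perm_skip.
      eapply Permutation_trans; [apply perm_swap|]. apply perm_skip.
      eapply Permutation_trans; [|apply perm_swap].
      change (Permutation ((triv 0 :: nil) ++ (T :: triv e :: nil)) ((T :: triv e :: nil) ++ (triv 0 :: nil))).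
      apply Permutation_app_comm.
    + simpl bsums. fold C.
      eapply biso_trans; [apply biso_sym, biso_assoc|]. apply biso_bsum.
      * eapply biso_trans; [|exact Hp]. apply biso_bsum; auto using biso_refl.
      * eapply biso_trans; [apply biso_sym, biso_assoc|]. apply biso_bsum; [|apply biso_refl].
        eapply biso_trans; [|exact Hm']. apply biso_bsum; auto using biso_refl, biso_sym.
  - apply biso_sym. eapply biso_trans; [repeat apply biso_flat; apply biso_atom|]. simpl app.
    eapply biso_trans; [apply (bsums_perm dist _ (Im :: Km :: triv (d + e) :: T :: triv 0 :: nil))|].
    + change (Permutation ((triv (d + e) :: triv 0 :: nil) ++ (Im :: T :: Km :: nil)) (Im :: Km :: triv (d + e) :: T :: triv 0 :: nil)).
      eapply Permutation_trans; [apply Permutation_app_comm|]. simpl. apply perm_skip.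
      eapply Permutation_trans; [apply perm_swap|]. apply perm_skip. apply perm_swap.
    + simpl bsums. fold C. eapply biso_trans; [apply biso_sym, biso_assoc|].
      eapply biso_trans; [apply biso_bsum; [exact Hm|]|].
      * apply biso_bsum; [|apply biso_refl]. apply biso_sym, biso_triv_add.
      * apply biso_bsum; [apply biso_refl|apply biso_assoc].
Qed.
End Reduction.

(** * Bifurcation *)

(** Block [i] is the value at time [i - N]; outside the window the sequence is continued by 0. *)
Definition zext (d N : nat) (v : vec) (z : Z) : vec :=
  if Nat.leb (Z.abs_nat z) N then blk d v (Z.to_nat (z + Z.of_nat N)) else zerov.

Lemma zext_at d N v i : (i <= 2 * N)%nat -> zext d N v (- Z.of_nat N + Z.of_nat i)%Z = blk d v i.
Proof.
  intros Hi; unfold zext. rewrite (proj2 (Nat.leb_le _ _)) by lia. f_equal; lia.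
Qed.

Lemma supp_zext d N v z : supp d (zext d N v z).
Proof. unfold zext; destruct Nat.leb; [apply supp_blk|apply supp_zerov]. Qed.

Lemma wmap_zero_orbit {L : Type} (d : nat) (A Pm Pp : L -> Z -> mat) (e : R) (N : nat) (l : L)
  (F : nat -> vec -> vec) (v : vec) :
  (forall i, (i < 2 * N)%nat ->
     vnorm d (vsub (F i (blk d v i)) (mv d (A l (- Z.of_nat N + Z.of_nat i)%Z) (blk d v i))) <= e * vnorm d (blk d v i)) ->
  vnorm (2 * N * d + (d + d)) (wmap d (2 * N) F (Pm l (- Z.of_nat N)%Z) (Pp l (Z.of_nat N)) v) = 0 ->
  window_orbit d A Pm Pp e N l (zext d N v) /\
  forall i, (i < 2 * N)%nat -> eqv d (blk d v (S i)) (F i (blk d v i)).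
Proof.
  intros HF H0. apply vnorm_zero_eqv, wmap_eq_zero in H0. destruct H0 as [H1 [H2 H3]].
  split; auto. split; [apply supp_zext|]. split; [|split].
  - intros z Hz. set (i := Z.to_nat (z + Z.of_nat N)).
    assert (Ez : z = (- Z.of_nat N + Z.of_nat i)%Z) by (unfold i; lia).
    assert (Hi : (i < 2 * N)%nat) by (unfold i; lia).
    rewrite Ez. replace (- Z.of_nat N + Z.of_nat i + 1)%Z with (- Z.of_nat N + Z.of_nat (S i))%Z by lia.
    rewrite !zext_at by lia.
    rewrite (vnorm_ext d _ (vsub (F i (blk d v i)) (mv d (A l (- Z.of_nat N + Z.of_nat i)%Z) (blk d v i)))); auto.
    intros j Hj; unfold vsub; now rewrite (H1 i Hi j Hj).
  - replace (- Z.of_nat N)%Z with (- Z.of_nat N + Z.of_nat 0)%Z at 2 by lia. now rewrite zext_at by lia.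
  - replace (zext d N v (Z.of_nat N)) with (blk d v (2 * N)); auto.
    rewrite <- (zext_at d N) by lia. f_equal; lia.
Qed.

Lemma clin_mv {L : Type} (dist : L -> L -> R) d (B : L -> mat) :
  (forall i j, (i < d)%nat -> (j < d)%nat -> cont_L dist (fun l => B l i j)) ->
  clin dist d d (fun l v => mv d (B l) v).
Proof.
  intros HB; split; [|split; [|split]].
  - intros; apply mv_vadd.
  - intros; apply mv_vscal.
  - intros; apply supp_mv.
  - intros g Hg Hc. apply contD_mvr; auto. intros; apply cont_L_contD; auto.
Qed.

(** The flow maps the kernels isomorphically: invariance keeps it inside them, the unstable estimate
    bounds it below, and regularity makes it onto. *)
Lemma ker_transport {L : Type} (dist : L -> L -> R) d (B : L -> Z -> mat) (I : Z -> Prop) (P : L -> Z -> mat) K al (l0 : L) n (m : nat) :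
  is_metric dist ->
  (forall z i j, (i < d)%nat -> (j < d)%nat -> cont_L dist (fun l => B l z i j)) ->
  (forall z, I z -> forall i j, (i < d)%nat -> (j < d)%nat -> cont_L dist (fun l => P l z i j)) ->
  (forall l, ED_wrt d (B l) I (P l) K al) -> (forall i, (i <= m)%nat -> I (n + Z.of_nat i)%Z) ->
  biso dist (KER d P n) (KER d P (n + Z.of_nat m)%Z).
Proof.
  intros Hmet HB HP HED HI.
  assert (HE : forall l, edw d (fun i => B l (n + Z.of_nat i)%Z) (fun i => P l (n + Z.of_nat i)%Z) K al m)
    by (intros l; eapply edw_of_ED; eauto).
  assert (En : (n + Z.of_nat 0 = n)%Z) by lia.
  assert (Hn : I n) by (rewrite <- En; apply HI; lia).
  pose proof (edw_K _ _ _ _ _ _ (HE l0)) as HK. pose proof (edw_al _ _ _ _ _ _ (HE l0)) as Hal.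
  assert (HKa : 0 < K * al ^ m) by (pose proof (pow_lt al m (proj1 Hal)); nra).
  assert (Hproj : forall z l, I z -> meq d (mm d (P l z) (P l z)) (P l z)).
  { intros z l Hz. destruct (HED l) as [[[Hp _] _] _]. now apply Hp. }
  assert (Hz : forall z l v, fiber (KER d P z) l v -> supp d v /\ mv d (P l z) v = zerov).
  { intros z l v Hv; apply fiber_KER in Hv; destruct Hv as [H1 H2]; split; auto.
    apply (supp_ext d); auto using supp_mv, supp_zerov. }
  assert (Hz' : forall z l v, supp d v -> mv d (P l z) v = zerov -> fiber (KER d P z) l v).
  { intros z l v H1 H2; apply fiber_KER; split; auto. rewrite H2; intros i _; reflexivity. }
  apply (biso_of_bijection dist (KER d P n) (KER d P (n + Z.of_nat m)%Z)
    (fun l v => fl d (fun i => B l (n + Z.of_nat i)%Z) 0 m v) (/ (K * al ^ m))).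
  - apply is_bundle_KER; auto.
  - apply is_bundle_KER; auto.
  - now apply Rinv_0_lt_compat.
  - simpl bN. clear HI HE HKa. induction m as [|m IH]; simpl; [apply clin_id|].
    apply (clin_comp dist d d d _ (fun l v => mv d (B l (n + Z.of_nat m)%Z) v)); auto. apply clin_mv; intros; now apply HB.
  - intros l v Hv; apply Hz in Hv; destruct Hv as [H1 H2]. apply Hz'; [now apply supp_fl|].
    pose proof (edw_inv_fl d _ _ _ _ _ 0 m v (HE l) ltac:(lia)) as Hinv. cbv beta in Hinv.
    rewrite En, H2 in Hinv. simpl (0 + m)%nat in Hinv. rewrite Hinv.
    clear. induction m as [|m IH]; simpl; auto. now rewrite IH, mv_zerov.
  - intros l v Hv; apply Hz in Hv; destruct Hv as [H1 H2]. simpl bN.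
    apply (Rmult_le_reg_l (K * al ^ m)); auto. rewrite <- Rmult_assoc, Rinv_r, Rmult_1_l by lra.
    apply (edw_unstable _ _ _ _ _ _ (HE l)); auto. now rewrite En.
  - intros l w Hw; apply Hz in Hw; destruct Hw as [H1 H2].
    destruct (edw_backward d _ _ _ _ _ 0 m w (HE l) ltac:(lia) H1 H2) as [z [z1 [z2 [z3 _]]]].
    exists z; split; auto. apply Hz'; auto. now rewrite En in z2.
Qed.

Lemma wmap_ext d n F F' Pl Pr v : (forall i, (i < n)%nat -> eqv d (F i (blk d v i)) (F' i (blk d v i))) ->
  wmap d n F Pl Pr v = wmap d n F' Pl Pr v.
Proof.
  intros H; unfold wmap; f_equal. apply unblk_ext; intros i Hi j Hj; unfold vsub; now rewrite H.
Qed.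

Lemma contD_f {L C : Type} (dist : L -> L -> R) (dC : C -> C -> R) D d (g : L -> vec -> vec) (a : C -> L) (v : C -> vec) :
  contf_on dist d (whole_space d) g -> contD dC dist D a -> contD dC (dV d) D v ->
  (forall c, D c -> supp d (v c)) -> contD dC (dV d) D (fun c => g (a c) (v c)).
Proof.
  intros Hg Ha Hv Hs.
  apply (contD_comp dC (dsum dist (dV d)) (dV d) D (fun p => supp d (snd p)) (fun c => (a c, v c))
    (fun p => g (fst p) (snd p))); auto.
  - now apply contD_pair.
  - intros [l x] Hx eps He. destruct (Hg l x Hx eps He) as [del [Hd H]]. exists del; split; auto.
    intros [l' x'] Hx' Hlt. apply H; auto.
Qed.

(** At the parameter of (F3) the linear truncated problem is injective by rigidity and onto by
    [edw_solve] for the dichotomy on [Z]. This also fixes the rank of the target bundle. *)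
Lemma has_dim_wbundle {L : Type} (dist : L -> L -> R) (d : nat) (A Pm Pp : L -> Z -> mat) (N : nat) (l0 : L) kl kh Km am Kp ap :
  is_metric dist ->
  ED_wrt d (A l0) (Zle kl) (Pm l0) Km am -> ED_wrt d (A l0) (Zge kh) (Pp l0) Kp ap ->
  has_ED d (A l0) Zall -> (kh <= Z.of_nat N)%Z -> (- Z.of_nat N <= kl)%Z ->
  is_bundle dist (wbundle d (2 * N) Pm Pp (- Z.of_nat N) (Z.of_nat N)) ->
  (forall phi, window_orbit d A Pm Pp 0 N l0 phi ->
     forall z, (- Z.of_nat N <= z <= Z.of_nat N)%Z -> vnorm d (phi z) = 0) ->
  let E := wbundle d (2 * N) Pm Pp (- Z.of_nat N) (Z.of_nat N) in
  let M := (S (2 * N) * d)%nat in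
  has_dim (bN E) (fiber E l0) M /\
  fheq dist (eq l0) (sphM M) (sobj E) (fun _ v => nrm (bN E)
    (wmap d (2 * N) (fun i => mv d (A l0 (- Z.of_nat N + Z.of_nat i)%Z)) (Pm l0 (- Z.of_nat N)%Z) (Pp l0 (Z.of_nat N)) v)).
Proof.
  intros Hmet HEDm HEDp [P [K [al HED]]] Hkh Hkl HE Hrig E M.
  set (n := (2 * N)%nat) in *. set (a := (- Z.of_nat N)%Z) in *.
  assert (En : (a + Z.of_nat n = Z.of_nat N)%Z) by (unfold a, n; lia).
  assert (E0 : (a + Z.of_nat 0 = a)%Z) by lia.
  assert (HPm : meq d (mm d (Pm l0 a) (Pm l0 a)) (Pm l0 a)).
  { destruct HEDm as [[[Hp _] _] _]. now apply Hp. }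
  assert (HPp : meq d (mm d (Pp l0 (Z.of_nat N)) (Pp l0 (Z.of_nat N))) (Pp l0 (Z.of_nat N))).
  { destruct HEDp as [[[Hp _] _] _]. now apply Hp. }
  apply linear_fibre_equiv; auto.
  - intros; apply wmap_vadd.
  - intros; apply wmap_vscal.
  - intros v _. now apply wmap_fiber.
  - intros v Hv H0. destruct (wmap_zero_orbit d A Pm Pp 0 N l0 (fun i => mv d (A l0 (a + Z.of_nat i)%Z)) v) as [Ho _]; auto.
    { intros i Hi. rewrite Rmult_0_l. right. rewrite <- (vnorm_zero d); apply vnorm_ext.
      intros j _; unfold vsub, zerov, a; ring. }
    assert (Hz : vnorm M v ^ 2 = 0).
    { unfold M; rewrite vnorm_blk. apply sumn_zero; intros i Hi.
      rewrite <- (zext_at d N v i) by (unfold n in Hi; lia). rewrite (Hrig _ Ho) by (unfold n in Hi; lia). ring. }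
    pose proof (vnorm_nonneg M v). nra.
  - intros w Hw. apply fiber_bsum in Hw. simpl (bN (triv _)) in Hw. destruct Hw as [_ Hw].
    pose proof Hw as Hws. apply fiber_supp in Hws. apply fiber_bsum in Hw. simpl bN in Hw, Hws. destruct Hw as [Hw1 Hw2].
    apply fiber_IM in Hw1. apply fiber_KER in Hw2. destruct Hw2 as [Hw2 Hw3].
    pose proof (edw_of_ED _ _ _ _ _ _ a n HED ltac:(intros; exact Logic.I)) as HW.
    assert (HEDl : ED_wrt d (A l0) (Zle kl) P K al) by (apply (ED_sub d _ Zall); auto; intros; exact Logic.I).
    assert (HEDr : ED_wrt d (A l0) (Zge kh) P K al) by (apply (ED_sub d _ Zall); auto; intros; exact Logic.I).
    destruct (edw_solve d _ _ K al n (Pm l0 a) (Pp l0 (Z.of_nat N)) (blk d (vtrunc (n * d) w))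
      (vtrunc d (vdrop (n * d) w)) (vdrop d (vdrop (n * d) w)) HW) as [phi [Hp1 [Hp2 [Hp3 Hp4]]]].
    + intros x Hx Hk. rewrite E0 in Hk. apply (ED_kernel_unique d (A l0) kl P (Pm l0) K al Km am); auto.
    + intros x Hx. rewrite En in Hx. apply (ED_image_unique d (A l0) kh P (Pp l0) K al Kp ap); auto.
    + exact Hw1.
    + exact Hw2.
    + apply (supp_ext d); auto using supp_mv, supp_zerov.
    + intros; apply supp_blk.
    + exists (unblk d (S n) phi). split; [apply supp_unblk|].
      assert (Hb : forall i, (i <= n)%nat -> blk d (unblk d (S n) phi) i = phi i).
      { intros i Hi. rewrite blk_unblk by lia. apply vtrunc_supp; auto. }
      unfold wmap. rewrite !Hb, Hp3, Hp4, vcat_split by lia.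
      rewrite <- (vcat_split (n * d) w) at 2. f_equal.
      rewrite <- (unblk_blk d n (vtrunc (n * d) w)) by apply supp_vtrunc.
      apply unblk_ext; intros i Hi j _. rewrite !Hb, Hp2 by lia. unfold vsub, vadd. ring.
Qed.

Theorem theorem6p1 (L : Type) (dist : L -> L -> R) (d : nat)
  (f : Z -> L -> vec -> vec) (D2f : Z -> L -> vec -> mat)
  (kl kh : Z) (Pp Pm : L -> Z -> mat) :
  is_metric dist -> mcompact dist -> mpath_connected dist ->
  (* each f_n continuous on L x R^d, with f_n(l,0) = 0 *)
  (forall n, contf_on dist d (whole_space d) (f n)) ->
  (forall n l, eqv d (f n l zerov) zerov) ->
  (* (F0) *)
  (forall n l x, supp d x -> is_deriv d (f n l) x (D2f n l x)) ->
  (forall n, contm_on dist d (whole_space d) (D2f n)) ->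
  (* (F1) *)
  (exists r0, 0 < r0 /\
     equicontf_on dist d (closed_ball d r0) f /\
     equicontm_on dist d (closed_ball d r0) D2f /\
     ptwise_boundedm_on d (closed_ball d r0) D2f) ->
  (* (F2) *)
  (kl < 0)%Z -> (0 < kh)%Z ->
  param_ED dist d (fun l n => D2f n l zerov) (Zge kh) Pp ->
  param_ED dist d (fun l n => D2f n l zerov) (Zle kl) Pm ->
  (* (F3) *)
  (exists l0, has_ED d (fun n => D2f n l0 zerov) Zall) ->
  (* J(IM P+(kh)) <> J(IM P-(kl)) *)
  (forall r s, bundle_rank (IM d Pp kh) r -> bundle_rank (IM d Pm kl) s ->
     ~ J_eq dist (IM d Pp kh) r (IM d Pm kl) s) ->
  exists ls : L, is_bifurcation_point dist d f ls.
Proof.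
  intros Hmet Hcomp Hpath Hcf Hf0 Hder HcD [r0 [Hr0 [_ [HeD HbD]]]] Hkl Hkh
    [HPpc [Kp [ap HEDp]]] [HPmc [Km [am HEDm]]] [l0 HED0] HJ.
  apply NNPP; intros Hnobif.
  set (A := fun (l : L) (n : Z) => D2f n l zerov).
  (* A parameter that is not a bifurcation point has a neighbourhood and a radius without nonzero
     solutions; compactness makes the radius common. *)
  assert (Hno : exists r, 0 < r /\ forall l phi, ell0 d phi -> (forall n, vnorm d (phi n) < r) ->
    (forall n, eqv d (phi (n + 1)%Z) (f n l (phi n))) -> forall n, eqv d (phi n) zerov).
  { apply (compact_uniform dist Hmet (fun r l => forall phi, ell0 d phi -> (forall n, vnorm d (phi n) < r) ->
      (forall n, eqv d (phi (n + 1)%Z) (f n l (phi n))) -> forall n, eqv d (phi n) zerov) Hcomp).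
    - intros r r' l Hr' Hrr H phi H1 H2 H3. apply H; auto. intros n; specialize (H2 n); lra.
    - intros ls. apply NNPP; intros Hc. apply Hnobif; exists ls. intros del Hdel.
      apply NNPP; intros Hc'. apply Hc. exists del, del; split; auto; split; auto.
      intros l Hl phi H1 H2 H3 n i Hi. apply NNPP; intros Hne. apply Hc'. exists l, phi.
      rewrite (metric_sym dist Hmet l ls). repeat split; auto; try apply H1. exists n, i; auto. }
  destruct Hno as [rs [Hrs Hno]].
  destruct (window_decay dist d D2f Hmet Hcomp r0 Hr0 HeD HbD kl kh Pm Pp Km am Kp ap HEDm HEDp l0)
    as [e1 [b [C [q [He1 [Hb [HC Hdec]]]]]]].
  destruct (window_rigid d D2f kl kh Pm Pp Km am Kp ap HEDm HEDp l0 HED0) as [e2 [He2 Hrig]].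
  set (e := Rmin e1 e2). assert (He : 0 < e) by now apply Rmin_pos.
  destruct (remainder_small dist d f D2f Hmet Hcomp Hf0 Hder r0 Hr0 HeD e He) as [eta0 [Heta0 Hrem]].
  (* Below [eta0] the remainder is an [e]-perturbation; the half of [rs] turns the strict bound in
     [Hno] into a non-strict one. *)
  set (eta := Rmin eta0 (rs / 2)).
  assert (Heta : 0 < eta) by (apply Rmin_pos; lra).
  assert (Heta1 : eta <= eta0) by apply Rmin_l.
  assert (Heta2 : eta < rs) by (pose proof (Rmin_r eta0 (rs / 2)); unfold eta; lra).
  assert (Hdec' : decay_property d A Pm Pp e b C q).
  { intros l N phi HN Ho. apply (Hdec l N phi HN). eapply window_orbit_le; [|exact Ho]. apply Rmin_l. }
  (* The lower bound on [N] puts both ends of the window into the half-lines of the dichotomies. *)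
  destruct (window_nonvanishing dist d f D2f Hmet Hcomp Pm Pp e b C eta q (Z.to_nat kh + Z.to_nat (- kl))
    Hb HC Heta Hdec' Hcf) as [N [HN Hnv]].
  { intros l phi H1 H2 H3. apply (Hno l); auto. intros n; specialize (H2 n); lra. }
  set (n := (2 * N)%nat) in *. set (a := (- Z.of_nat N)%Z) in *.
  set (Y := wbundle d n Pm Pp a (Z.of_nat N)). set (M := (S n * d)%nat).
  assert (Ha : Zle kl a) by (unfold Zle, a; lia).
  assert (HNk : Zge kh (Z.of_nat N)) by (unfold Zge; lia).
  assert (HprojP : forall l z, Zge kh z -> meq d (mm d (Pp l z) (Pp l z)) (Pp l z)).
  { intros l z Hz; destruct (HEDp l) as [[[Hp _] _] _]; now apply Hp. }
  assert (HprojM : forall l z, Zle kl z -> meq d (mm d (Pm l z) (Pm l z)) (Pm l z)).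
  { intros l z Hz; destruct (HEDm l) as [[[Hp _] _] _]; now apply Hp. }
  assert (Hkl' : Zle kl kl) by (unfold Zle; lia). assert (Hkh' : Zge kh kh) by (unfold Zge; lia).
  assert (HYb : is_bundle dist Y).
  { apply is_bundle_bsum; [apply is_bundle_triv|apply is_bundle_bsum; [apply is_bundle_IM|apply is_bundle_KER]]; auto. }
  destruct (has_dim_wbundle dist d A Pm Pp N l0 kl kh Km am Kp ap Hmet (HEDm l0) (HEDp l0) HED0 HNk Ha HYb)
    as [Hdim Hlin].
  { intros phi Ho. apply Hrig; [exact HNk|exact Ha|]. eapply window_orbit_le; [|exact Ho]. lra. }
  fold n a Y M in Hdim, Hlin.
  set (W := fun (F : nat -> vec -> vec) l v => wmap d n F (Pm l a) (Pp l (Z.of_nat N)) v).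
  assert (Hsumn : forall v, usphere M v ->
    sumn (n + 1) (fun i => vnorm d (zext d N (vscal eta v) (a + Z.of_nat i)%Z) ^ 2) = eta ^ 2).
  { intros v [Hv1 Hv2]. rewrite Nat.add_1_r.
    rewrite (sumn_ext _ _ (fun i => vnorm d (blk d (vscal eta v) i) ^ 2))
      by (intros i Hi; unfold a; rewrite zext_at by (unfold n in Hi; lia); reflexivity).
    rewrite <- vnorm_blk. fold M. rewrite vnorm_scal, Hv2, Rabs_pos_eq by lra. ring. }
  assert (Hblk : forall v i, usphere M v -> (i < n)%nat -> vnorm d (blk d (vscal eta v) i) <= eta0).
  { intros v i [Hv1 Hv2] Hi. eapply Rle_trans; [apply (vnorm_blk_le d (S n)); lia|].
    fold M. rewrite vnorm_scal, Hv2, Rabs_pos_eq by lra. lra. }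
  assert (Hnz : forall l v, usphere M v ->
    vnorm (bN Y) (W (fun i => f (a + Z.of_nat i)%Z l) l (vscal eta v)) <> 0).
  { intros l v Hv H0.
    destruct (wmap_zero_orbit d A Pm Pp e N l (fun i => f (a + Z.of_nat i)%Z l) (vscal eta v)) as [Ho Hs]; auto.
    { intros i Hi. apply Hrem; [apply supp_blk|]. now apply Hblk. }
    apply (Hnv l _ Ho); [|now apply Hsumn].
    intros z Hz. set (i := Z.to_nat (z + Z.of_nat N)).
    assert (Ez : z = (- Z.of_nat N + Z.of_nat i)%Z) by (unfold i; lia).
    assert (Hi : (i < 2 * N)%nat) by (unfold i; lia).
    rewrite Ez. replace (- Z.of_nat N + Z.of_nat i + 1)%Z with (- Z.of_nat N + Z.of_nat (S i))%Z by lia.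
    rewrite !zext_at by lia. now apply Hs. }
  assert (Hfib : forall F l v, fiber Y l (W F l v)) by (intros; apply wmap_fiber; auto).
  assert (HcPm : forall {B} (dB : B -> B -> R) D (c : B -> L), contD dB dist D c ->
    forall i j, (i < d)%nat -> (j < d)%nat -> contD dB dR D (fun x => Pm (c x) a i j)).
  { intros B dB D c Hc i j Hi Hj. apply (contD_comp dB dist dR D (fun _ => True) c (fun l => Pm l a i j)); auto.
    apply cont_L_contD; auto. }
  assert (HcPp : forall {B} (dB : B -> B -> R) D (c : B -> L), contD dB dist D c ->
    forall i j, (i < d)%nat -> (j < d)%nat -> contD dB dR D (fun x => Pp (c x) (Z.of_nat N) i j)).
  { intros B dB D c Hc i j Hi Hj. apply (contD_comp dB dist dR D (fun _ => True) c (fun l => Pp l (Z.of_nat N) i j)); auto.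
    apply cont_L_contD; auto. }
  (* The truncated problem on the sphere of radius [eta], parametrized by the unit sphere and
     normalized in the target. *)
  set (g := fun l v => nrm (bN Y) (W (fun i => f (a + Z.of_nat i)%Z l) l (vscal eta v))).
  assert (Hgm : fm dist (fun _ => True) (sphM M) (sobj Y) g).
  { apply fm_nrm; [|intros; split; auto].
    apply (contD_wmap (dP dist M) _ d n (fun p i => f (a + Z.of_nat i)%Z (fst p))
      (fun p => Pm (fst p) a) (fun p => Pp (fst p) (Z.of_nat N)) (fun p => vscal eta (snd p))).
    - apply contD_vscal; [apply contD_cR|apply (contP_v dist Hmet)].
    - intros i Hi. apply contD_f with (g := f (a + Z.of_nat i)%Z) (dist := dist) (a := fst)
        (v := fun p : L * vec => blk d (vscal eta (snd p)) i); auto.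
      + apply contP_l.
      + apply (contD_blk (dP dist M) _ d (S n) i (fun p => vscal eta (snd p))); [lia|].
        apply contD_vscal; [apply contD_cR|apply (contP_v dist Hmet)].
      + intros; apply supp_blk.
    - apply HcPm, contP_l.
    - apply HcPp, contP_l. }
  assert (Hg0 : fheq dist (eq l0) (sphM M) (sobj Y) g).
  { eapply (fheq_hmt dist Hmet); [|exact Hlin]. apply hmt_sym; auto.
    (* The straight homotopy from [f] to its linearization. Every stage is an [e]-perturbation of
       the linear problem, and [e <= e2], so rigidity at [l0] excludes zeros on the sphere. *)
    set (F := fun (t : R) (l : L) (i : nat) (x : vec) =>
      vadd (vscal (1 - t) (f (a + Z.of_nat i)%Z l x)) (vscal t (mv d (A l (a + Z.of_nat i)%Z) x))).
    set (G := fun t l v => W (F t l) l (vscal eta v)).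
    apply (hmt_ext dist (eq l0) (sphM M) (sobj Y) (fun l v => nrm (bN Y) (G 0 l v)) (fun l v => nrm (bN Y) (G 1 l v))).
    - intros l v _ _. unfold g, G, W; f_equal. apply wmap_ext; intros i Hi j _. unfold F, vadd, vscal; ring.
    - intros l v <- _. transitivity (nrm (bN Y) (vscal eta
        (wmap d n (fun i => mv d (A l0 (a + Z.of_nat i)%Z)) (Pm l0 a) (Pp l0 (Z.of_nat N)) v))); [|now apply nrm_vscal].
      f_equal. rewrite <- wmap_vscal. apply wmap_ext; intros i Hi j _. unfold F, vadd, vscal; ring.
    - apply hmt_nrm.
      + apply (contD_wmap (dH dist M) _ d n (fun q i => F (fst q) (fst (snd q)) i)
          (fun q => Pm (fst (snd q)) a) (fun q => Pp (fst (snd q)) (Z.of_nat N)) (fun q => vscal eta (snd (snd q)))).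
        * apply contD_vscal; [apply contD_cR|apply (contH_v dist Hmet)].
        * intros i Hi.
          assert (Hcb : contD (dH dist M) (dV d) (hdom (eq l0) (sphM M)) (fun q => blk d (vscal eta (snd (snd q))) i)).
          { apply (contD_blk (dH dist M) _ d (S n) i (fun q => vscal eta (snd (snd q)))); [lia|].
            apply contD_vscal; [apply contD_cR|apply (contH_v dist Hmet)]. }
          apply contD_vadd; apply contD_vscal.
          -- apply contD_minus; [apply contD_cR|apply (contH_t dist Hmet)].
          -- apply contD_f with (g := f (a + Z.of_nat i)%Z) (dist := dist) (a := fun q : R * (L * vec) => fst (snd q))
               (v := fun q : R * (L * vec) => blk d (vscal eta (snd (snd q))) i); auto.
             ++ apply contH_l.
             ++ intros; apply supp_blk.
          -- apply (contH_t dist Hmet).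
          -- apply (contD_ext _ _ _ (fun q => mv d (A l0 (a + Z.of_nat i)%Z) (blk d (vscal eta (snd (snd q))) i))).
             ++ intros x [_ [Hx _]]. now rewrite Hx.
             ++ apply contD_mvr; auto. intros; apply contD_cR.
        * apply HcPm, contH_l.
        * apply HcPp, contH_l.
      + intros t l v Ht <- Hv; split; [apply Hfib|]. intros H0.
        destruct (wmap_zero_orbit d A Pm Pp e N l0 (F t l0) (vscal eta v)) as [Ho _]; auto.
        { intros i Hi. fold a. set (x := blk d (vscal eta v) i).
          rewrite (vnorm_ext d _ (vscal (1 - t) (vsub (f (a + Z.of_nat i)%Z l0 x) (mv d (A l0 (a + Z.of_nat i)%Z) x))))
            by (intros j _; unfold F, vadd, vscal, vsub; ring).
          rewrite vnorm_scal, Rabs_pos_eq by (destruct Ht; lra).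
          assert (Hx : vnorm d (vsub (f (a + Z.of_nat i)%Z l0 x) (mv d (A l0 (a + Z.of_nat i)%Z) x)) <= e * vnorm d x).
          { apply Hrem; [apply supp_blk|]. now apply Hblk. }
          pose proof (vnorm_nonneg d (vsub (f (a + Z.of_nat i)%Z l0 x) (mv d (A l0 (a + Z.of_nat i)%Z) x))).
          destruct Ht; nra. }
        assert (Hz : sumn (n + 1) (fun i => vnorm d (zext d N (vscal eta v) (a + Z.of_nat i)%Z) ^ 2) = 0).
        { apply sumn_zero; intros i Hi. rewrite (Hrig N (zext d N (vscal eta v))); [ring|exact HNk|exact Ha| |unfold a, n in *; lia].
          eapply window_orbit_le; [|exact Ho]. apply Rmin_r. }
        rewrite (Hsumn v Hv) in Hz. nra. }
  pose proof (sphere_map_fheq dist Hmet Y M g l0 Hcomp Hpath HYb Hgm Hg0) as Hfheq.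
  pose proof (stably_fhe_of_fheq dist M Y g Hfheq) as Hstab.
  assert (HrY : bundle_rank Y M) by (apply (bundle_rank_of_fiber dist Y l0); auto).
  assert (HIp : is_bundle dist (IM d Pp kh)) by (apply is_bundle_IM; auto).
  assert (HIm : is_bundle dist (IM d Pm kl)) by (apply is_bundle_IM; auto).
  assert (HKm : is_bundle dist (KER d Pm kl)) by (apply is_bundle_KER; auto).
  destruct (bundle_rank_exists dist _ l0 HIp Hpath) as [r Hr].
  destruct (bundle_rank_exists dist _ l0 HIm Hpath) as [s Hs].
  destruct (bundle_rank_exists dist _ l0 HKm Hpath) as [k Hk].
  assert (HcA : forall z i j, (i < d)%nat -> (j < d)%nat -> cont_L dist (fun l => A l z i j)).
  { intros z i j Hi Hj l eps Heps. destruct (HcD z l zerov (supp_zerov d) eps Heps) as [del [Hd H]].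
    exists del; split; auto. intros l' Hl'.
    eapply Rle_lt_trans; [apply (entry_le_mnorm d (msub (A l' z) (A l z))); auto|].
    apply H; [apply supp_zerov|]. rewrite (vnorm_ext d (vsub zerov zerov) zerov), vnorm_zero; [lra|].
    intros m _; unfold vsub, zerov; ring. }
  assert (HKp' : biso dist (KER d Pp (Z.of_nat N)) (KER d Pp kh)).
  { apply biso_sym. replace (Z.of_nat N) with (kh + Z.of_nat (Z.to_nat (Z.of_nat N - kh)))%Z by (unfold Zge in HNk; lia).
    apply (ker_transport dist d A (Zge kh) Pp Kp ap l0); auto. intros i Hi; unfold Zge; lia. }
  assert (HKm' : biso dist (KER d Pm a) (KER d Pm kl)).
  { replace kl with (a + Z.of_nat (Z.to_nat (kl - a)))%Z at 1 by (unfold Zle in Ha; lia).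
    apply (ker_transport dist d A (Zle kl) Pm Km am l0); auto. intros i Hi; unfold Zle in *; lia. }
  assert (Hko : forall T, biso dist (bsum (bsum (bsum (IM d Pp kh) T) (bsum Y (triv 0))) (KER d Pm kl))
    (bsum (bsum (bsum (triv M) (triv 0)) (bsum (IM d Pm kl) T)) (KER d Pm kl))).
  { intros T. apply (ko_identity dist d (n * d) (IM d Pp kh) (KER d Pp kh) (KER d Pp (Z.of_nat N))
      (IM d Pm kl) (KER d Pm kl) (IM d Pm a) (KER d Pm a) T); auto; apply biso_IM_KER; auto. }
  (* The isomorphism with [T = triv 0] compares ranks, because the source sphere and [Y] both have
     rank [M]. *)
  assert (Hrs_eq : r = s).
  { assert (((r + 0) + (M + 0)) + k = ((M + 0) + (s + 0)) + k)%nat; [|lia].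
    apply (rank_biso dist _ _ l0 _ _ (Hko (triv 0))).
    - exact (rank_bsum _ _ _ _ (rank_bsum _ _ _ _ (rank_bsum _ _ _ _ Hr (rank_triv 0))
        (rank_bsum _ _ _ _ HrY (rank_triv 0))) Hk).
    - exact (rank_bsum _ _ _ _ (rank_bsum _ _ _ _ (rank_bsum _ _ _ _ (rank_triv M) (rank_triv 0))
        (rank_bsum _ _ _ _ Hs (rank_triv 0))) Hk). }
  subst s. apply (HJ r r Hr Hs).
  (* A single generator, [[Theta^M] - [Y]], expresses the difference of the two classes;
     [KER d Pm kl] is the stabilizing summand. *)
  exists ((true, (triv M, Y)) :: nil). split.
  - intros p [<-|[]]. split; [apply is_bundle_triv|]. split; [exact HYb|]. split; [|exact Hstab].
    exists M; split; [apply rank_triv|exact HrY].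
  - exists (KER d Pm kl); split; auto. apply bundle_iso_of_biso. exact (Hko (triv r)).
Qed.
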